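(* Let $n\ge 2$, let $\Gamma$ be the star graph with $n$ edges $e_j=[0,\infty)$ joined at a single vertex, and let $V$ be a real-valued function on $\Gamma$ with restrictions $V_j=V|_{e_j}$ satisfying $\int_{e_j}|V_j(x)|\,dx<\infty$ for all $1\le j\le n$. Let $H$ be the Schr\''odinger operator $H\psi=-\psi''+V\psi$ on $L_2(\Gamma)$ with Kirchhoff vertex condition, and $H_0$ the same operator with $V\equiv 0$. Then for all $\zeta$ with $\operatorname{Im}\zeta>0$ and $\zeta^2\in\rho(H)$, $$ \operatorname{Tr}\left((H_0-\zeta^2)^{-1}-(H-\zeta^2)^{-1}\right)=\frac{1}{2\zeta}\,\frac{d}{d\zeta}\ln\left(\frac{K(\zeta)}{\zeta}\prod_{j=1}^n w_j(\zeta)\right), $$ where $K(\zeta)=\sum_{j=1}^n \theta_j'(0,\zeta)/\theta_j(0,\zeta)$ and $w_j(\zeta)=\theta_j(0,\zeta)$, with $\theta_j$ the Jost solution on the edge $e_j$.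
   Context: $L_2(\Gamma)=\bigoplus_{j=1}^n L_2(e_j)$ and $\psi_j$ denotes the restriction of $\psi$ to $e_j$. The self-adjoint operator $H$ is defined through the closed quadratic form $h[\phi]=\int_\Gamma|\phi'|^2\,dx+\int_\Gamma V|\phi|^2\,dx$ with form domain $H^1(\Gamma)$, the set of continuous functions $\phi$ on $\Gamma$ (so $\phi_1(0)=\dots=\phi_n(0)$) with $\phi_j\in H^1(e_j)$ for every $j$. This corresponds to the vertex conditions $\psi_1(0)=\dots=\psi_n(0)$ and $\sum_{j=1}^n\psi_j'(0)=0$ (Kirchhoff). $H_0$ is defined in the same way with $V\equiv0$. $\rho(\cdot)$ denotes the resolvent set and $\operatorname{Tr}$ the trace of a trace class operator. Jost solution: for $\operatorname{Im}\zeta\ge0$, $\zeta\ne0$, $\theta_j(x,\zeta)$ is the unique solution on $[0,\infty)$ of $-u''+V_ju=\zeta^2u$ with $\theta_j(x,\zeta)=e^{ix\zeta}(1+o(1))$ as $x\to\infty$; a prime denotes $d/dx$. $w_j(\zeta)=\theta_j(0,\zeta)$ is the Jost function. The product $K(\zeta)\prod_j w_j(\zeta)$ is understood as the analytic function $\sum_{j}\theta_j'(0,\zeta)\prod_{k\ne j}\theta_k(0,\zeta)$ at points where some $w_j(\zeta)=0$, and $\frac{d}{d\zeta}\ln F$ means the logarithmic derivative $F'(\zeta)/F(\zeta)$. *)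

(* Defs.v *)
From HB Require Import structures.
From mathcomp Require Import all_boot all_order all_algebra.
From mathcomp Require Import complex.
From mathcomp Require Import all_classical all_reals all_analysis.

Set Implicit Arguments.
Unset Strict Implicit.
Unset Printing Implicit Defensive.

Import Order.TTheory GRing.Theory Num.Theory.
Import numFieldTopology.Exports numFieldNormedType.Exports.

Local Open Scope classical_set_scope.
Local Open Scope ring_scope.

(* An edge is [0, +oo[ with Lebesgue measure.  Functions on an edge are total
   functions on R, whose values outside [0, +oo[ are never used. *)
Definition edge (R : realType) : set R := `[0, +oo[%classic.
Arguments edge : clear implicits.

Definition gfun (R : realType) (n : nat) := 'I_n -> R -> R[i].

Section ComplexCalculus.
Context {R : realType}.
Local Notation mu := (@lebesgue_measure R).
Implicit Types (D : set R) (f g u du : R -> R[i]).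

Definition cexp (z : R[i]) : R[i] :=
  (expR (complex.Re z))%:C%C *
  Complex (cos (complex.Im z)) (sin (complex.Im z)).

Definition cintegrable D f : Prop :=
  mu.-integrable D (EFin \o (fun x => complex.Re (f x))) /\
  mu.-integrable D (EFin \o (fun x => complex.Im (f x))).

Definition cintegral D f : R[i] :=
  Complex (\int[mu]_(x in D) complex.Re (f x))
          (\int[mu]_(x in D) complex.Im (f x)).

(* u is locally absolutely continuous on [0, +oo[, with u' = du almost
   everywhere; if du is continuous, it is the pointwise derivative of u,
   one-sided at 0. *)
Definition ac_derivative u du : Prop :=
  forall x, 0 <= x ->
    cintegrable `[0, x] du /\ u x = u 0 + cintegral `[0, x] du.

(* - u'' + q u = z u on [0, +oo[, with u' = du.  As q is only integrable, du is
   absolutely continuous and the equation holds almost everywhere. *)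
Definition schrodinger_solution (q : R -> R) (z : R[i]) u du : Prop :=
  ac_derivative u du /\
  ac_derivative du (fun x => ((q x)%:C%C - z) * u x).

Definition jost_solution (q : R -> R) (zeta : R[i]) u du : Prop :=
  schrodinger_solution q (zeta ^+ 2) u du /\
  (u x / cexp ('i%C * x%:C%C * zeta) : R[i]^o) @[x --> +oo] --> (1 : R[i]^o).

End ComplexCalculus.

Section StarGraph.
Context {R : realType} {n : nat}.
Local Notation mu := (@lebesgue_measure R).
Local Notation gfun := (gfun R n).
Implicit Types (V : 'I_n -> R -> R) (f g phi psi dphi dpsi : gfun) (z : R[i]).

(* Elements of L_2(Gamma) are represented by functions up to gae_eq. *)
Definition L2 f : Prop := forall j,
  [/\ measurable_fun (edge R) (fun x => complex.Re (f j x)),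
      measurable_fun (edge R) (fun x => complex.Im (f j x)) &
      mu.-integrable (edge R) (EFin \o (fun x => Normc.normc (f j x) ^+ 2))].

Definition gae_eq f g : Prop :=
  forall j, {ae mu, forall x, edge R x -> f j x = g j x}.

Definition inner f g : R[i] :=
  \sum_(j < n) cintegral (edge R) (fun x => f j x * conjc (g j x)).

Definition normsq f : R :=
  \sum_(j < n) \int[mu]_(x in edge R) Normc.normc (f j x) ^+ 2.

Definition bounded_operator (T : gfun -> gfun) : Prop :=
  [/\ forall f, L2 f -> L2 (T f),
      forall (a : R[i]) f g, L2 f -> L2 g ->
        gae_eq (T (fun j x => a * f j x + g j x))
               (fun j x => a * T f j x + T g j x) &
      exists M : R, forall f, L2 f -> normsq (T f) <= M * normsq f].

(* L_2(Gamma) is separable and infinite-dimensional (when n > 0), so that its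
   orthonormal bases are sequences. *)
Definition orthonormal_basis (e : nat -> gfun) : Prop :=
  [/\ forall k, L2 (e k),
      forall k l, inner (e k) (e l) = (k == l)%:R &
      forall f, L2 f -> (forall k, inner f (e k) = 0) ->
        gae_eq f (fun=> fun=> 0)].

Definition hilbert_schmidt (A : gfun -> gfun) : Prop :=
  bounded_operator A /\
  forall e, orthonormal_basis e -> cvgn (series (fun k => normsq (A (e k)))).

(* The trace class in the sense of Schatten and von Neumann: products of two
   Hilbert-Schmidt operators. *)
Definition trace_class (T : gfun -> gfun) : Prop :=
  bounded_operator T /\
  exists A B, [/\ hilbert_schmidt A, hilbert_schmidt B &
    forall f, L2 f -> gae_eq (T f) (A (B f))].

Definition has_trace (T : gfun -> gfun) (t : R[i]) : Prop :=
  trace_class T /\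
  forall e, orthonormal_basis e ->
    (\sum_(0 <= k < N) inner (T (e k)) (e k) : R[i]^o) @[N --> \oo]
      --> (t : R[i]^o).

(* phi is in H^1(Gamma), with derivative dphi; phi is the continuous
   representative of its class. *)
Definition H1 phi dphi : Prop :=
  [/\ L2 phi, L2 dphi, forall j, ac_derivative (phi j) (dphi j) &
      forall i j, phi i 0 = phi j 0].

(* The sesquilinear form of h: h[phi] = form V phi dphi phi dphi. *)
Definition form V psi dpsi phi dphi : R[i] :=
  \sum_(j < n)
    (cintegral (edge R) (fun x => dpsi j x * conjc (dphi j x)) +
     cintegral (edge R) (fun x => (V j x)%:C%C * (psi j x * conjc (phi j x)))).

(* psi is in the domain of H and H psi = f, where H is the operator associated
   with the closed form h (first representation theorem). *)
Definition hamiltonian V psi f : Prop :=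
  L2 f /\ exists dpsi, H1 psi dpsi /\
    forall phi dphi, H1 phi dphi -> form V psi dpsi phi dphi = inner f phi.

(* T is a bounded two-sided inverse of H - z : D(H) -> L_2(Gamma). *)
Definition is_resolvent V z (T : gfun -> gfun) : Prop :=
  [/\ bounded_operator T,
      forall g, L2 g -> hamiltonian V (T g) (fun j x => g j x + z * T g j x) &
      forall psi f, hamiltonian V psi f ->
        gae_eq (T (fun j x => f j x - z * psi j x)) psi].

Definition resolvent_set V : set R[i] :=
  [set z | exists T, is_resolvent V z T].

(* (H - z)^-1, up to gae_eq on L2; a junk value (the identity) when z is not in
   the resolvent set. *)
Definition resolvent V z : gfun -> gfun :=
  @xget {classic (gfun -> gfun)} idfun
    [set T | is_resolvent V z T].

Definition jost_family V (theta dtheta : 'I_n -> R -> R[i] -> R[i]) : Prop :=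
  forall j (zeta : R[i]), 0 <= complex.Im zeta -> zeta != 0 ->
    jost_solution (V j) zeta (theta j ^~ zeta) (dtheta j ^~ zeta).

Definition w (theta : 'I_n -> R -> R[i] -> R[i]) (j : 'I_n) (zeta : R[i]) :=
  theta j 0 zeta.

Definition K (theta dtheta : 'I_n -> R -> R[i] -> R[i]) (zeta : R[i]) : R[i] :=
  \sum_(j < n) dtheta j 0 zeta / theta j 0 zeta.

(* The product of K and all the w_j, continued to the zeros of the w_j. *)
Definition Kw (theta dtheta : 'I_n -> R -> R[i] -> R[i]) (zeta : R[i]) : R[i] :=
  \sum_(j < n) dtheta j 0 zeta * \prod_(k < n | k != j) theta k 0 zeta.

Lemma KwE theta dtheta zeta : (forall j, w theta j zeta != 0) ->
  Kw theta dtheta zeta = K theta dtheta zeta * \prod_(j < n) w theta j zeta.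
Proof.
move=> w0; rewrite /Kw /K mulr_suml; apply: eq_bigr => j _.
by rewrite [in RHS](bigD1 j)//= mulrA /w divfK//; exact: w0.
Qed.

End StarGraph.

(* Main.v *)
(* Proof idea.  If K(zeta) prod_j w_j(zeta) = 0, then a combination of the Jost
   solutions is an eigenfunction of H; so this product does not vanish, and on
   each edge there is a solution chi_j with Wronskian -1 against theta_j whose
   initial data make the kernel theta_j(max) chi_j(min) on an edge, and
   c_jl theta_j theta_l between two edges, satisfy the vertex conditions.  Its
   operator G is the resolvent of H; let G0 be that of H_0.  By the resolvent
   identity, G0 - G = G0 V G, a product of the Hilbert-Schmidt operators
   G0 |V|^(1/2) and sgn(V) |V|^(1/2) G.  By Parseval's identity its trace in any
   orthonormal basis is the integral of V times the diagonal of the kernel of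
   G0 G.  On each edge the product rule turns this integral into that of
   chi0_j theta0_j - chi_j theta_j plus boundary terms, which cancel at the
   vertex.

   For the right-hand side, the variation of theta_j with zeta gives
     d/dzeta (chi_j(0) theta_j'(0, zeta) - chi_j'(0) theta_j(0, zeta))
       = - 1/(2 zeta) + i int_0^oo (- 1 - 2 i zeta chi_j theta_j) dx
   with chi_j fixed, and minus the sum over j of these numbers is the
   logarithmic derivative of K prod_j w_j.  Subtracting the same formula for
   V = 0, where K prod_j w_j = i n zeta, leaves 2 zeta times the sum of the
   integrals of chi0_j theta0_j - chi_j theta_j. *)
Require Import Defs.
From HB Require Import structures.
From mathcomp Require Import all_boot all_order all_algebra.
From mathcomp Require Import complex.
From mathcomp Require Import all_classical all_reals all_analysis measurable_realfun.
From mathcomp Require Import ring lra.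

Set Implicit Arguments.
Unset Strict Implicit.
Unset Printing Implicit Defensive.

Import Order.TTheory GRing.Theory Num.Theory.
Import numFieldTopology.Exports numFieldNormedType.Exports.

Local Open Scope classical_set_scope.
Local Open Scope ring_scope.

(** * Complex-valued integrals *)

Section ComplexNorm.
Context {R : realType}.
Implicit Types (z w : R[i]) (a : R).
Local Notation nc := (@Normc.normc R).
Local Notation Re := complex.Re.
Local Notation Im := complex.Im.

Lemma cReD z w : Re (z + w) = Re z + Re w. Proof. by case: z w => ? ? []. Qed.
Lemma cImD z w : Im (z + w) = Im z + Im w. Proof. by case: z w => ? ? []. Qed.
Lemma cReN z : Re (- z) = - Re z. Proof. by case: z. Qed.
Lemma cImN z : Im (- z) = - Im z. Proof. by case: z. Qed.
Lemma cReM z w : Re (z * w) = Re z * Re w - Im z * Im w.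
Proof. by case: z w => ? ? []. Qed.
Lemma cImM z w : Im (z * w) = Re z * Im w + Im z * Re w.
Proof. by case: z w => ? ? []. Qed.
Lemma Re_conjc z : Re (conjc z) = Re z. Proof. by case: z. Qed.
Lemma Im_conjc z : Im (conjc z) = - Im z. Proof. by case: z. Qed.
Lemma eqc z w : Re z = Re w -> Im z = Im w -> z = w.
Proof. by case: z w => ? ? [? ?] /= -> ->. Qed.

Lemma ncE z : nc z = Num.sqrt (Re z ^+ 2 + Im z ^+ 2). Proof. by case: z. Qed.
Lemma nc_ge0 z : 0 <= nc z. Proof. by rewrite ncE sqrtr_ge0. Qed.
Lemma ncM z w : nc (z * w) = nc z * nc w. Proof. exact: Normc.normcM. Qed.
Lemma ncV z : nc z^-1 = (nc z)^-1. Proof. exact: Normc.normcV. Qed.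
Lemma ncN z : nc (- z) = nc z. Proof. by rewrite !ncE cReN cImN !sqrrN. Qed.
Lemma nc0 : nc 0 = 0. Proof. exact: Normc.normc0. Qed.
Lemma nc1 : nc 1 = 1. Proof. exact: Normc.normc1. Qed.
Lemma nc_real a : nc a%:C%C = `|a|.
Proof. by rewrite ncE /= expr0n addr0 sqrtr_sqr. Qed.
Lemma nc_i : nc 'i%C = 1.
Proof. by rewrite ncE /= expr0n expr1n add0r sqrtr1. Qed.
Lemma nc_conjc z : nc (conjc z) = nc z.
Proof. by rewrite !ncE Re_conjc Im_conjc sqrrN. Qed.
Lemma nc_eq0 z : (nc z == 0) = (z == 0).
Proof. by apply/eqP/eqP => [/Normc.eq0_normc//|->]; rewrite nc0. Qed.
Lemma nc_gt0 z : (0 < nc z) = (z != 0).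
Proof. by rewrite lt_def nc_eq0 nc_ge0 andbT. Qed.
Lemma ncD z w : nc (z + w) <= nc z + nc w.
Proof. exact: (@le_normcD R z w). Qed.
Lemma ncB z w : nc (z - w) <= nc z + nc w.
Proof. by rewrite (le_trans (ncD _ _))// ncN. Qed.
Lemma ncBC z w : nc (z - w) = nc (w - z).
Proof. by rewrite -ncN opprB. Qed.
Lemma ncX z n : nc (z ^+ n) = nc z ^+ n.
Proof. by elim: n => [|n ih]; rewrite ?expr0 ?nc1// !exprS ncM ih. Qed.
Lemma nc_sum I (r : seq I) (P : pred I) (F : I -> R[i]) :
  nc (\sum_(i <- r | P i) F i) <= \sum_(i <- r | P i) nc (F i).
Proof.
elim/big_ind2: _ => [|x a y b xa yb|//]; first by rewrite nc0.
by rewrite (le_trans (ncD _ _))// lerD.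
Qed.
Lemma nc_Re z : `|Re z| <= nc z.
Proof.
by rewrite ncE -sqrtr_sqr ler_sqrt ?addr_ge0 ?sqr_ge0// lerDl sqr_ge0.
Qed.
Lemma nc_Im z : `|Im z| <= nc z.
Proof.
by rewrite ncE -sqrtr_sqr ler_sqrt ?addr_ge0 ?sqr_ge0// lerDr sqr_ge0.
Qed.
Lemma nc_ReIm z : nc z <= `|Re z| + `|Im z|.
Proof.
rewrite ncE -[leRHS]ger0_norm ?addr_ge0// -sqrtr_sqr ler_sqrt ?sqr_ge0//.
rewrite sqrrD !real_normK ?num_real//.
by have := mulr_ge0 (normr_ge0 (Re z)) (normr_ge0 (Im z)); lra.
Qed.
Lemma sqr_nc z : (nc z ^+ 2)%:C%C = z * conjc z.
Proof.
rewrite ncE sqr_sqrtr ?addr_ge0 ?sqr_ge0//; case: z => a b; apply: eqc => /=; ring.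
Qed.
Lemma mulcJ z : z * conjc z = (nc z ^+ 2)%:C%C. Proof. by rewrite sqr_nc. Qed.
Lemma sqr_ncD z w : nc (z + w) ^+ 2 <= 2 * nc z ^+ 2 + 2 * nc w ^+ 2.
Proof.
have h := ncD z w; have h0 := nc_ge0 (z + w).
apply: (@le_trans _ _ ((nc z + nc w) ^+ 2)).
  by rewrite ler_sqr ?nnegrE// (le_trans h0 h).
have := sqr_ge0 (nc z - nc w); nra.
Qed.

Lemma normCE z : `|z| = (nc z)%:C%C.
Proof. by rewrite normc_def ncE. Qed.

Lemma cvgcP T (F : set_system T) (FF : Filter F) (f : T -> R[i]^o) (l : R[i]^o) :
  f @ F --> l <-> forall e : R, 0 < e -> \forall x \near F, nc (f x - l) < e.
Proof.
split=> [/cvgrPdist_lt fl e e0|fl].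
  have /fl : 0 < e%:C%C :> R[i] by rewrite ltcR.
  by apply: filterS => x; rewrite /= normCE ltcR ncBC.
apply/cvgrPdist_lt => -[e e'] /=; rewrite ltcE /= => /andP[/eqP -> e0].
apply: filterS (fl _ e0) => x; rewrite ncBC => xe.
by rewrite normCE complexr0 ltcR.
Qed.

End ComplexNorm.

Section ComplexIntegral.
Context {R : realType}.
Local Notation mu := (@lebesgue_measure R).
Local Notation nc := (@Normc.normc R).
Local Notation Re := complex.Re.
Local Notation Im := complex.Im.
Implicit Types (D : set R) (f g : R -> R[i]) (h : R -> R).

Definition cmeas D f :=
  measurable_fun D (fun x => Re (f x)) /\ measurable_fun D (fun x => Im (f x)).

Notation rint D h := (mu.-integrable D (EFin \o h)).

Lemma rint_meas D h : rint D h -> measurable_fun D h.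
Proof. by move=> /measurable_int /measurable_EFinP. Qed.

Lemma rint_le D h (g : R -> R) : measurable D -> measurable_fun D h -> rint D g ->
  (forall x, D x -> `|h x| <= g x) -> rint D h.
Proof.
move=> mD mh ig hg; apply: le_integrable ig => //; first exact/measurable_EFinP.
by move=> x Dx; rewrite /= lee_fin (le_trans (hg _ Dx)) ?ler_norm.
Qed.

Lemma rint_norm D h : rint D h -> rint D (fun x => `|h x|).
Proof. exact: integrable_norm. Qed.

Lemma rintD D h (g : R -> R) : measurable D -> rint D h -> rint D g ->
  rint D (fun x => h x + g x).
Proof. by move=> mD ih ig; apply: (@integrableD _ _ _ mu D mD (EFin \o h) (EFin \o g)). Qed.

Lemma rintN D h : measurable D -> rint D h -> rint D (fun x => - h x).
Proof. by move=> mD ih; apply: (@integrableN _ _ _ mu D (EFin \o h)). Qed.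

Lemma rintB D h (g : R -> R) : measurable D -> rint D h -> rint D g ->
  rint D (fun x => h x - g x).
Proof. by move=> mD ih ig; apply: rintD => //; apply: rintN. Qed.

Lemma rintZ D a h : measurable D -> rint D h -> rint D (fun x => a * h x).
Proof. by move=> mD ih; apply: (@integrableZl _ _ _ mu D mD a (EFin \o h)). Qed.

Lemma rint_ext D h (g : R -> R) : (forall x, D x -> h x = g x) -> rint D h -> rint D g.
Proof.
move=> hg /integrableP[mh ih]; apply/integrableP; split.
  by apply: eq_measurable_fun mh => x /set_mem Dx /=; rewrite hg.
by under eq_integral => x /set_mem Dx do rewrite /= -hg//.
Qed.

Lemma rint_sum D (I : Type) (r : seq I) (P : pred I) (F : I -> R -> R) : measurable D ->
  (forall i, P i -> rint D (F i)) -> rint D (fun x => \sum_(i <- r | P i) F i x).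
Proof.
move=> mD iF; elim: r => [|i r ih].
  apply: (@rint_ext _ (fun=> 0)) => [x _|]; first by rewrite big_nil.
  exact: integrable0.
case: (boolP (P i)) => Pi; last first.
  by apply: rint_ext ih => x _; rewrite big_cons (negPf Pi).
apply: (@rint_ext _ (fun x => F i x + \sum_(i <- r | P i) F i x)) => [x _|].
  by rewrite big_cons Pi.
by apply: rintD => //; apply: iF.
Qed.

Lemma Rintegral_bigsum D (J : Type) (r : seq J) (P : pred J) (F : J -> R -> R) :
  measurable D -> (forall i, P i -> rint D (F i)) ->
  \int[mu]_(x in D) (\sum_(i <- r | P i) F i x) = \sum_(i <- r | P i) \int[mu]_(x in D) F i x.
Proof.
move=> mD iF; elim: r => [|i r ih].
  rewrite big_nil /Rintegral; under eq_integral do rewrite big_nil.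
  by rewrite integral0.
under eq_Rintegral do rewrite big_cons; rewrite big_cons; case: ifP => Pi; last exact: ih.
by rewrite RintegralD ?ih//; [exact: iF|exact: rint_sum].
Qed.

Lemma cmeasD D f g : cmeas D f -> cmeas D g -> cmeas D (fun x => f x + g x).
Proof.
move=> [f1 f2] [g1 g2]; split.
  by under eq_fun do rewrite cReD; apply: measurable_funD.
by under eq_fun do rewrite cImD; apply: measurable_funD.
Qed.

Lemma cmeasN D f : cmeas D f -> cmeas D (fun x => - f x).
Proof.
move=> [f1 f2]; split.
  by under eq_fun do rewrite cReN; apply: measurableT_comp.
by under eq_fun do rewrite cImN; apply: measurableT_comp.
Qed.

Lemma cmeasM D f g : cmeas D f -> cmeas D g -> cmeas D (fun x => f x * g x).
Proof.
move=> [f1 f2] [g1 g2]; split.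
  by under eq_fun do rewrite cReM; apply: measurable_funB; apply: measurable_funM.
by under eq_fun do rewrite cImM; apply: measurable_funD; apply: measurable_funM.
Qed.

Lemma cmeas_cst D z : cmeas D (fun=> z).
Proof. by split; apply: measurable_cst. Qed.

Lemma cmeas_real D h : measurable_fun D h -> cmeas D (fun x => (h x)%:C%C).
Proof. by move=> mh; split => //=; apply: measurable_cst. Qed.

Lemma cmeas_conj D f : cmeas D f -> cmeas D (fun x => conjc (f x)).
Proof.
move=> [f1 f2]; split.
  by under eq_fun do rewrite Re_conjc.
by under eq_fun do rewrite Im_conjc; apply: measurableT_comp.
Qed.

Lemma cmeas_sum D (I : Type) (r : seq I) (P : pred I) (F : I -> R -> R[i]) :
  (forall i, P i -> cmeas D (F i)) -> cmeas D (fun x => \sum_(i <- r | P i) F i x).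
Proof.
move=> mF; elim: r => [|i r ih].
  by under eq_fun do rewrite big_nil; apply: cmeas_cst.
case: (boolP (P i)) => Pi.
  by under eq_fun do rewrite big_cons Pi; apply: cmeasD => //; apply: mF.
by under eq_fun do rewrite big_cons (negPf Pi).
Qed.

Lemma cmeas_ext D f g : (forall x, D x -> f x = g x) -> cmeas D f -> cmeas D g.
Proof.
move=> fg [f1 f2]; split.
  by apply: eq_measurable_fun f1 => x /set_mem Dx; rewrite fg.
by apply: eq_measurable_fun f2 => x /set_mem Dx; rewrite fg.
Qed.

Lemma cmeasS D (E : set R) f : measurable D -> E `<=` D -> cmeas D f -> cmeas E f.
Proof. by move=> mE DE [f1 f2]; split; [apply: measurable_funS f1|apply: measurable_funS f2]. Qed.

Lemma cmeas_nc D f : cmeas D f -> measurable_fun D (fun x => nc (f x)).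
Proof.
move=> [f1 f2]; under eq_fun do rewrite ncE.
apply: (measurableT_comp (continuous_measurable_fun (@sqrt_continuous R))).
by apply: measurable_funD; apply: measurable_funX.
Qed.

Lemma cint_meas D f : cintegrable D f -> cmeas D f.
Proof. by move=> [f1 f2]; split; apply: rint_meas. Qed.

Lemma cint_nc D f : measurable D -> cintegrable D f -> rint D (fun x => nc (f x)).
Proof.
move=> mD fi; have mf := cint_meas fi; case: fi => f1 f2.
apply: (@rint_le _ _ (fun x => `|Re (f x)| + `|Im (f x)|)) => //.
- exact: cmeas_nc.
- by apply: rintD => //; apply: rint_norm.
- by move=> x _; rewrite ger0_norm ?nc_ge0 ?nc_ReIm.
Qed.

Lemma cint_le D f h : measurable D -> cmeas D f -> rint D h ->
  (forall x, D x -> nc (f x) <= h x) -> cintegrable D f.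
Proof.
move=> mD [f1 f2] ih fh; split.
  by apply: rint_le ih _ => // x Dx; rewrite (le_trans (nc_Re _))// fh.
by apply: rint_le ih _ => // x Dx; rewrite (le_trans (nc_Im _))// fh.
Qed.

Lemma cint_ext D f g : (forall x, D x -> f x = g x) -> cintegrable D f -> cintegrable D g.
Proof.
move=> fg [f1 f2]; split.
  by apply: rint_ext f1 => x Dx; rewrite fg.
by apply: rint_ext f2 => x Dx; rewrite fg.
Qed.

Lemma cintD D f g : measurable D -> cintegrable D f -> cintegrable D g ->
  cintegrable D (fun x => f x + g x).
Proof.
move=> mD [f1 f2] [g1 g2]; split.
  by apply: (@rint_ext _ (fun x => Re (f x) + Re (g x))) => [x _|]; [rewrite cReD|apply: rintD].
by apply: (@rint_ext _ (fun x => Im (f x) + Im (g x))) => [x _|]; [rewrite cImD|apply: rintD].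
Qed.

Lemma cintZ D z f : measurable D -> cintegrable D f -> cintegrable D (fun x => z * f x).
Proof.
move=> mD fi; apply: (@cint_le _ _ (fun x => nc z * nc (f x))) => //.
- by apply: cmeasM; [apply: cmeas_cst|apply: cint_meas].
- by apply: rintZ => //; apply: cint_nc.
- by move=> x _; rewrite ncM.
Qed.

Lemma cintN D f : measurable D -> cintegrable D f -> cintegrable D (fun x => - f x).
Proof. by move=> mD fi; apply: cint_ext (cintZ (-1) mD fi) => x _; rewrite mulN1r. Qed.

Lemma cintB D f g : measurable D -> cintegrable D f -> cintegrable D g ->
  cintegrable D (fun x => f x - g x).
Proof. by move=> mD fi gi; apply: cintD => //; apply: cintN. Qed.

Lemma cint_sum D (I : Type) (r : seq I) (P : pred I) (F : I -> R -> R[i]) : measurable D ->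
  (forall i, P i -> cintegrable D (F i)) ->
  cintegrable D (fun x => \sum_(i <- r | P i) F i x).
Proof.
move=> mD iF; apply: (@cint_le _ _ (fun x => \sum_(i <- r | P i) nc (F i x))) => //.
- by apply: cmeas_sum => i Pi; apply: cint_meas; apply: iF.
- by apply: rint_sum => // i Pi; apply: cint_nc => //; apply: iF.
- by move=> x _; apply: nc_sum.
Qed.

Lemma cint0 D : cintegrable D (fun=> 0).
Proof. by split; apply: integrable0. Qed.

Lemma eq_cintegral D f g : (forall x, D x -> f x = g x) -> cintegral D f = cintegral D g.
Proof.
by move=> fg; rewrite /cintegral; congr Complex; apply: eq_Rintegral => x /set_mem Dx;
  rewrite fg.
Qed.

Lemma cintegralD D f g : measurable D -> cintegrable D f -> cintegrable D g ->
  cintegral D (fun x => f x + g x) = cintegral D f + cintegral D g.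
Proof.
move=> mD [f1 f2] [g1 g2]; apply: eqc.
  by rewrite cReD /= -RintegralD//; apply: eq_Rintegral => x _; rewrite cReD.
by rewrite cImD /= -RintegralD//; apply: eq_Rintegral => x _; rewrite cImD.
Qed.

Lemma cintegralZ D z f : measurable D -> cintegrable D f ->
  cintegral D (fun x => z * f x) = z * cintegral D f.
Proof.
move=> mD [f1 f2]; apply: eqc.
  rewrite cReM /= -!RintegralZl// -RintegralB//; try exact: rintZ.
  by apply: eq_Rintegral => x _; rewrite cReM.
rewrite cImM /= -!RintegralZl// -RintegralD//; try exact: rintZ.
by apply: eq_Rintegral => x _; rewrite cImM.
Qed.

Lemma cintegralN D f : measurable D -> cintegrable D f ->
  cintegral D (fun x => - f x) = - cintegral D f.
Proof.
move=> mD fi; rewrite -mulN1r -cintegralZ//.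
by apply: eq_cintegral => x _; rewrite mulN1r.
Qed.

Lemma cintegralB D f g : measurable D -> cintegrable D f -> cintegrable D g ->
  cintegral D (fun x => f x - g x) = cintegral D f - cintegral D g.
Proof. by move=> mD fi gi; rewrite cintegralD ?cintegralN//; apply: cintN. Qed.

Lemma cintegral0 D : cintegral D (fun=> 0) = 0.
Proof. by rewrite /cintegral /Rintegral !integral0. Qed.

Lemma cintegral_sum D (I : Type) (r : seq I) (P : pred I) (F : I -> R -> R[i]) :
  measurable D -> (forall i, P i -> cintegrable D (F i)) ->
  cintegral D (fun x => \sum_(i <- r | P i) F i x) = \sum_(i <- r | P i) cintegral D (F i).
Proof.
move=> mD iF; elim: r => [|i r ih].
  by rewrite big_nil -[RHS](cintegral0 D); apply: eq_cintegral => x _; rewrite big_nil.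
rewrite big_cons; case: ifP => Pi.
  rewrite -ih -cintegralD//; [|exact: iF|exact: cint_sum].
  by apply: eq_cintegral => x _; rewrite big_cons Pi.
by rewrite -ih; apply: eq_cintegral => x _; rewrite big_cons Pi.
Qed.

Lemma cintegral_conj D f : measurable D -> cintegrable D f ->
  cintegral D (fun x => conjc (f x)) = conjc (cintegral D f).
Proof.
move=> mD [f1 f2]; apply: eqc.
  by rewrite Re_conjc /=; apply: eq_Rintegral => x _; rewrite Re_conjc.
rewrite Im_conjc /= -mulN1r -RintegralZl//.
by apply: eq_Rintegral => x _; rewrite Im_conjc mulN1r.
Qed.

Lemma cintegral_real D h : cintegral D (fun x => (h x)%:C%C) = (\int[mu]_(x in D) h x)%:C%C.
Proof. by rewrite /cintegral /=; congr Complex; rewrite /Rintegral integral0. Qed.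

Lemma nc_cintegral D f : measurable D -> cintegrable D f ->
  nc (cintegral D f) <= \int[mu]_(x in D) nc (f x).
Proof.
move=> mD fi; set I := cintegral D f.
have [I0|I0] := eqVneq I 0.
  by rewrite I0 nc0; apply: Rintegral_ge0 => x _; apply: nc_ge0.
pose c := conjc I / (nc I)%:C%C.
have ncI0 : nc I != 0 by rewrite nc_eq0.
have ncI0' : (nc I)%:C%C != 0 :> R[i] by apply/eqP => /complexI/eqP; apply/negP.
have cI : (nc I)%:C%C = cintegral D (fun x => c * f x).
  rewrite cintegralZ// -/I /c mulrAC [conjc I * I]mulrC mulcJ rmorphXn /= expr2.
  by rewrite mulfK.
have -> : nc I = Re (nc I)%:C%C by [].
rewrite cI; apply: le_Rintegral => //.
- by have [] := cintZ c mD fi.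
- exact: cint_nc.
- move=> x _; rewrite (le_trans (ler_norm _))// (le_trans (nc_Re _))// ncM /c ncM.
  by rewrite nc_conjc ncV nc_real ger0_norm ?nc_ge0// divff// mul1r.
Qed.

Lemma nc_cintegral_le D f h : measurable D -> cmeas D f -> rint D h ->
  (forall x, D x -> nc (f x) <= h x) -> nc (cintegral D f) <= \int[mu]_(x in D) h x.
Proof.
move=> mD mf ih fh; have fi := cint_le mD mf ih fh.
by rewrite (le_trans (nc_cintegral mD fi))// le_Rintegral//; apply: cint_nc.
Qed.

Lemma cintegral_itvB f (a b : itv_bound R) x :
  cintegrable [set` (Interval a b)] f ->
  (a <= BRight x)%O -> (BRight x <= b)%O ->
  cintegral [set` Interval a b] f =
  cintegral [set` Interval a (BRight x)] f + cintegral [set` Interval (BRight x) b] f.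
Proof.
move=> [f1 f2] ax xb; apply: eqc.
  by rewrite cReD /= -(Rintegral_itvB f1 ax xb) addrC subrK.
by rewrite cImD /= -(Rintegral_itvB f2 ax xb) addrC subrK.
Qed.

End ComplexIntegral.
Notation rint D h := ((@lebesgue_measure _).-integrable D (EFin \o h)).

(** * Absolutely continuous functions *)

Section ACReal.
Context {R : realType}.
Local Notation mu := (@lebesgue_measure R).
Implicit Types (f g u v du dv : R -> R) (x : R).

Lemma rint_patch D f : measurable D -> rint D f -> rint setT (f \_ D).
Proof.
by move=> mD fi; rewrite -restrict_EFin; apply/integrable_restrict => //=; rewrite setTI.
Qed.

Lemma integral_patchE D f :
  (\int[mu]_s ((f \_ D) s)%:E = \int[mu]_(s in D) (f s)%:E)%E.
Proof. by rewrite [RHS]integral_mkcond restrict_EFin. Qed.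

Lemma rint0S f x y : 0 <= y <= x -> rint `[0, x] f -> rint `[0, y] f.
Proof.
move=> /andP[y0 yx]; apply: integrableS => //; apply: subset_itvl.
by rewrite bnd_simp.
Qed.

Definition prim f x := \int[mu]_(t in `[0, x]) f t.

Lemma Rintegral_primB f s x : 0 <= s <= x -> rint `[0, x] f ->
  \int[mu]_(t in `[s, x]) f t = prim f x - prim f s.
Proof.
move=> /andP[s0 sx] fi; rewrite /prim Rintegral_itvB ?bnd_simp//.
rewrite Rintegral_itv_obnd_cbnd//; apply: integrableS fi => //.
by apply: subset_itvr; rewrite bnd_simp.
Qed.

Lemma prim_meas f x : 0 <= x -> rint `[0, x] f -> measurable_fun `[0, x] (prim f).
Proof.
move=> x0 fi; apply: subspace_continuous_measurable_fun => //.
exact: parameterized_integral_continuous.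
Qed.

Lemma prim_le f x y : 0 <= y <= x -> rint `[0, x] f ->
  `|prim f y| <= prim (fun t => `|f t|) x.
Proof.
move=> yx fi; have fy := rint0S yx fi.
rewrite (le_trans (le_normr_Rintegral _ fy))// /prim.
have yx' := yx; case/andP: yx' => y0 yx'.
rewrite -[leRHS](subrK (\int[mu]_(t in `[0, y]) `|f t|)) Rintegral_itvB ?bnd_simp//.
  by rewrite lerDr; apply: Rintegral_ge0.
exact: rint_norm.
Qed.

Lemma rint_prim f g x : 0 <= x -> rint `[0, x] f -> rint `[0, x] g ->
  rint `[0, x] (fun t => f t * prim g t).
Proof.
move=> x0 fi gi; pose M := prim (fun t => `|g t|) x.
apply: (@rint_le _ _ _ (fun t => M * `|f t|)) => //.
- by apply: measurable_funM; [exact: rint_meas|exact: prim_meas].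
- by apply: rintZ => //; apply: rint_norm.
- move=> t; rewrite /= in_itv /= => tx; rewrite normrM mulrC ler_wpM2r//.
  exact: prim_le.
Qed.

Definition triangle f g x (p : R * R) : R :=
  (f \_ `[0, x]) p.1 * (g \_ `[0, x]) p.2 * (p.2 <= p.1)%R%:R.

Lemma triangle_meas f g x : rint `[0, x] f -> rint `[0, x] g ->
  measurable_fun setT (triangle f g x).
Proof.
move=> fi gi; apply: measurable_funM.
  apply: measurable_funM.
    exact: (measurableT_comp (rint_meas (rint_patch _ fi)) measurable_fst).
  exact: (measurableT_comp (rint_meas (rint_patch _ gi)) measurable_snd).
rewrite (_ : (fun _ => _) = \1_[set p : R * R | p.2 <= p.1]).
  apply: measurable_indic; rewrite -[X in measurable X]setTI.
  by apply: measurable_fun_le.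
by apply/funext => p; rewrite indicE mem_setE.
Qed.

Lemma integral_triangle1 f g x t : rint `[0, x] g ->
  (\int[mu]_s (triangle f g x (t, s))%:E = (((fun t => f t * prim g t) \_ `[0, x]) t)%:E)%E.
Proof.
move=> gi; rewrite patchE; case: ifPn => [|/negbTE tx]; last first.
  under eq_integral do rewrite /triangle /= patchE tx !mul0r.
  by rewrite integral0.
rewrite mem_setE => tx; have tx' : 0 <= t <= x by move: tx; rewrite in_itv.
have gt := rint0S tx' gi.
transitivity (\int[mu]_s ((f t)%:E * ((g \_ `[0, t]) s)%:E))%E; last first.
  rewrite integralZl; [|exact: measurableT|exact: rint_patch].
  rewrite integral_patchE /prim EFinM /Rintegral fineK; first reflexivity.
  exact: (integrable_fin_num _ gt).
apply: eq_integral => s _; rewrite /triangle -EFinM -mulrA; congr EFin.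
rewrite !patchE !mem_setE /= !in_itv /= tx'; congr (_ * _).
case: (leP s t) => st; rewrite ?andbT ?andbF ?mulr1 ?mulr0//.
by case/andP: tx' => _ tx'; rewrite (le_trans st tx') andbT.
Qed.

Lemma integral_triangle2 f g x s : rint `[0, x] f ->
  (\int[mu]_t (triangle f g x (t, s))%:E =
  (((fun s => g s * \int[mu]_(t in `[s, x]) f t)%R \_ `[0, x]) s)%:E)%E.
Proof.
move=> fi; rewrite patchE; case: ifPn => [|/negbTE sx]; last first.
  under eq_integral do rewrite /triangle /= [(g \_ _) s]patchE sx mulr0 mul0r.
  by rewrite integral0.
rewrite mem_setE => sx; have sx' : 0 <= s <= x by move: sx; rewrite in_itv.
have fsx : rint `[s, x] f.
  by apply: integrableS fi => //; apply: subset_itvr; rewrite bnd_simp; case/andP: sx'.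
transitivity (\int[mu]_t ((g s)%:E * ((f \_ `[s, x]) t)%:E))%E; last first.
  rewrite integralZl; [|exact: measurableT|exact: rint_patch].
  rewrite integral_patchE EFinM fineK; first reflexivity.
  exact: (integrable_fin_num _ fsx).
apply: eq_integral => t _; rewrite /triangle -EFinM mulrAC mulrC; congr EFin.
rewrite !patchE !mem_setE /= !in_itv /= sx'; congr (_ * _).
case/andP: sx' => s0 _; case: (leP s t) => st; rewrite ?mulr1 ?mulr0//=.
by rewrite (le_trans s0 st).
Qed.

Lemma integral_patch_norm_fin D f : measurable D -> rint D f ->
  (\int[mu]_s `|((f \_ D) s)%:E|)%E \is a fin_num.
Proof.
move=> mD fi; have /integrableP[_ ffin] := rint_patch mD fi.
by rewrite ge0_fin_numE// integral_ge0.
Qed.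

Lemma triangle_int f g x : rint `[0, x] f -> rint `[0, x] g ->
  (mu \x mu)%E.-integrable setT (EFin \o triangle f g x).
Proof.
move=> fi gi.
have mh := triangle_meas fi gi.
have ifa : measurable_fun setT (fun t => (`|(f \_ `[0, x]) t|)%:E).
  by apply/measurable_EFinP; apply: measurableT_comp => //; exact: (rint_meas (rint_patch _ fi)).
have iga : measurable_fun setT (fun t => (`|(g \_ `[0, x]) t|)%:E).
  by apply/measurable_EFinP; apply: measurableT_comp => //; exact: (rint_meas (rint_patch _ gi)).
have f0 t : [set: R] t -> (0 <= (`|(f \_ `[0, x]) t|)%:E)%E by rewrite lee_fin.
have g0 t : [set: R] t -> (0 <= (`|(g \_ `[0, x]) t|)%:E)%E by rewrite lee_fin.
apply/integrable12ltyP; first exact/measurable_EFinP.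
apply: (@le_lt_trans _ _
    (\int[mu]_t ((`|(f \_ `[0, x]) t|)%:E * \int[mu]_s (`|(g \_ `[0, x]) s|)%:E))%E).
  apply: ge0_le_integral.
  - exact: measurableT.
  - by move=> t _; apply: integral_ge0.
  - apply: (@measurable_fun_fubini_tonelli_F _ _ _ _ _ mu
        (fun p => (`|triangle f g x p|)%:E)).
      by apply/measurable_EFinP; apply: measurableT_comp.
    by move=> p; rewrite lee_fin.
  - exact: emeasurable_funM.
  - move=> t _; rewrite -ge0_integralZl; [|exact: measurableT|exact: iga|exact: g0|exact: f0].
    apply: ge0_le_integral.
    + exact: measurableT.
    + by move=> s _; rewrite lee_fin.
    + apply/measurable_EFinP; apply: measurableT_comp => //.
      exact: (measurableT_comp mh (pair1_measurable t)).
    + exact: emeasurable_funM.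
    + move=> s _; rewrite lee_fin /triangle !normrM /= ler_piMr ?mulr_ge0//.
      by rewrite normr_nat lern1 leq_b1.
rewrite ge0_integralZr; [|exact: measurableT|exact: ifa|exact: f0|exact: integral_ge0].
have gfn := integral_patch_norm_fin (measurable_itv `[0, x]) gi.
have ffn := integral_patch_norm_fin (measurable_itv `[0, x]) fi.
apply: lte_mul_pinfty; [exact: integral_ge0|exact: ffn|].
by rewrite -ge0_fin_numE//; exact: integral_ge0.
Qed.

Lemma fubini_triangle f g x : rint `[0, x] f -> rint `[0, x] g ->
  \int[mu]_(t in `[0, x]) (f t * prim g t) =
  \int[mu]_(s in `[0, x]) (g s * \int[mu]_(t in `[s, x]) f t).
Proof.
move=> fi gi; rewrite /Rintegral; congr fine.
transitivity (\int[mu]_t \int[mu]_s (EFin \o triangle f g x) (t, s))%E.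
  rewrite -(integral_patchE `[0, x] (fun t => f t * prim g t)).
  by apply: eq_integral => t _; exact: (esym (integral_triangle1 f t gi)).
rewrite (Fubini (triangle_int fi gi)).
rewrite -(integral_patchE `[0, x] (fun s => g s * \int[mu]_(t in `[s, x]) f t)).
by apply: eq_integral => s _; exact: (integral_triangle2 g s fi).
Qed.

Lemma prim_mul f g x : 0 <= x -> rint `[0, x] f -> rint `[0, x] g ->
  prim (fun t => f t * prim g t + g t * prim f t) x = prim f x * prim g x.
Proof.
move=> x0 fi gi; rewrite /prim RintegralD//; try exact: rint_prim.
rewrite fubini_triangle//.
have e1 s : `[0, x]%classic s ->
    g s * \int[mu]_(t in `[s, x]) f t = prim f x * g s - g s * prim f s.
  rewrite /= in_itv /= => sx. rewrite Rintegral_primB//; ring.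
under eq_Rintegral => s /set_mem sx do rewrite e1//.
rewrite RintegralB//; [|exact: rintZ|exact: rint_prim].
by rewrite RintegralZl// subrK.
Qed.

Definition rac u du := forall x, 0 <= x -> rint `[0, x] du /\ u x = u 0 + prim du x.

Lemma rint_cst x (a : R) : rint `[0, x] (fun=> a).
Proof.
apply: continuous_compact_integrable => //; first exact: segment_compact.
by move=> y; apply: cvg_cst.
Qed.

Lemma racM u du v dv : rac u du -> rac v dv ->
  rac (fun x => u x * v x) (fun x => du x * v x + u x * dv x).
Proof.
move=> hu hv x x0; have [dui ux] := hu x x0; have [dvi vx] := hv x x0.
have e1 t : `[0, x]%classic t -> du t * v t + u t * dv t =
    v 0 * du t + u 0 * dv t + (du t * prim dv t + dv t * prim du t).
  rewrite /= in_itv /= => /andP[t0 tx].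
  have [_ ->] := hu t t0; have [_ ->] := hv t t0; ring.
have i1 : rint `[0, x] (fun t => v 0 * du t) by apply: rintZ.
have i2 : rint `[0, x] (fun t => u 0 * dv t) by apply: rintZ.
have i3 : rint `[0, x] (fun t => du t * prim dv t + dv t * prim du t).
  by apply: rintD => //; apply: rint_prim.
split.
  apply: rint_ext (fun x hx => esym (e1 x hx)) _.
  by apply: rintD => //; apply: rintD.
rewrite /prim; under eq_Rintegral => t /set_mem tx do rewrite e1//.
rewrite RintegralD//; last exact: rintD.
rewrite RintegralD// RintegralZl// RintegralZl//.
have := prim_mul x0 dui dvi; rewrite {1}/prim => ->.
rewrite ux vx /prim; ring.
Qed.

End ACReal.

Section EdgeReal.
Context {R : realType}.
Local Notation mu := (@lebesgue_measure R).
Local Notation edge := (edge R).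
Implicit Types (f g u v du dv : R -> R) (x : R).

Lemma edge_meas : measurable edge. Proof. exact: measurable_itv. Qed.
Hint Resolve edge_meas : core.

Lemma edgeP x : edge x <-> 0 <= x.
Proof. by rewrite /Defs.edge /= in_itv /= andbT. Qed.

Lemma itv0_sub x : `[0, x]%classic `<=` edge.
Proof. by move=> y; rewrite /= in_itv /= => /andP[y0 _]; apply/edgeP. Qed.

Lemma itvy_sub x : 0 <= x -> `]x, +oo[%classic `<=` edge.
Proof.
by move=> x0 y; rewrite /= in_itv /= andbT => xy; apply/edgeP; rewrite (le_trans x0)// ltW.
Qed.

Lemma rint_edge0 f x : rint edge f -> rint `[0, x] f.
Proof. by apply: integrableS => //; apply: itv0_sub. Qed.

Lemma rint_edgey f x : 0 <= x -> rint edge f -> rint `]x, +oo[ f.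
Proof. by move=> x0; apply: integrableS => //; apply: itvy_sub. Qed.

Lemma Rintegral_edge_split f x : 0 <= x -> rint edge f ->
  \int[mu]_(t in edge) f t = prim f x + \int[mu]_(t in `]x, +oo[) f t.
Proof.
by move=> x0 fi; rewrite -(Rintegral_itvB fi) ?bnd_simp// /prim [RHS]addrC subrK.
Qed.

Lemma edge_bigcup : edge = \bigcup_i `[0, i%:R]%classic.
Proof.
apply/seteqP; split=> x; last by case=> i _; apply: itv0_sub.
move=> /edgeP x0; exists (Num.bound x) => //=; rewrite in_itv /= x0 /=.
by rewrite ltW// archi_boundP.
Qed.

Lemma edge_cvg f : measurable_fun edge f -> (forall x, edge x -> 0 <= f x) ->
  (\int[mu]_(x in [set` (`[0, i%:R]%R : interval R)]) (f x)%:E @[i --> \oo] --> \int[mu]_(x in edge) (f x)%:E)%E.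
Proof.
move=> mf f0; rewrite edge_bigcup.
apply: (@ge0_nondecreasing_set_cvg_integral _ (measurableTypeR R) R (fun i => [set` (`[0, i%:R]%R : interval R)]) (EFin \o f) mu).
- move=> m n mn; apply/subsetPset; apply: subset_itvl; by rewrite bnd_simp ler_nat.
- by move=> i; apply: measurable_itv.
- move=> i; apply/measurable_EFinP; apply: measurable_funS mf => //; exact: itv0_sub.
- by move=> i x ix; rewrite lee_fin f0//; apply: itv0_sub ix.
Qed.

Lemma rint_edge_bounded f (M : R) : measurable_fun edge f ->
  (forall x, edge x -> 0 <= f x) -> (forall x, 0 <= x -> rint `[0, x] f) ->
  (forall x, 0 <= x -> prim f x <= M) ->
  rint edge f /\ \int[mu]_(x in edge) f x <= M.
Proof.
move=> mf f0 fi fM; have fc := edge_cvg mf f0.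
have le : (\int[mu]_(x in edge) (f x)%:E <= M%:E)%E.
  have /cvg_lim <- := fc => //; apply: lime_le; first by apply/cvg_ex; exists (\int[mu]_(x in edge) (f x)%:E)%E.
  apply: nearW => n; have := fM _ (ler0n R n); rewrite /prim /Rintegral -lee_fin fineK//.
  by apply: integrable_fin_num => //; apply: fi.
have fin : rint edge f.
  apply/integrableP; split; first exact/measurable_EFinP.
  rewrite (_ : (\int[mu]_(x in edge) _)%E = \int[mu]_(x in edge) (f x)%:E)%E.
    by rewrite (le_lt_trans le) ?ltry.
  by apply: eq_integral => x /set_mem xe; rewrite /= ger0_norm ?f0.
split => //; rewrite -lee_fin /Rintegral fineK//.
by apply: integrable_fin_num.
Qed.

Lemma tail_small f : rint edge f -> (forall x, edge x -> 0 <= f x) ->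
  forall e, 0 < e -> exists2 X, 0 <= X & forall x, X <= x ->
    \int[mu]_(t in `]x, +oo[) f t < e.
Proof.
move=> fi f0 e e0; have fc := edge_cvg (rint_meas fi) f0.
have ffin : (\int[mu]_(x in edge) (f x)%:E)%E \is a fin_num by apply: integrable_fin_num.
have : prim f i%:R @[i --> \oo] --> \int[mu]_(x in edge) f x.
  by apply: fine_cvg; rewrite fineK.
move=> /cvgrPdist_lt/(_ e e0)[N _ /(_ N (leqnn N)) hN].
exists N%:R => // x Nx; have x0 : 0 <= x by rewrite (le_trans _ Nx).
move: hN; rewrite (Rintegral_edge_split (ler0n R N) fi) addrAC subrr add0r.
apply: le_lt_trans; rewrite (le_trans _ (ler_norm _))//.
rewrite -[leLHS]add0r -lerBrDr.
rewrite -(lerD2l (prim f N%:R)) addrA -Rintegral_edge_split// (Rintegral_edge_split x0)// addrK addr0.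
rewrite -subr_ge0 -Rintegral_primB ?Nx ?ler0n//; last exact: rint_edge0.
apply: Rintegral_ge0 => t; rewrite /= in_itv /= => /andP[Nt _]; apply: f0.
by apply/edgeP; rewrite (le_trans _ Nt).
Qed.

Lemma rac_meas u du : rac u du -> measurable_fun edge u.
Proof.
move=> hu; rewrite edge_bigcup; apply/measurable_fun_bigcup => [i|i]; first exact: measurable_itv.
have [ui _] := hu i%:R (ler0n _ _).
apply: (@eq_measurable_fun _ _ _ _ _ (fun x => u 0 + prim du x)).
  move=> x; rewrite inE /= in_itv /= => /andP[x0 _].
  by have [_ ->] := hu x x0.
by apply: measurable_funD => //; apply: prim_meas.
Qed.

Lemma rac_C1 u du : (forall x, is_derive x 1 u (du x)) -> continuous du -> rac u du.
Proof.
move=> hd hc x x0; have ci : {within `[0, x], continuous du} by apply: continuous_subspaceT.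
split; first by apply: continuous_compact_integrable => //; exact: segment_compact.
move: x0; rewrite le_eqVlt => /predU1P[<-|x0].
  by rewrite /prim set_itv1 Rintegral_set1 addr0.
have cu : continuous u.
  move=> y; apply: differentiable_continuous; apply/derivable1_diffP.
  by have [] := hd y.
have h : (\int[mu]_(x in `[0%R, x]) (du x)%:E = (u x)%:E - (u 0)%:E)%E.
  apply: continuous_FTC2 => //.
  - split.
    + by move=> y _; have [] := hd y.
    + by apply: cvg_at_right_filter; apply: cu.
    + by apply: cvg_at_left_filter; apply: cu.
  - by move=> y _; rewrite derive1E; have [_ ->] := hd y.
rewrite /prim /Rintegral h /=; ring.
Qed.

End EdgeReal.
#[export] Hint Extern 0 (measurable (edge _)) => exact: edge_meas : core.

Section ACComplex.
Context {R : realType}.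
Local Notation mu := (@lebesgue_measure R).
Local Notation edge := (edge R).
Local Notation nc := (@Normc.normc R).
Local Notation Re := complex.Re.
Local Notation Im := complex.Im.
Local Notation ac := (@ac_derivative R).
Implicit Types (f g u v du dv : R -> R[i]) (x : R).

Lemma acP u du : ac u du <->
  rac (fun x => Re (u x)) (fun x => Re (du x)) /\ rac (fun x => Im (u x)) (fun x => Im (du x)).
Proof.
split=> [h|[h1 h2] x x0].
  split=> x x0; have [[i1 i2] ->] := h x x0; split=> //.
    by rewrite cReD.
  by rewrite cImD.
have [i1 e1] := h1 x x0; have [i2 e2] := h2 x x0; split => //.
by apply: eqc; rewrite (cReD, cImD).
Qed.

Lemma rac_ext (u du v dv : R -> R) : (forall x, edge x -> u x = v x) ->
  (forall x, edge x -> du x = dv x) -> rac u du -> rac v dv.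
Proof.
move=> uv duv hu x x0; have [i e] := hu x x0.
have h t : `[0, x]%classic t -> du t = dv t by move=> /itv0_sub; exact: duv.
split; first exact: rint_ext i.
rewrite -!uv ?e//; [|exact/edgeP|exact/edgeP].
by congr (_ + _); apply: eq_Rintegral => t /set_mem; exact: h.
Qed.

Lemma racD (u du v dv : R -> R) : rac u du -> rac v dv ->
  rac (fun x => u x + v x) (fun x => du x + dv x).
Proof.
move=> hu hv x x0; have [iu eu] := hu x x0; have [iv ev] := hv x x0.
split; first exact: rintD.
by rewrite /prim RintegralD// eu ev -/(prim du x) -/(prim dv x); ring.
Qed.

Lemma racZ a (u du : R -> R) : rac u du -> rac (fun x => a * u x) (fun x => a * du x).
Proof.
move=> hu x x0; have [iu eu] := hu x x0.
split; first exact: rintZ.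
by rewrite /prim RintegralZl// eu mulrDr.
Qed.

Lemma ac_ext u du v dv : (forall x, edge x -> u x = v x) ->
  (forall x, edge x -> du x = dv x) -> ac u du -> ac v dv.
Proof.
move=> uv duv /acP[h1 h2]; apply/acP; split.
  by apply: rac_ext h1 => x xe; rewrite ?uv ?duv.
by apply: rac_ext h2 => x xe; rewrite ?uv ?duv.
Qed.

Lemma ac_eq u du dv : (forall x, edge x -> du x = dv x) -> ac u du -> ac u dv.
Proof. by move=> h; apply: ac_ext. Qed.

Lemma acD u du v dv : ac u du -> ac v dv -> ac (fun x => u x + v x) (fun x => du x + dv x).
Proof.
move=> /acP[u1 u2] /acP[v1 v2]; apply/acP; split.
  by apply: rac_ext (racD u1 v1) => x _; rewrite cReD.
by apply: rac_ext (racD u2 v2) => x _; rewrite cImD.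
Qed.

Lemma acZ (a : R[i]) u du : ac u du -> ac (fun x => a * u x) (fun x => a * du x).
Proof.
move=> /acP[u1 u2]; apply/acP; split.
  apply: rac_ext (racD (racZ (Re a) u1) (racZ (- Im a) u2)) => x _; rewrite cReM; ring.
apply: rac_ext (racD (racZ (Re a) u2) (racZ (Im a) u1)) => x _; rewrite cImM; ring.
Qed.

Lemma acN u du : ac u du -> ac (fun x => - u x) (fun x => - du x).
Proof.
by move=> h; apply: ac_ext (acZ (-1) h) => x _; rewrite mulN1r.
Qed.

Lemma acB u du v dv : ac u du -> ac v dv -> ac (fun x => u x - v x) (fun x => du x - dv x).
Proof. by move=> hu hv; apply: acD => //; apply: acN. Qed.

Lemma acM u du v dv : ac u du -> ac v dv ->
  ac (fun x => u x * v x) (fun x => du x * v x + u x * dv x).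
Proof.
move=> /acP[u1 u2] /acP[v1 v2]; apply/acP; split.
  apply: rac_ext (racD (racM u1 v1) (racZ (-1) (racM u2 v2))) => x _; rewrite ?cReD !cReM; ring.
apply: rac_ext (racD (racM u1 v2) (racM u2 v1)) => x _; rewrite ?cImD !cImM; ring.
Qed.

Lemma ac_cst c : ac (fun=> c) (fun=> 0).
Proof. by move=> x x0; split; [exact: cint0|rewrite cintegral0 addr0]. Qed.

Lemma ac_conj u du : ac u du -> ac (fun x => conjc (u x)) (fun x => conjc (du x)).
Proof.
move=> /acP[u1 u2]; apply/acP; split.
  by apply: rac_ext u1 => x _; rewrite Re_conjc.
by apply: rac_ext (racZ (-1) u2) => x _; rewrite Im_conjc mulN1r.
Qed.

Lemma ac_meas u du : ac u du -> cmeas edge u.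
Proof. by move=> /acP[/rac_meas h1 /rac_meas h2]; split. Qed.

Lemma ac_int u du x : ac u du -> cintegrable `[0, x] du.
Proof.
have [x0|x0 _] := leP 0 x; first by move=> /(_ x x0)[].
by rewrite set_itv_ge ?bnd_simp -?ltNge//; split; apply: integrable_set0.
Qed.

Lemma dac_meas u du : ac u du -> cmeas edge du.
Proof.
move=> hu; rewrite edge_bigcup; split; apply/measurable_fun_bigcup => [i|i];
  try exact: measurable_itv; by have [] := cint_meas (ac_int i%:R hu).
Qed.

Lemma cint_edge0 f x : cintegrable edge f -> cintegrable `[0, x] f.
Proof. by move=> [f1 f2]; split; apply: rint_edge0. Qed.

Lemma cint_edgey f x : 0 <= x -> cintegrable edge f -> cintegrable `]x, +oo[ f.
Proof. by move=> x0 [f1 f2]; split; apply: rint_edgey. Qed.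

Lemma cintegral_edge_split f x : 0 <= x -> cintegrable edge f ->
  cintegral edge f = cintegral `[0, x] f + cintegral `]x, +oo[ f.
Proof.
by move=> x0 fi; rewrite -cintegral_itvB ?bnd_simp.
Qed.

Lemma ac_tail u du x : ac u du -> cintegrable edge du -> 0 <= x ->
  u x = u 0 + cintegral edge du - cintegral `]x, +oo[ du.
Proof.
move=> hu hi x0; have [_ ->] := hu x x0; rewrite (cintegral_edge_split x0 hi); ring.
Qed.

Lemma nc_tail f x : 0 <= x -> cintegrable edge f ->
  nc (cintegral `]x, +oo[ f) <= \int[mu]_(t in `]x, +oo[) nc (f t).
Proof.
by move=> x0 fi; apply: nc_cintegral => //; apply: cint_edgey.
Qed.

Lemma ac_lim u du : ac u du -> cintegrable edge du ->
  forall e : R, 0 < e -> exists2 X, 0 <= X & forall x, X <= x ->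
    nc (u x - (u 0 + cintegral edge du)) < e.
Proof.
move=> hu hi e e0; have hn : rint edge (fun t => nc (du t)) by exact: cint_nc.
have [X X0 hX] := tail_small hn (fun t _ => nc_ge0 (du t)) e0.
exists X => // x Xx; have x0 := le_trans X0 Xx.
rewrite (ac_tail hu hi x0) addrAC subrr add0r ncN.
by apply: le_lt_trans (hX _ Xx); apply: nc_tail.
Qed.

Lemma rint_itv_sub f (A : interval R) : [set` A] `<=` edge -> cintegrable edge f ->
  \int[mu]_(t in [set` A]) nc (f t) <= \int[mu]_(t in edge) nc (f t).
Proof.
move=> AE fi; have hn : rint edge (fun t => nc (f t)) by exact: cint_nc.
have hA : rint [set` A] (fun t => nc (f t)).
  by apply: integrableS hn => //; exact: measurable_itv.
rewrite -lee_fin /Rintegral !fineK; try by apply: integrable_fin_num => //; exact: measurable_itv.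
apply: ge0_subset_integral => //.
- exact: (measurable_int _ hn).
- by move=> t _; rewrite lee_fin nc_ge0.
Qed.

Lemma ac_bounded u du : ac u du -> cintegrable edge du ->
  forall x, 0 <= x -> nc (u x) <= nc (u 0) + \int[mu]_(t in edge) nc (du t).
Proof.
move=> hu hi x x0; have [i ->] := hu x x0.
rewrite (le_trans (ncD _ _))// lerD2l (le_trans (nc_cintegral _ i))//.
by apply: rint_itv_sub => //; exact: itv0_sub.
Qed.

Lemma ac_bounded0 u du X : ac u du -> exists M, forall x, 0 <= x <= X -> nc (u x) <= M.
Proof.
move=> hu; exists (nc (u 0) + prim (fun t => nc (du t)) X) => x /andP[x0 xX].
have X0 := le_trans x0 xX; have [iX _] := hu X X0; have [i ->] := hu x x0.
rewrite (le_trans (ncD _ _))// lerD2l (le_trans (nc_cintegral _ i))//.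
have iX' : rint `[0, X] (fun t => nc (du t)) by exact: cint_nc.
rewrite -subr_ge0 -[X in _ <= _ - X]/(prim _ x) -Rintegral_primB ?x0//.
by apply: Rintegral_ge0 => t _; apply: nc_ge0.
Qed.

Lemma cint_const_edge (c : R) : rint edge (fun=> c) -> c = 0.
Proof.
move=> ci; apply/eqP/negPn/negP => c0.
have /integrable_lty/= := rint_norm ci => /(_ edge_meas).
rewrite integral_cst//= /Defs.edge lebesgue_measure_itv /= ltry.
by rewrite oppr0 adde0 /= mulr_infty gtr0_sg ?normr_gt0// mul1e ltxx.
Qed.

Lemma ac_lim0 u du : ac u du -> cintegrable edge du -> cintegrable edge u ->
  u 0 + cintegral edge du = 0.
Proof.
move=> hu hi ui; set l := (u 0 + _); apply/eqP/negPn/negP => l0.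
have e0 : 0 < nc l / 2 by rewrite divr_gt0// nc_gt0.
have [X X0 hX] := ac_lim hu hi e0.
have un : rint edge (fun x => nc (u x)) by exact: cint_nc.
have : rint edge (fun=> nc l / 2).
  have h : rint edge (\1_[set` (`[0, X]%R : interval R)]).
    by apply: (@integrableS _ _ _ mu setT) => //; exact: integrable_indic_itv.
  apply: (@rint_le _ _ _ (fun x => nc (u x) + nc l * \1_[set` (`[0, X]%R : interval R)] x)) => //.
    by apply: rintD => //; exact: rintZ.
  move=> x /edgeP x0; rewrite (ger0_norm (ltW e0)) indicE mem_setE in_itv /= x0 /=.
  have [xX|Xx] := leP x X.
    by rewrite mulr1; have := nc_ge0 (u x); have := nc_ge0 l; lra.
  rewrite mulr0 addr0.
  have hy : nc l <= nc (u x) + nc (l - u x) by rewrite -{1}(subrK (u x) l) addrC ncD.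
  by move: (hX _ (ltW Xx)); rewrite ncBC -/l; lra.
by move=> /cint_const_edge /eqP; rewrite gt_eqF.
Qed.

Lemma ac_tail0 u du x : ac u du -> cintegrable edge du -> cintegrable edge u -> 0 <= x ->
  u x = - cintegral `]x, +oo[ du.
Proof. by move=> hu hi ui x0; rewrite (ac_tail hu hi x0) (ac_lim0 hu hi ui) sub0r. Qed.

Lemma ac_total0 u du : ac u du -> cintegrable edge du -> cintegrable edge u ->
  cintegral edge du = - u 0.
Proof. by move=> hu hi ui; have /eqP := ac_lim0 hu hi ui; rewrite addrC addr_eq0 => /eqP. Qed.

End ACComplex.

Section Cexp.
Context {R : realType}.
Local Notation mu := (@lebesgue_measure R).
Local Notation edge := (edge R).
Local Notation nc := (@Normc.normc R).
Local Notation Re := complex.Re.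
Local Notation Im := complex.Im.
Local Notation ac := (@ac_derivative R).
Local Notation cexp := (@cexp R).

Lemma Re_cexp z : Re (cexp z) = expR (Re z) * cos (Im z).
Proof. by rewrite /cexp cReM /= mul0r subr0. Qed.
Lemma Im_cexp z : Im (cexp z) = expR (Re z) * sin (Im z).
Proof. by rewrite /cexp cImM /= mul0r addr0. Qed.
Lemma cexpD z w : cexp (z + w) = cexp z * cexp w.
Proof.
apply: eqc; rewrite (Re_cexp, Im_cexp) (cReM, cImM) !Re_cexp !Im_cexp cReD cImD expRD (cosD, sinD); ring.
Qed.
Lemma cexp0 : cexp 0 = 1.
Proof. by apply: eqc; rewrite (Re_cexp, Im_cexp) /= expR0 (cos0, sin0) ?mulr1 ?mulr0. Qed.
Lemma cexpN z : cexp z * cexp (- z) = 1.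
Proof. by rewrite -cexpD subrr cexp0. Qed.
Lemma cexp_neq0 z : cexp z != 0.
Proof. by apply/eqP => h; have /eqP := cexpN z; rewrite h mul0r eq_sym oner_eq0. Qed.
Lemma cexpNV z : cexp (- z) = (cexp z)^-1.
Proof. by apply: (mulfI (cexp_neq0 z)); rewrite cexpN divff// cexp_neq0. Qed.
Lemma nc_cexp z : nc (cexp z) = expR (Re z).
Proof.
rewrite ncE Re_cexp Im_cexp !exprMn -mulrDr cos2Dsin2 mulr1 sqrtr_sqr ger0_norm// expR_ge0.
Qed.

Lemma continuous_scaled (g : R -> R) (a : R) : continuous g ->
  continuous (fun x => g (a * x)).
Proof.
move=> gc x; apply: (@continuous_comp _ _ _ (fun x => a * x) g); last exact: gc.
by apply: cvgM; [exact: cvg_cst|exact: cvg_id].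
Qed.

Lemma rac_expR (a : R) : rac (fun x => expR (a * x)) (fun x => a * expR (a * x)).
Proof.
apply: rac_C1.
  by move=> x; apply: trigger_derive; rewrite /GRing.scale /= mulr1 mulrC.
move=> x; apply: cvgM; first exact: cvg_cst.
by apply: continuous_scaled; exact: continuous_expR.
Qed.

Lemma rac_cos (a : R) : rac (fun x => cos (a * x)) (fun x => - (a * sin (a * x))).
Proof.
apply: rac_C1.
  by move=> x; apply: trigger_derive; rewrite /GRing.scale /= mulr1 mulrC mulrN.
move=> x; apply: cvgN; apply: cvgM; first exact: cvg_cst.
by apply: continuous_scaled; exact: continuous_sin.
Qed.

Lemma rac_sin (a : R) : rac (fun x => sin (a * x)) (fun x => a * cos (a * x)).
Proof.
apply: rac_C1.
  by move=> x; apply: trigger_derive; rewrite /GRing.scale /= mulr1 mulrC.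
move=> x; apply: cvgM; first exact: cvg_cst.
by apply: continuous_scaled; exact: continuous_cos.
Qed.

Lemma ac_cexp c : ac (fun x => cexp (c * x%:C%C)) (fun x => c * cexp (c * x%:C%C)).
Proof.
have eR x : Re (c * x%:C%C) = Re c * x by rewrite cReM /= mulr0 subr0.
have eI x : Im (c * x%:C%C) = Im c * x by rewrite cImM /= mulr0 add0r.
apply/acP; split.
  apply: rac_ext (racM (rac_expR (Re c)) (rac_cos (Im c))) => x _.
    by rewrite Re_cexp eR eI.
  rewrite cReM Re_cexp Im_cexp eR eI; ring.
apply: rac_ext (racM (rac_expR (Re c)) (rac_sin (Im c))) => x _.
  by rewrite Im_cexp eR eI.
rewrite cImM Re_cexp Im_cexp eR eI; ring.
Qed.

Lemma rint_expN (k : R) : 0 < k -> rint edge (fun x => expR (- k * x)) /\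
  \int[mu]_(x in edge) expR (- k * x) <= k^-1.
Proof.
move=> k0; have h := rac_expR (- k).
have i x : 0 <= x -> rint `[0, x] (fun x => expR (- k * x)).
  move=> x0; have [i _] := h x x0; apply: rint_ext (rintZ (- k^-1) (measurable_itv _) i) => t _.
  by rewrite mulrA mulrNN mulVf ?mul1r// gt_eqF.
apply: rint_edge_bounded => //.
  exact: rac_meas h.
move=> x x0; have [_ e] := h x x0.
have : prim (fun x => - k * expR (- k * x)) x = - k * prim (fun x => expR (- k * x)) x.
  by rewrite /prim RintegralZl//; exact: i.
move=> e'; move: e; rewrite e' mulr0 expR0 => e.
rewrite -[k^-1]mulr1 ler_pdivlMl//.
have := expR_ge0 (- k * x); lra.
Qed.

End Cexp.

(** * Convolution with a decaying exponential *)

Section Convolution.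
Context {R : realType}.
Local Notation mu := (@lebesgue_measure R).
Local Notation edge := (edge R).
Implicit Types (p : R -> R) (k x : R).

Definition cvl k p x := \int[mu]_(y in edge) (expR (- k * `|x - y|) * p y).
Definition cvl0 k p x := \int[mu]_(y in `[0, x]) (expR (- k * (x - y)) * p y).
Definition cvly k p x := \int[mu]_(y in `]x, +oo[) (expR (- k * (y - x)) * p y).

Lemma rint_bounded_mul (g : R -> R) p (D : set R) : measurable D -> measurable_fun D g ->
  (forall y, D y -> `|g y| <= 1) -> rint D p -> rint D (fun y => g y * p y).
Proof.
move=> mD mg g1 ip; apply: (rint_le _ _ (rint_norm ip)) => //.
  by apply: measurable_funM => //; exact: rint_meas.
by move=> y Dy; rewrite normrM ler_piMl// g1.
Qed.

Lemma expR_abs_meas k x (D : set R) : measurable_fun D (fun y => expR (- k * `|x - y|)).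
Proof.
apply: measurableT_comp => //; apply: measurable_funM => //.
by apply: measurableT_comp => //; apply: measurable_funB.
Qed.

Lemma expR_abs_le1 k x y : 0 < k -> `|expR (- k * `|x - y|)| <= 1.
Proof.
move=> k0; rewrite ger0_norm ?expR_ge0// -expR0 ler_expR mulNr oppr_le0.
by rewrite mulr_ge0// ltW.
Qed.

Lemma cvl_int k p x : 0 < k -> rint edge p ->
  rint edge (fun y => expR (- k * `|x - y|) * p y).
Proof.
move=> k0; apply: rint_bounded_mul => //; first exact: expR_abs_meas.
by move=> y _; apply: expR_abs_le1.
Qed.

Lemma cvlE k p x : 0 < k -> rint edge p -> 0 <= x -> cvl k p x = cvl0 k p x + cvly k p x.
Proof.
move=> k0 ip x0.
have e1 : cvl0 k p x = prim (fun y => expR (- k * `|x - y|) * p y) x.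
  apply: eq_Rintegral => y; rewrite inE /= in_itv /= => /andP[y0 yx].
  by rewrite ger0_norm ?subr_ge0.
have e2 : cvly k p x = \int[mu]_(y in `]x, +oo[) (expR (- k * `|x - y|) * p y).
  apply: eq_Rintegral => y; rewrite inE /= in_itv /= andbT => xy.
  by rewrite distrC gtr0_norm ?subr_gt0.
by rewrite e1 e2; exact: (Rintegral_edge_split x0 (cvl_int x k0 ip)).
Qed.

Lemma cvl0_ge0 k p x : (forall y, edge y -> 0 <= p y) -> 0 <= cvl0 k p x.
Proof.
move=> p0; apply: Rintegral_ge0 => y yx; rewrite mulr_ge0 ?expR_ge0// p0//.
exact: itv0_sub yx.
Qed.

Lemma cvly_ge0 k p x : 0 <= x -> (forall y, edge y -> 0 <= p y) -> 0 <= cvly k p x.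
Proof.
move=> x0 p0; apply: Rintegral_ge0 => y yx; rewrite mulr_ge0 ?expR_ge0// p0//.
exact: itvy_sub yx.
Qed.

Lemma cvl_ge0 k p x : (forall y, edge y -> 0 <= p y) -> 0 <= cvl k p x.
Proof. by move=> p0; apply: Rintegral_ge0 => y yx; rewrite mulr_ge0 ?expR_ge0// p0. Qed.

Lemma cvl0_le k p x : 0 < k -> rint edge p -> (forall y, edge y -> 0 <= p y) -> 0 <= x ->
  cvl0 k p x <= cvl k p x.
Proof. by move=> k0 ip p0 x0; rewrite cvlE// lerDl cvly_ge0. Qed.

Lemma cvly_le k p x : 0 < k -> rint edge p -> (forall y, edge y -> 0 <= p y) -> 0 <= x ->
  cvly k p x <= cvl k p x.
Proof. by move=> k0 ip p0 x0; rewrite cvlE// lerDr cvl0_ge0. Qed.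

Lemma rac_prim p : (forall x, 0 <= x -> rint `[0, x] p) -> rac (prim p) p.
Proof.
move=> ip x x0; split; first exact: ip.
by rewrite {2}/prim set_itv1 Rintegral_set1 add0r.
Qed.

Lemma rint0_exp_mul k p x : rint `[0, x] p -> rint `[0, x] (fun y => expR (k * y) * p y).
Proof.
move=> ip; apply: (@rint_le _ _ _ (fun y => expR (`|k| * x) * `|p y|)) => //.
- apply: measurable_funM; last exact: rint_meas.
  by apply: measurableT_comp => //; apply: measurable_funM.
- by apply: rintZ => //; apply: rint_norm.
- move=> y; rewrite /= in_itv /= => /andP[y0 yx]; rewrite normrM ler_wpM2r//.
  rewrite ger0_norm ?expR_ge0// ler_expR (le_trans (ler_norm _))// normrM.
  by rewrite ler_wpM2l// ger0_norm.
Qed.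

Lemma cvl0E k p x : 0 <= x -> rint `[0, x] p ->
  cvl0 k p x = expR (- k * x) * prim (fun y => expR (k * y) * p y) x.
Proof.
move=> x0 ip; rewrite /prim -RintegralZl//; last exact: rint0_exp_mul.
by apply: eq_Rintegral => y _; rewrite mulrA -expRD; congr (expR _ * _); ring.
Qed.

Lemma cvlyE k p x : 0 < k -> rint edge p -> 0 <= x -> cvly k p x =
  expR (k * x) * (\int[mu]_(y in edge) (expR (- k * y) * p y) - prim (fun y => expR (- k * y) * p y) x).
Proof.
move=> k0 ip x0.
have i1 : rint edge (fun y => expR (- k * y) * p y).
  apply: rint_bounded_mul => //.
    by apply: measurableT_comp => //; apply: measurable_funM.
  move=> y /edgeP y0; rewrite ger0_norm ?expR_ge0// -expR0 ler_expR mulNr oppr_le0.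
  by rewrite mulr_ge0// ltW.
rewrite (Rintegral_edge_split x0 i1) addrAC subrr add0r -RintegralZl//; last exact: rint_edgey.
by apply: eq_Rintegral => y _; rewrite mulrA -expRD; congr (expR _ * _); ring.
Qed.

Lemma rac_cvl0 k p : (forall x, 0 <= x -> rint `[0, x] p) ->
  rac (cvl0 k p) (fun x => p x - k * cvl0 k p x).
Proof.
move=> ip.
have hp : rac (prim (fun y => expR (k * y) * p y)) (fun y => expR (k * y) * p y).
  by apply: rac_prim => x x0; apply: rint0_exp_mul; exact: ip.
have h := racM (rac_expR (- k)) hp.
apply: rac_ext h => x /edgeP x0; rewrite cvl0E//; try exact: ip.
have E : expR (- k * x) * expR (k * x) = 1 by rewrite -expRD mulNr addNr expR0.
by rewrite [X in _ + X]mulrA E; ring.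
Qed.

Lemma rac_cvly k p : 0 < k -> rint edge p ->
  rac (cvly k p) (fun x => k * cvly k p x - p x).
Proof.
move=> k0 ip.
have h1 : rac (prim (fun y => expR (- k * y) * p y)) (fun y => expR (- k * y) * p y).
  by apply: rac_prim => x x0; apply: rint0_exp_mul; exact: rint_edge0.
have e : rac (fun=> \int[mu]_(y in edge) (expR (- k * y) * p y)) (fun=> 0).
  by move=> x x0; split; [exact: rint_cst|rewrite /prim Rintegral_cst// mul0r addr0].
apply: rac_ext (racM (rac_expR k) (racD e (racZ (-1) h1))) => x /edgeP x0; rewrite cvlyE//.
  by rewrite mulN1r.
have E : expR (k * x) * expR (- k * x) = 1 by rewrite -expRD mulNr addrN expR0.
have E' : expR (k * x) * (-1 * (expR (- k * x) * p x)) =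
    - (expR (k * x) * expR (- k * x)) * p x by ring.
by rewrite add0r E' E; ring.
Qed.

Lemma primB p q x : rint `[0, x] p -> rint `[0, x] q ->
  prim (fun t => p t - q t) x = prim p x - prim q x.
Proof. by move=> ip iq; rewrite /prim RintegralB. Qed.

Lemma primZ k p x : rint `[0, x] p -> prim (fun t => k * p t) x = k * prim p x.
Proof. by move=> ip; rewrite /prim RintegralZl. Qed.

Let arith0 (c N t k q : R) : c = N - t - k * q -> 0 <= t -> 0 <= c -> k * q <= N.
Proof. lra. Qed.

Let arithy (c c0 N t k q : R) : c = c0 + (k * q - (N - t)) -> c <= t -> 0 <= c0 -> k * q <= N.
Proof. lra. Qed.

Lemma cvl_rint k p : 0 < k -> rint edge p -> (forall y, edge y -> 0 <= p y) ->
  rint edge (cvl k p) /\ \int[mu]_(x in edge) cvl k p x <= 2 / k * \int[mu]_(x in edge) p x.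
Proof.
move=> k0 ip p0; set N := \int[mu]_(x in edge) p x.
have h0 : rac (cvl0 k p) (fun x => p x - k * cvl0 k p x).
  by apply: rac_cvl0 => x _; exact: rint_edge0.
have hy := rac_cvly k0 ip.
have pN x : 0 <= x -> prim p x = N - \int[mu]_(y in `]x, +oo[) p y.
  by move=> x0; rewrite /N (Rintegral_edge_split x0 ip) addrK.
have tail0 x : 0 <= x -> 0 <= \int[mu]_(y in `]x, +oo[) p y.
  by move=> x0; apply: Rintegral_ge0 => y /(itvy_sub x0); exact: p0.
have i0 x : 0 <= x -> rint `[0, x] (cvl0 k p).
  move=> x0; have [i _] := h0 x x0.
  apply: rint_ext (rintZ (- k^-1) (measurable_itv _) (rintB (measurable_itv _) i (rint_edge0 x ip))) => t _.
  by field; rewrite gt_eqF.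
have iy x : 0 <= x -> rint `[0, x] (cvly k p).
  move=> x0; have [i _] := hy x x0.
  apply: rint_ext (rintZ k^-1 (measurable_itv _) (rintD (measurable_itv _) i (rint_edge0 x ip))) => t _.
  by field; rewrite gt_eqF.
have [r0 l0] : rint edge (cvl0 k p) /\ \int[mu]_(x in edge) cvl0 k p x <= k^-1 * N.
  apply: rint_edge_bounded; [exact: rac_meas h0|by move=> x _; exact: cvl0_ge0|exact: i0|].
  move=> x x0; rewrite ler_pdivlMl//; case: (h0 x x0) => i.
  have z : cvl0 k p 0 = 0 by rewrite /cvl0 set_itv1 Rintegral_set1.
  have -> : prim (fun x => p x - k * cvl0 k p x) x = prim p x - k * prim (cvl0 k p) x.
    rewrite primB; [|exact: rint_edge0|apply: rintZ; [exact: measurable_itv|exact: i0]].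
    by rewrite primZ; last exact: i0.
  rewrite z add0r pN// => e.
  exact: (arith0 e (tail0 x x0) (cvl0_ge0 k x p0)).
have [ry ly] : rint edge (cvly k p) /\ \int[mu]_(x in edge) cvly k p x <= k^-1 * N.
  apply: rint_edge_bounded; [exact: rac_meas hy|by move=> x /edgeP x0; exact: cvly_ge0|exact: iy|].
  move=> x x0; rewrite ler_pdivlMl//; case: (hy x x0) => i.
  have -> : prim (fun x => k * cvly k p x - p x) x = k * prim (cvly k p) x - prim p x.
    rewrite primB; [|apply: rintZ; [exact: measurable_itv|exact: iy]|exact: rint_edge0].
    by rewrite primZ; last exact: iy.
  rewrite pN// => e.
  have : cvly k p x <= \int[mu]_(y in `]x, +oo[) p y.
    apply: le_Rintegral => //; last 1 first.
    - move=> y; rewrite /= in_itv /= andbT => xy; rewrite ler_piMl//.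
        by apply/p0/edgeP; rewrite (le_trans x0)// ltW.
      by rewrite -expR0 ler_expR mulNr oppr_le0 mulr_ge0// ?ltW// subr_gt0.
    - apply: rint_ext (rint_edgey x0 (cvl_int x k0 ip)) => y.
      by rewrite /= in_itv /= andbT => xy; rewrite distrC gtr0_norm ?subr_gt0.
    - exact: rint_edgey.
  by move=> le; exact: (arithy e le (cvly_ge0 k (lexx _) p0)).
split.
  by apply: rint_ext (rintD _ r0 ry) => // x /edgeP x0; rewrite cvlE.
have -> : \int[mu]_(x in edge) cvl k p x = \int[mu]_(x in edge) (cvl0 k p x + cvly k p x).
  by apply: eq_Rintegral => x /set_mem /edgeP x0; rewrite cvlE.
rewrite RintegralD; [|exact: edge_meas|exact: r0|exact: ry].
have -> : 2 / k * N = k^-1 * N + k^-1 * N by ring.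
exact: lerD l0 ly.
Qed.

Lemma expR_abs_rint k x : 0 < k -> 0 <= x -> rint edge (fun y => expR (- k * `|x - y|)) /\
  \int[mu]_(y in edge) expR (- k * `|x - y|) <= 2 / k.
Proof.
move=> k0 x0; have [ie le] := @rint_expN R k k0.
have i : rint edge (fun y => expR (- k * `|x - y|)).
  apply: (@rint_le _ _ _ (fun y => expR (k * x) * expR (- k * y))) => //.
  - exact: expR_abs_meas.
  - exact: rintZ.
  move=> y _; rewrite ger0_norm ?expR_ge0// -expRD ler_expR.
  have := ler_norm (y - x); rewrite distrC => h.
  rewrite -subr_ge0; have -> : k * x + - k * y - - k * `|x - y| = k * (`|x - y| - (y - x)) by ring.
  by rewrite mulr_ge0 ?subr_ge0// ltW.
split => //; rewrite (Rintegral_edge_split x0 i).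
have -> : prim (fun y => expR (- k * `|x - y|)) x = k^-1 * (1 - expR (- k * x)).
  have [i1 e1] := @rac_expR R k x x0.
  have -> : 1 - expR (- k * x) = expR (- k * x) * prim (fun y => k * expR (k * y)) x.
    have e2 : prim (fun y => k * expR (k * y)) x = expR (k * x) - 1.
      by rewrite e1 mulr0 expR0 addrC addKr.
    by rewrite e2 mulrBr mulr1 -expRD mulNr addNr expR0.
  rewrite /prim mulrA -RintegralZl//; apply: eq_Rintegral => y.
  rewrite inE /= in_itv /= => /andP[y0 yx]; rewrite ger0_norm ?subr_ge0//.
  have -> : - k * (x - y) = - k * x + k * y by ring.
  by rewrite expRD; field; rewrite gt_eqF.
have -> : \int[mu]_(y in `]x, +oo[) expR (- k * `|x - y|) =
    expR (k * x) * \int[mu]_(y in `]x, +oo[) expR (- k * y).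
  rewrite -RintegralZl//; last exact: rint_edgey.
  apply: eq_Rintegral => y; rewrite inE /= in_itv /= andbT => xy.
  by rewrite distrC gtr0_norm ?subr_gt0// -expRD; congr expR; ring.
have [i1 e1] := @rac_expR R (- k) x x0.
have e2 : prim (fun y => expR (- k * y)) x = k^-1 * (1 - expR (- k * x)).
  have i2 : rint `[0, x] (fun y => expR (- k * y)) by exact: rint_edge0.
  by rewrite e1 mulr0 expR0 /prim RintegralZl//; field; rewrite gt_eqF.
have := Rintegral_edge_split x0 ie; rewrite e2 => e3.
have E : expR (k * x) * expR (- k * x) = 1 by rewrite -expRD mulNr addrN expR0.
have hT : \int[mu]_(y in `]x, +oo[) expR (- k * y) <= k^-1 * expR (- k * x).
  by move: le; rewrite e3; lra.
have hT2 : expR (k * x) * \int[mu]_(y in `]x, +oo[) expR (- k * y) <= k^-1.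
  by rewrite (le_trans (ler_wpM2l (expR_ge0 _) hT))// mulrCA E mulr1.
have h0 : 0 <= k^-1 * expR (- k * x) by rewrite mulr_ge0 ?expR_ge0// invr_ge0 ltW.
have -> : 2 / k = k^-1 + k^-1 by ring.
by apply: lerD hT2; rewrite mulrBr mulr1 lerBlDr lerDl.
Qed.

End Convolution.

(** * Growing solutions by Picard iteration *)

Lemma le_of_eq (R : numDomainType) (a b : R) : a = b -> a <= b.
Proof. by move=> ->. Qed.

Section Gauge.
Context {R : realType}.
Local Notation edge := (edge R).
Local Notation nc := (@Normc.normc R).
Local Notation Re := complex.Re.
Local Notation ac := (@ac_derivative R).
Implicit Types (q : R -> R) (c d z : R[i]) (u du m mp : R -> R[i]).

(* Locked because [cexp] unfolds to a product, which would be matched by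
   [rewrite ncM] and similar. *)
Definition ex c (x : R) : R[i] := locked (cexp (c * x%:C%C)).

Lemma exE c x : ex c x = cexp (c * x%:C%C). Proof. by rewrite /ex -lock. Qed.
Lemma exN c x : ex (- c) x = (ex c x)^-1.
Proof. by rewrite !exE mulNr cexpNV. Qed.
Lemma ex_neq0 c x : ex c x != 0. Proof. by rewrite exE cexp_neq0. Qed.
Lemma ex0 c : ex c 0 = 1. Proof. by rewrite exE mulr0 cexp0. Qed.
Lemma nc_ex c x : nc (ex c x) = expR (Re c * x).
Proof. by rewrite exE nc_cexp cReM /= mulr0 subr0. Qed.
Lemma ac_ex c : ac (ex c) (fun x => c * ex c x).
Proof. by apply: ac_ext (ac_cexp c) => x _; rewrite exE. Qed.
Lemma ex_meas c : cmeas edge (ex c). Proof. exact: ac_meas (ac_ex c). Qed.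

Lemma ac_gauge q z c u du : c ^+ 2 = - z -> schrodinger_solution q z u du ->
  ac (fun x => ex (- c) x * u x) (fun x => ex (- c) x * (du x - c * u x)) /\
  ac (fun x => ex (- c) x * (du x - c * u x))
     (fun x => (q x)%:C%C * (ex (- c) x * u x) - 2 * c * (ex (- c) x * (du x - c * u x))).
Proof.
move=> cz [hu hdu]; split.
  by apply: ac_eq (acM (ac_ex (- c)) hu) => x _; ring.
apply: ac_eq (acM (ac_ex (- c)) (acB hdu (acZ c hu))) => x _.
have -> : z = - c ^+ 2 by rewrite cz opprK.
ring.
Qed.

Lemma ac_ungauge q z c m mp : c ^+ 2 = - z -> ac m mp ->
  ac mp (fun x => (q x)%:C%C * m x - 2 * c * mp x) ->
  schrodinger_solution q z (fun x => ex c x * m x) (fun x => ex c x * (mp x + c * m x)).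
Proof.
move=> cz hm hmp; split.
  by apply: ac_eq (acM (ac_ex c) hm) => x _; ring.
apply: ac_eq (acM (ac_ex c) (acD hmp (acZ c hm))) => x _.
have -> : z = - c ^+ 2 by rewrite cz opprK.
ring.
Qed.

End Gauge.

Section Picard.
Context {R : realType}.
Local Notation mu := (@lebesgue_measure R).
Local Notation edge := (edge R).
Local Notation nc := (@Normc.normc R).
Local Notation Re := complex.Re.
Local Notation Im := complex.Im.
Local Notation ac := (@ac_derivative R).
Variables (q : R -> R) (iq : rint edge q) (d : R[i]) (d0 : Re d < 0).
Implicit Types (f g : R -> R[i]).

Let aq x := `|q x|.
Let Q := prim aq.
Let L := 2 / nc d.
Let N := \int[mu]_(x in edge) aq x.

Let nd0 : 0 < nc d.
Proof. by rewrite nc_gt0; apply/eqP => d1; move: d0; rewrite d1 /= ltxx. Qed.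

Let L0 : 0 < L. Proof. by rewrite divr_gt0. Qed.

Let iaq : rint edge aq. Proof. exact: rint_norm. Qed.

Let Q0 x : 0 <= Q x. Proof. by apply: Rintegral_ge0 => t _; exact: normr_ge0. Qed.

Let QN x : 0 <= x -> Q x <= N.
Proof.
move=> x0; rewrite /N (Rintegral_edge_split x0 iaq) -/(Q x) lerDl.
by apply: Rintegral_ge0 => t _; exact: normr_ge0.
Qed.

Let LQ0 x : 0 <= L * Q x.
Proof. exact: mulr_ge0 (ltW L0) (Q0 x). Qed.

Let LQN x : 0 <= x -> L * Q x <= L * N.
Proof. by move=> x0; apply: ler_wpM2l; [exact: ltW|exact: QN]. Qed.

Definition volterra f x : R[i] :=
  d^-1 * (ex d x * cintegral `[0, x] (fun t => ex (- d) t * ((q t)%:C%C * f t))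
          - cintegral `[0, x] (fun t => (q t)%:C%C * f t)).

Definition bounded_meas f := cmeas edge f /\ exists M, forall x, 0 <= x -> nc (f x) <= M.

Let bm_int f x : bounded_meas f -> cintegrable `[0, x] (fun t => (q t)%:C%C * f t).
Proof.
move=> [mf [M fM]]; apply: (@cint_le _ _ _ (fun t => M * aq t)).
- exact: measurable_itv.
- apply: (cmeasS _ (@itv0_sub _ x)); first exact: measurable_itv.
  by apply: cmeasM => //; apply: cmeas_real; exact: rint_meas iq.
- apply: rintZ; first exact: measurable_itv.
  exact: rint_edge0.
- move=> t /itv0_sub/edgeP t0; rewrite ncM nc_real mulrC ler_wpM2r//; exact: fM.
Qed.

Let bm_int' f x : bounded_meas f ->
  cintegrable `[0, x] (fun t => ex (- d) t * ((q t)%:C%C * f t)).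
Proof.
move=> bf; have i := bm_int x bf.
apply: (@cint_le _ _ _ (fun t => expR (- Re d * x) * nc ((q t)%:C%C * f t))).
- exact: measurable_itv.
- apply: cmeasM; last exact: cint_meas.
  by apply: (cmeasS _ (@itv0_sub _ x)); [exact: measurable_itv|exact: ex_meas].
- by apply: rintZ; [exact: measurable_itv|apply: cint_nc => //; exact: measurable_itv].
- move=> t; rewrite /= in_itv /= => /andP[t0 tx]; rewrite ncM ler_wpM2r ?nc_ge0//.
  by rewrite nc_ex cReN ler_expR ler_wpM2l// oppr_ge0 ltW.
Qed.

Lemma volterraB f g : bounded_meas f -> bounded_meas g -> forall x,
  volterra (fun x => f x - g x) x = volterra f x - volterra g x.
Proof.
move=> bf bg x; rewrite /volterra.
have -> : cintegral `[0, x] (fun t => (q t)%:C%C * (f t - g t)) =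
    cintegral `[0, x] (fun t => (q t)%:C%C * f t) - cintegral `[0, x] (fun t => (q t)%:C%C * g t).
  rewrite -cintegralB; [|exact: measurable_itv|exact: bm_int|exact: bm_int].
  by apply: eq_cintegral => t _; rewrite mulrBr.
have -> : cintegral `[0, x] (fun t => ex (- d) t * ((q t)%:C%C * (f t - g t))) =
    cintegral `[0, x] (fun t => ex (- d) t * ((q t)%:C%C * f t)) -
    cintegral `[0, x] (fun t => ex (- d) t * ((q t)%:C%C * g t)).
  rewrite -cintegralB; [|exact: measurable_itv|exact: bm_int'|exact: bm_int'].
  by apply: eq_cintegral => t _; rewrite !mulrBr.
ring.
Qed.

Lemma ac_prim f : (forall x, 0 <= x -> cintegrable `[0, x] f) ->
  ac (fun x => cintegral `[0, x] f) f.
Proof.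
move=> fi x x0; split; first exact: fi.
by rewrite /cintegral set_itv1 !Rintegral_set1 add0r.
Qed.

Lemma ac_volterra f : bounded_meas f -> ac (volterra f)
  (fun x => ex d x * cintegral `[0, x] (fun t => ex (- d) t * ((q t)%:C%C * f t))).
Proof.
move=> bf.
have h1 := ac_prim (fun x _ => bm_int x bf).
have h2 := ac_prim (fun x _ => bm_int' x bf).
apply: ac_eq (acZ d^-1 (acB (acM (ac_ex d) h2) h1)) => x _.
have e : ex (- d) x * ex d x = 1 by rewrite exN mulVf// ex_neq0.
have d1 : d != 0 by rewrite -nc_gt0.
transitivity (d^-1 * d * (ex d x * cintegral `[0, x] (fun t => ex (- d) t * ((q t)%:C%C * f t)))
  + d^-1 * ((ex (- d) x * ex d x) * ((q x)%:C%C * f x) - (q x)%:C%C * f x)); first by ring.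
by rewrite e mul1r subrr mulr0 addr0 mulVf// mul1r.
Qed.

Lemma volterra_le f (h : R -> R) x : 0 <= x -> bounded_meas f ->
  rint `[0, x] (fun t => aq t * h t) -> (forall t, 0 <= t <= x -> nc (f t) <= h t) ->
  nc (volterra f x) <= L * prim (fun t => aq t * h t) x.
Proof.
move=> x0 bf ih fh; rewrite /volterra ncM ncV.
have -> : L * prim (fun t => aq t * h t) x =
    (nc d)^-1 * (prim (fun t => aq t * h t) x + prim (fun t => aq t * h t) x).
  by rewrite /L; ring.
rewrite ler_wpM2l ?invr_ge0 ?nc_ge0// (le_trans (ncB _ _))// lerD//.
  rewrite -cintegralZ; [|exact: measurable_itv|exact: bm_int'].
  apply: nc_cintegral_le => //.
    by apply: cmeasM; [exact: cmeas_cst|apply: cint_meas; exact: bm_int'].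
  move=> t; rewrite /= in_itv /= => tx; rewrite mulrA !ncM nc_real.
  have le1 : nc (ex d x) * nc (ex (- d) t) <= 1.
    rewrite !nc_ex cReN -expRD -expR0 ler_expR mulNr -mulrBr nmulr_rle0// subr_ge0.
    by case/andP: tx.
  apply: (@le_trans _ _ (1 * (aq t * nc (f t)))).
    by apply: ler_wpM2r => //; rewrite mulr_ge0 ?nc_ge0// normr_ge0.
  by rewrite mul1r; apply: ler_wpM2l; [exact: normr_ge0|exact: fh].
apply: nc_cintegral_le => //; first by apply: cint_meas; exact: bm_int.
move=> t; rewrite /= in_itv /= => tx.
by rewrite ncM nc_real; apply: ler_wpM2l; [exact: normr_ge0|exact: fh].
Qed.

Let rac_Q : rac Q aq.
Proof. by apply: rac_prim => x _; exact: rint_edge0. Qed.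

Lemma prim_pow k x : 0 <= x -> rint `[0, x] (fun t => aq t * Q t ^+ k) /\
  prim (fun t => aq t * Q t ^+ k) x = Q x ^+ k.+1 / k.+1%:R.
Proof.
have h j : rac (fun x => Q x ^+ j.+1) (fun x => j.+1%:R * (aq x * Q x ^+ j)).
  elim: j => [|j ih].
    by apply: rac_ext rac_Q => t _; rewrite ?expr1 ?expr0 ?mulr1 ?mul1r.
  apply: rac_ext (racM rac_Q ih) => t _; first by rewrite -exprS.
  by rewrite [j.+2%:R]mulrS exprS; ring.
move=> x0; have [i e] := h k x x0.
have k0 : k.+1%:R != 0 :> R by rewrite pnatr_eq0.
have i' : rint `[0, x] (fun t => aq t * Q t ^+ k).
  apply: rint_ext (rintZ k.+1%:R^-1 (measurable_itv _) i) => t _.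
  by rewrite mulKf.
split => //; rewrite e primZ// {2}/Q /prim set_itv1 Rintegral_set1 expr0n add0r.
by rewrite mulrC mulKf.
Qed.

Variables (a b : R[i]).

Definition picard0 x : R[i] := a + b / d * (ex d x - 1).

Fixpoint picard k : R -> R[i] := if k is k'.+1 then volterra (picard k') else picard0.

Let C := nc a + nc (b / d) * 2.

Let C0 : 0 <= C. Proof. by rewrite addr_ge0 ?mulr_ge0 ?nc_ge0. Qed.

Lemma ex_le1 x : 0 <= x -> nc (ex d x) <= 1.
Proof. by move=> x0; rewrite nc_ex -expR0 ler_expR nmulr_rle0. Qed.

Lemma picardP k : cmeas edge (picard k) /\
  forall x, 0 <= x -> nc (picard k x) <= C * ((L * Q x) ^+ k / k`!%:R).
Proof.
elim: k => [|k [mk bk]].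
  split.
    apply: cmeasD; first exact: cmeas_cst.
    apply: cmeasM; first exact: cmeas_cst.
    by apply: cmeasD; [exact: ex_meas|exact: cmeas_cst].
  move=> x x0; rewrite expr0 fact0 divr1 mulr1 /= /picard0 (le_trans (ncD _ _))// lerD2l ncM.
  rewrite ler_wpM2l ?nc_ge0// (le_trans (ncB _ _))// nc1 lerD2r; exact: ex_le1.
have bm : bounded_meas (picard k).
  split=> //; exists (C * ((L * N) ^+ k / k`!%:R)) => x x0.
  apply: (le_trans (bk _ x0)); apply: ler_wpM2l; first exact: C0.
  apply: ler_wpM2r; first by rewrite invr_ge0.
  by apply: lerXn2r; [exact: LQ0|exact: le_trans (LQ0 x) (LQN x0)|exact: LQN].
split; first exact: ac_meas (ac_volterra bm).
move=> x x0 /=; have [i e] := prim_pow k x0.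
pose h t := C * (L ^+ k / k`!%:R) * Q t ^+ k.
have ih : rint `[0, x] (fun t => aq t * h t).
  apply: rint_ext (rintZ (C * (L ^+ k / k`!%:R)) (measurable_itv _) i) => t _.
  by rewrite /h; ring.
apply: (le_trans (@volterra_le _ h x x0 bm ih _)).
  move=> t /andP[t0 tx]; apply: (le_trans (bk _ t0)); rewrite /h [(L * Q t) ^+ _]exprMn.
  by apply: le_of_eq; rewrite -!mulrA [_^-1 * _]mulrC.
have -> : prim (fun t => aq t * h t) x = C * (L ^+ k / k`!%:R) * prim (fun t => aq t * Q t ^+ k) x.
  rewrite -primZ//; apply: eq_Rintegral => t _; rewrite /h; ring.
rewrite e factS natrM [(L * Q x) ^+ _]exprMn [L ^+ k.+1]exprS [Q x ^+ k.+1]exprS.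
have k0 : k.+1%:R != 0 :> R by rewrite pnatr_eq0.
have f0 : k`!%:R != 0 :> R by rewrite pnatr_eq0 -lt0n fact_gt0.
apply: le_of_eq; move: k0 f0.
move: (k.+1%:R) (k`!%:R) (L ^+ k) (Q x ^+ k) (L) (C) (Q x) => s f lk qk l c w s0 f0.
by field; rewrite s0 f0.
Qed.


Let T k := C * (expR (L * N) - series (exp_coeff (L * N)) k).

Let exp_le x k : 0 <= x -> C * ((L * Q x) ^+ k / k`!%:R) <= C * exp_coeff (L * N) k.
Proof.
move=> x0; apply: ler_wpM2l; first exact: C0.
apply: ler_wpM2r; first by rewrite invr_ge0.
by apply: lerXn2r; [exact: LQ0|exact: le_trans (LQ0 x) (LQN x0)|exact: LQN].
Qed.

Let expc0 k : 0 <= exp_coeff (L * N) k.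
Proof.
by rewrite /exp_coeff divr_ge0// exprn_ge0//; exact: le_trans (LQ0 0) (LQN (lexx _)).
Qed.

Let ser_exp : series (exp_coeff (L * N)) n @[n --> \oo] --> expR (L * N).
Proof. by rewrite /expR; exact: is_cvg_series_exp_coeff. Qed.

Let T_cvg (e : R) : 0 < e -> exists k, forall j, (k <= j)%N -> T j < e.
Proof.
move=> e0.
have : T k @[k --> \oo] --> C * (expR (L * N) - expR (L * N)).
  by apply: cvgM; [exact: cvg_cst|apply: cvgB; [exact: cvg_cst|exact: ser_exp]].
rewrite subrr mulr0 => /cvgrPdist_lt/(_ e e0)[k _ hk]; exists k => j kj.
by have := hk j kj; rewrite sub0r normrN; apply: le_lt_trans; exact: ler_norm.
Qed.

Let psum k x := \sum_(0 <= i < k) picard i x.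

Let psum_diff k j x : (k <= j)%N -> 0 <= x -> nc (psum j x - psum k x) <= T k.
Proof.
move=> kj x0; rewrite /psum (big_cat_nat (n := k))//= addrAC subrr add0r.
apply: (le_trans (nc_sum _ _ _)).
apply: (@le_trans _ _ (C * \sum_(k <= i < j) exp_coeff (L * N) i)).
  rewrite mulr_sumr; apply: ler_sum => i _.
  exact: le_trans ((picardP i).2 x x0) (exp_le i x0).
rewrite /T; apply: ler_wpM2l; first exact: C0.
rewrite lerBrDl /series /= -big_cat_nat//=.
apply: (nondecreasing_cvgn_le _ _ j).
  by apply: nondecreasing_series => n _ _; exact: expc0.
by apply/cvg_ex; exists (expR (L * N)); exact: ser_exp.
Qed.

Definition picard_sol x : R[i] :=
  Complex (limn (fun k => Re (psum k x))) (limn (fun k => Im (psum k x))).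

Let ReS k x : Re (psum k x) = series (fun i => Re (picard i x)) k.
Proof.
by rewrite /psum /series /=; elim/big_ind2: _ => // u r v s <- <-; rewrite cReD.
Qed.

Let ImS k x : Im (psum k x) = series (fun i => Im (picard i x)) k.
Proof.
by rewrite /psum /series /=; elim/big_ind2: _ => // u r v s <- <-; rewrite cImD.
Qed.

Let cvg_dom (u : nat -> R) : (forall i, `|u i| <= C * exp_coeff (L * N) i) -> cvgn (series u).
Proof.
move=> h; apply: normed_cvg.
apply: (@series_le_cvg _ _ (fun i => C * exp_coeff (L * N) i)).
- by move=> i; exact: normr_ge0.
- by move=> i; apply: mulr_ge0; [exact: C0|exact: expc0].
- exact: h.
- by apply: is_cvg_seriesZ; apply/cvg_ex; exists (expR (L * N)); exact: ser_exp.
Qed.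

Let psum_cvg x : 0 <= x -> (Re (psum k x) @[k --> \oo] --> Re (picard_sol x)) /\
  (Im (psum k x) @[k --> \oo] --> Im (picard_sol x)).
Proof.
move=> x0; have b1 i : nc (picard i x) <= C * exp_coeff (L * N) i.
  exact: le_trans ((picardP i).2 x x0) (exp_le i x0).
split; rewrite /picard_sol /=.
  suff : cvgn (fun k => Re (psum k x)) by [].
  rewrite (_ : (fun _ => _) = series (fun i => Re (picard i x))); last by apply/funext => k; exact: ReS.
  by apply: cvg_dom => i; exact: le_trans (nc_Re _) (b1 i).
suff : cvgn (fun k => Im (psum k x)) by [].
rewrite (_ : (fun _ => _) = series (fun i => Im (picard i x))); last by apply/funext => k; exact: ImS.
by apply: cvg_dom => i; exact: le_trans (nc_Im _) (b1 i).
Qed.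

Let sol_diff k x : 0 <= x -> nc (picard_sol x - psum k x) <= T k.
Proof.
move=> x0; apply/ler_addgt0Pr => e e0; have [c1 c2] := psum_cvg x0.
have e2 : 0 < e / 2 by rewrite divr_gt0.
have [k1 _ h1] := (@cvgrPdist_lt _ _ _ _ _ _ _).1 c1 _ e2.
have [k2 _ h2] := (@cvgrPdist_lt _ _ _ _ _ _ _).1 c2 _ e2.
pose j := maxn k (maxn k1 k2).
have j0 : (k <= j)%N by rewrite leq_maxl.
have {}h1 : `|Re (picard_sol x) - Re (psum j x)| < e / 2.
  by apply: h1 => /=; rewrite (leq_trans (leq_maxl k1 k2))// leq_maxr.
have {}h2 : `|Im (picard_sol x) - Im (psum j x)| < e / 2.
  by apply: h2 => /=; rewrite (leq_trans (leq_maxr k1 k2))// leq_maxr.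
have -> : picard_sol x - psum k x = (psum j x - psum k x) + (picard_sol x - psum j x) by ring.
apply: (le_trans (ncD _ _)); apply: lerD; first exact: psum_diff.
apply: (le_trans (nc_ReIm _)); rewrite cReD cImD cReN cImN [leRHS]splitr.
exact: ltW (ltrD h1 h2).
Qed.

Let psum_bm k : bounded_meas (psum k).
Proof.
split; first by apply: cmeas_sum => i _; exact: (picardP i).1.
exists (T 0) => x x0; have := psum_diff (leq0n k) x0.
by rewrite {2}/psum big_geq// subr0.
Qed.

Let sol_bound x : 0 <= x -> nc (picard_sol x) <= C * expR (L * N).
Proof.
move=> x0; have := sol_diff 0 x0.
by rewrite /psum big_geq// subr0 /T /series /= big_geq// subr0.
Qed.

Let sol_bm : bounded_meas picard_sol.
Proof.
split; last by exists (C * expR (L * N)) => x; exact: sol_bound.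
split.
  apply: (@measurable_fun_cvg _ _ _ _ (fun k x => Re (psum k x))).
    by move=> k; have [[]] := psum_bm k.
  by move=> x /edgeP x0; have [] := psum_cvg x0.
apply: (@measurable_fun_cvg _ _ _ _ (fun k x => Im (psum k x))).
  by move=> k; have [[]] := psum_bm k.
by move=> x /edgeP x0; have [] := psum_cvg x0.
Qed.

Let volterra_psum k x : volterra (psum k) x = psum k.+1 x - picard0 x.
Proof.
elim: k => [|k ih].
  rewrite /psum big_nat1 subrr /volterra.
  rewrite (@eq_cintegral _ _ _ (fun=> 0)); last by move=> t _; rewrite big_geq// !mulr0.
  rewrite cintegral0 (@eq_cintegral _ _ _ (fun=> 0)); last by move=> t _; rewrite big_geq// !mulr0.
  by rewrite cintegral0 mulr0 subrr mulr0.
have -> : volterra (psum k.+1) x = volterra (psum k) x + volterra (picard k) x.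
  rewrite -[LHS](subrK (volterra (psum k) x)) addrC; congr (_ + _).
  rewrite -volterraB//; congr volterra; apply/funext => t.
  by rewrite /psum big_nat_recr//= addrAC subrr add0r.
by rewrite ih [in RHS]/psum big_nat_recr//= -/(psum k.+1 x); ring.
Qed.

Let volterra_dist k x : 0 <= x -> nc (volterra picard_sol x - volterra (psum k) x) <= L * (N * T k).
Proof.
move=> x0; rewrite -volterraB//.
have ih : rint `[0, x] (fun t => aq t * T k).
  apply: rint_ext (rintZ (T k) (measurable_itv _) (rint_edge0 x iaq)) => t _.
  exact: mulrC.
have bm : bounded_meas (fun t => picard_sol t - psum k t).
  have [m1 [M1 h1]] := sol_bm; have [m2 [M2 h2]] := psum_bm k.
  split; first by apply: cmeasD => //; exact: cmeasN.
  by exists (M1 + M2) => t t0; rewrite (le_trans (ncB _ _))// lerD ?h1 ?h2.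
have T0 : 0 <= T k by exact: le_trans (nc_ge0 _) (sol_diff k (lexx 0)).
apply: (le_trans (volterra_le x0 bm ih _)).
  by move=> t /andP[t0 _]; exact: sol_diff.
apply: ler_wpM2l; first exact: ltW.
have -> : prim (fun t => aq t * T k) x = T k * Q x.
  by rewrite -primZ; [apply: eq_Rintegral => t _; exact: mulrC|exact: rint_edge0].
by rewrite mulrC; apply: ler_wpM2r => //; exact: QN.
Qed.

Lemma picard_solE x : 0 <= x -> picard_sol x = picard0 x + volterra picard_sol x.
Proof.
move=> x0; apply/eqP; rewrite -subr_eq0 -nc_eq0 eq_le nc_ge0 andbT.
have N0 : 0 <= N by exact: le_trans (Q0 0) (QN (lexx _)).
have LN0 : 0 <= L * N by apply: mulr_ge0 => //; exact: ltW.
apply/ler_addgt0Pr => e e0; rewrite add0r.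
have c0 : 0 < 1 + L * N by rewrite ltr_pwDl.
have [k hk] := T_cvg (divr_gt0 e0 c0).
have h1 := sol_diff k.+1 x0; have h2 := volterra_dist k x0.
have t1 := hk k (leqnn k); have t2 := hk k.+1 (leqnSn k).
have -> : picard_sol x - (picard0 x + volterra picard_sol x) =
  (picard_sol x - psum k.+1 x) - (volterra picard_sol x - volterra (psum k) x).
  by rewrite volterra_psum; ring.
apply: (le_trans (ncB _ _)); apply: (le_trans (lerD h1 h2)).
have -> : e = e / (1 + L * N) + (L * N) * (e / (1 + L * N)).
  by rewrite -[X in X + _]mul1r -mulrDl mulrC divfK// gt_eqF.
by apply: lerD; [exact: ltW|rewrite mulrA; apply: ler_wpM2l => //; exact: ltW].
Qed.

Lemma picard_exists : exists n np M,
  [/\ ac n np, ac np (fun x => (q x)%:C%C * n x + d * np x), n 0 = a, np 0 = b &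
    forall x, 0 <= x -> nc (n x) <= M /\
      nc (np x) <= M * (expR (Re d * x) + cvl0 (- Re d) aq x)].
Proof.
have d1 : d != 0 by rewrite -nc_gt0.
pose P x := cintegral `[0, x] (fun t => ex (- d) t * ((q t)%:C%C * picard_sol t)).
pose np x := ex d x * (b + P x).
have e x : ex (- d) x * ex d x = 1 by rewrite exN mulVf// ex_neq0.
have i x := bm_int' x sol_bm.
have hP : ac P (fun t => ex (- d) t * ((q t)%:C%C * picard_sol t)).
  by apply: ac_prim => x _.
have hn : ac picard_sol np.
  apply: ac_ext (acD (acD (ac_cst a) (acZ (b / d) (acB (ac_ex d) (ac_cst 1)))) (ac_volterra sol_bm)).
    by move=> x /edgeP x0; rewrite [RHS]picard_solE.
  by move=> x _; rewrite /np -/(P x) subr0 add0r mulrA divfK// mulrDr [b * _]mulrC.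
have hnp : ac np (fun x => (q x)%:C%C * picard_sol x + d * np x).
  apply: ac_eq (acM (ac_ex d) (acD (ac_cst b) hP)) => x _.
  transitivity ((ex (- d) x * ex d x) * ((q x)%:C%C * picard_sol x) + d * np x).
    by rewrite /np; ring.
  by rewrite e mul1r.
pose M := C * expR (L * N) + nc b.
have Mb : C * expR (L * N) <= M by rewrite lerDl nc_ge0.
have M0 : 0 <= C * expR (L * N) by rewrite mulr_ge0 ?expR_ge0//; exact: C0.
exists picard_sol, np, M; split => //.
- rewrite picard_solE// /picard0 ex0 subrr mulr0 addr0 /volterra /cintegral.
  rewrite set_itv1 !Rintegral_set1 (_ : Complex 0 0 = 0)//.
  by rewrite mulr0 subrr mulr0 addr0.
- by rewrite /np ex0 mul1r /P /cintegral set_itv1 !Rintegral_set1 (_ : Complex 0 0 = 0)// addr0.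
move=> x x0; split; first exact: le_trans (sol_bound x0) Mb.
rewrite /np mulrDr mulrDr; apply: (le_trans (ncD _ _)); apply: lerD.
  rewrite ncM nc_ex mulrC; apply: ler_wpM2r; first exact: expR_ge0.
  by rewrite lerDr.
rewrite -cintegralZ; [|exact: measurable_itv|exact: i].
have ia : rint `[0, x] (fun t => expR (Re d * (x - t)) * aq t).
  apply: rint_ext (rintZ (expR (Re d * x)) (measurable_itv _)
    (rint0_exp_mul (- Re d) (rint_edge0 x iaq))) => t _.
  by rewrite mulrA -expRD; congr (expR _ * _); ring.
have -> : M * cvl0 (- Re d) aq x = \int[mu]_(t in `[0, x]) (M * (expR (Re d * (x - t)) * aq t)).
  by rewrite RintegralZl; [rewrite /cvl0 opprK|exact: measurable_itv|exact: ia].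
apply: nc_cintegral_le.
- exact: measurable_itv.
- by apply: cint_meas; apply: cintZ; [exact: measurable_itv|exact: i].
- by apply: rintZ => //.
- move=> t; rewrite /= in_itv /= => /andP[t0 tx].
  rewrite !ncM nc_real !nc_ex mulrA -expRD cReN -/(aq t).
  have -> : Re d * x + - Re d * t = Re d * (x - t) by ring.
  apply: (@le_trans _ _ (expR (Re d * (x - t)) * (aq t * M))).
    apply: ler_wpM2l; first exact: expR_ge0.
    apply: ler_wpM2l; first exact: normr_ge0.
    exact: le_trans (sol_bound t0) Mb.
  by apply: le_of_eq; rewrite [RHS]mulrC mulrA.
Qed.

End Picard.

(** * Jost solutions *)

Section Decay.
Context {R : realType}.
Local Notation mu := (@lebesgue_measure R).
Local Notation edge := (edge R).
Local Notation nc := (@Normc.normc R).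
Local Notation Re := complex.Re.
Local Notation Im := complex.Im.
Local Notation ac := (@ac_derivative R).
Implicit Types (q p h : R -> R) (c d z zeta : R[i]) (u du m mp n np : R -> R[i]).

Lemma ncM_le z c (A B : R) : nc z <= A -> nc c <= B -> nc (z * c) <= A * B.
Proof. by move=> zA cB; rewrite ncM ler_pM ?nc_ge0. Qed.

Lemma cvly_rint k p x : 0 <= x -> rint edge (fun y => expR (- k * y) * p y) ->
  rint `]x, +oo[ (fun y => expR (- k * (y - x)) * p y).
Proof.
move=> x0 ip.
have h := rintZ (expR (k * x)) (measurable_itv _) (rint_edgey x0 ip).
apply: rint_ext h => y _; rewrite mulrA -expRD; congr (expR _ * _); ring.
Qed.

Lemma exp_rint k p : 0 <= k -> rint edge p -> rint edge (fun y => expR (- k * y) * p y).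
Proof.
move=> k0; apply: rint_bounded_mul; first exact: edge_meas.
  by apply: measurableT_comp => //; apply: measurable_funM.
move=> y /edgeP y0; rewrite ger0_norm ?expR_ge0// -expR0 ler_expR mulNr oppr_le0.
exact: mulr_ge0.
Qed.

Lemma cvly_monok k k' p x : 0 <= x -> 0 <= k <= k' -> rint edge p ->
  (forall y, edge y -> 0 <= p y) -> cvly k' p x <= cvly k p x.
Proof.
move=> x0 /andP[k0 kk] ip p0; apply: le_Rintegral.
- exact: measurable_itv.
- by apply: cvly_rint => //; apply: exp_rint => //; exact: le_trans kk.
- by apply: cvly_rint => //; apply: exp_rint.
- move=> y xy; apply: ler_wpM2r; first by apply: p0; exact: itvy_sub xy.
  rewrite ler_expR; apply: ler_wpM2r; last by rewrite lerN2.
  by move: xy; rewrite /= in_itv /= andbT => /ltW; rewrite subr_ge0.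
Qed.

Lemma cvl0_monok k k' p x : 0 <= x -> k <= k' -> rint edge p ->
  (forall y, edge y -> 0 <= p y) -> cvl0 k' p x <= cvl0 k p x.
Proof.
move=> x0 kk ip p0.
have i j : rint `[0, x] (fun y => expR (- j * (x - y)) * p y).
  have h := rintZ (expR (- j * x)) (measurable_itv _) (rint0_exp_mul j (rint_edge0 x ip)).
  apply: rint_ext h => y _; rewrite mulrA -expRD; congr (expR _ * _); ring.
apply: le_Rintegral; [exact: measurable_itv|exact: i|exact: i|].
move=> y xy; apply: ler_wpM2r; first by apply: p0; exact: itv0_sub xy.
rewrite ler_expR; apply: ler_wpM2r; last by rewrite lerN2.
by move: xy; rewrite /= in_itv /= => /andP[_]; rewrite subr_ge0.
Qed.

Lemma cvly_cst k (a x : R) : 0 < k -> 0 <= a -> 0 <= x -> cvly k (fun=> a) x <= a * (2 / k).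
Proof.
move=> k0 a0 x0; have [i le] := expR_abs_rint k0 x0.
apply: (@le_trans _ _ (a * \int[mu]_(y in edge) expR (- k * `|x - y|))); last first.
  by apply: ler_wpM2l.
rewrite (Rintegral_edge_split x0 i) mulrDr.
have -> : cvly k (fun=> a) x = a * \int[mu]_(y in `]x, +oo[) expR (- k * `|x - y|).
  rewrite -RintegralZl; [|exact: measurable_itv|exact: rint_edgey].
  apply: eq_Rintegral => y; rewrite inE /= in_itv /= andbT => xy.
  by rewrite distrC gtr0_norm ?subr_gt0// mulrC.
rewrite lerDr; apply: mulr_ge0 => //; apply: Rintegral_ge0 => y _; exact: expR_ge0.
Qed.

(* Multiplying by the integrating factor [ex d], which decays, makes the
   boundary term at infinity vanish. *)
Lemma decay1 d (g del : R -> R[i]) h (B : R) : Re d < 0 ->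
  ac del (fun x => g x - d * del x) -> cmeas edge g ->
  (forall x, 0 <= x -> nc (del x) <= B) -> (forall x, 0 <= x -> nc (g x) <= h x) ->
  rint edge (fun y => expR (Re d * y) * h y) ->
  forall x, 0 <= x -> nc (del x) <= cvly (- Re d) h x.
Proof.
move=> d0 hdel mg dB gh ih x x0.
have hw : ac (fun x => ex d x * del x) (fun x => ex d x * g x).
  by apply: ac_eq (acM (ac_ex d) hdel) => t _; ring.
have hi : cintegrable edge (fun x => ex d x * g x).
  apply: (cint_le _ _ ih); [exact: edge_meas|by apply: cmeasM => //; exact: ex_meas|].
  move=> t /edgeP t0; rewrite ncM nc_ex; apply: ler_wpM2l; [exact: expR_ge0|exact: gh].
have wi : cintegrable edge (fun x => ex d x * del x).
  have k0 : 0 < - Re d by rewrite oppr_gt0.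
  have [ie _] := rint_expN k0; rewrite opprK in ie.
  apply: (cint_le _ _ (rintZ B edge_meas ie)); [exact: edge_meas|exact: ac_meas hw|].
  move=> t /edgeP t0; rewrite ncM nc_ex mulrC; apply: ler_wpM2r; [exact: expR_ge0|exact: dB].
have e := ac_tail0 hw hi wi x0.
have -> : del x = ex (- d) x * - cintegral `]x, +oo[ (fun x => ex d x * g x).
  by rewrite -e mulrA exN mulVf ?mul1r// ex_neq0.
rewrite mulrN ncN -cintegralZ; [|exact: measurable_itv|exact: cint_edgey].
apply: nc_cintegral_le.
- exact: measurable_itv.
- by apply: cint_meas; apply: cintZ; [exact: measurable_itv|exact: cint_edgey].
- by apply: cvly_rint => //; rewrite opprK.
- move=> y /(itvy_sub x0)/edgeP y0; rewrite mulrA !ncM !nc_ex -expRD cReN.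
  have -> : - Re d * x + Re d * y = - - Re d * (y - x) by ring.
  by apply: ler_wpM2l; [exact: expR_ge0|exact: gh].
Qed.

Definition gsol q c m mp := ac m mp /\ ac mp (fun x => (q x)%:C%C * m x - 2 * c * mp x).

Lemma gsol_bounded q c m mp (M : R) : rint edge q -> gsol q c m mp ->
  (forall x, 0 <= x -> nc (m x) <= M) -> exists B, forall x, 0 <= x -> nc (mp x) <= B.
Proof.
move=> iq [hm hmp] mM.
have hA : ac (fun x => mp x + 2 * c * m x) (fun x => (q x)%:C%C * m x).
  by apply: ac_eq (acD hmp (acZ (2 * c) hm)) => x _; ring.
have iA : cintegrable edge (fun x => (q x)%:C%C * m x).
  apply: (cint_le _ _ (rintZ M edge_meas (rint_norm iq))); first exact: edge_meas.
    by apply: cmeasM; [apply: cmeas_real; exact: rint_meas|exact: ac_meas hm].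
  by move=> x /edgeP x0; rewrite ncM nc_real mulrC; apply: ler_wpM2r => //; exact: mM.
exists (nc (mp 0 + 2 * c * m 0) + \int[mu]_(t in edge) nc ((q t)%:C%C * m t) + nc (2 * c) * M).
move=> x x0; have le := ac_bounded hA iA x0.
have -> : mp x = (mp x + 2 * c * m x) - 2 * c * m x by ring.
apply: (le_trans (ncB _ _)); apply: lerD; first exact: le.
by apply: ncM_le => //; exact: mM.
Qed.

Lemma gsol_meas q c m mp : gsol q c m mp -> cmeas edge m /\ cmeas edge mp.
Proof. by move=> [hm hmp]; split; [exact: ac_meas hm|exact: ac_meas hmp]. Qed.

Lemma Re2 c : Re (2 * c) = 2 * Re c.
Proof. by rewrite !mulr_natl !mulr2n cReD. Qed.

Lemma gsol_decay q c m mp (M : R) : rint edge q -> gsol q c m mp -> Re c < 0 ->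
  (forall x, 0 <= x -> nc (m x) <= M) ->
  forall x, 0 <= x -> nc (mp x) <= M * cvly (- (2 * Re c)) (fun t => `|q t|) x.
Proof.
move=> iq gs c0 mM x x0; have [B hB] := gsol_bounded iq gs mM.
have [hm hmp] := gs; have [mm _] := gsol_meas gs.
have c2 : Re (2 * c) < 0 by rewrite Re2 pmulr_rlt0.
have i1 : rint edge (fun y => expR (Re (2 * c) * y) * `|q y|).
  by rewrite -[Re (2 * c)]opprK; apply: exp_rint; [rewrite oppr_ge0 ltW|exact: rint_norm].
have i2 : rint edge (fun y => expR (Re (2 * c) * y) * (M * `|q y|)).
  by apply: rint_ext (rintZ M edge_meas i1) => y _; ring.
have mq : cmeas edge (fun t => (q t)%:C%C * m t).
  by apply: cmeasM => //; apply: cmeas_real; exact: rint_meas.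
have := decay1 c2 hmp mq hB _ i2 x0.
have -> : cvly (- Re (2 * c)) (fun y => M * `|q y|) x = M * cvly (- (2 * Re c)) (fun t => `|q t|) x.
  rewrite -RintegralZl; [|exact: measurable_itv|].
    by rewrite Re2; apply: eq_Rintegral => y _; ring.
  by apply: cvly_rint => //; rewrite opprK -Re2.
apply=> t t0; rewrite ncM nc_real mulrC; apply: ler_wpM2r => //; exact: mM.
Qed.

Definition tends (f : R -> R[i]) (l : R[i]) :=
  (f x : R[i]^o) @[x --> +oo] --> (l : R[i]^o).

Lemma tendsP f l : tends f l <->
  forall e, 0 < e -> exists2 X, 0 <= X & forall x, X <= x -> nc (f x - l) < e.
Proof.
split=> [/cvgcP h e e0|h].
  have [X [Xr hX]] := h e e0.
  exists (`|X| + 1); first by rewrite addr_ge0.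
  by move=> x Xx; apply: hX; rewrite (lt_le_trans _ Xx)// (le_lt_trans (ler_norm _))// ltrDl.
apply/cvgcP => e e0; have [X X0 hX] := h e e0.
by exists X; split; [exact: num_real|move=> x /ltW; exact: hX].
Qed.

Lemma tends_unique f l l' : tends f l -> tends f l' -> l = l'.
Proof. by move=> h h'; exact: (cvg_unique (@norm_hausdorff _ R[i]^o) h h'). Qed.

Lemma tendsD f g l l' : tends f l -> tends g l' -> tends (fun x => f x + g x) (l + l').
Proof. by move=> h h'; exact: (cvgD h h'). Qed.

Lemma tendsM f g l l' : tends f l -> tends g l' -> tends (fun x => f x * g x) (l * l').
Proof. by move=> h h'; exact: (@cvgM R[i] _ _ _ _ _ _ _ h h'). Qed.

Lemma tends_cst l : tends (fun=> l) l.
Proof. exact: cvg_cst. Qed.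

Lemma tends_ext f g l : (forall x, 0 <= x -> f x = g x) -> tends f l -> tends g l.
Proof.
move=> fg /tendsP h; apply/tendsP => e e0; have [X X0 hX] := h e e0.
by exists X => // x Xx; rewrite -fg ?hX// (le_trans X0).
Qed.

Lemma ac_tends u du : ac u du -> cintegrable edge du -> tends u (u 0 + cintegral edge du).
Proof. by move=> hu hi; apply/tendsP => e e0; exact: ac_lim. Qed.

Lemma ac_tends0 u du : ac u du -> cintegrable edge du -> cintegrable edge u -> tends u 0.
Proof. by move=> hu hi ui; rewrite -(ac_lim0 hu hi ui); exact: ac_tends. Qed.

Lemma Re_ci zeta : Re ('i%C * zeta) = - Im zeta.
Proof. by rewrite cReM /= mul0r mul1r sub0r. Qed.

Lemma ci_sqr zeta : ('i%C * zeta) ^+ 2 = - zeta ^+ 2.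
Proof. by rewrite exprMn sqr_i mulN1r. Qed.

Lemma jost_gsol q zeta u du : jost_solution q zeta u du ->
  let c := 'i%C * zeta in
  let m := fun x => ex (- c) x * u x in
  let mp := fun x => ex (- c) x * (du x - c * u x) in
  [/\ gsol q c m mp, tends m 1 & exists M, forall x, 0 <= x -> nc (m x) <= M].
Proof.
move=> [hs hl] c m mp.
have gs : gsol q c m mp by exact: ac_gauge (ci_sqr zeta) hs.
have tm : tends m 1.
  apply: tends_ext hl => x _; rewrite /m exN [RHS]mulrC exE; congr (_ / cexp _).
  by rewrite /c mulrAC.
split => //; have /tendsP/(_ 1 ltr01)[X X0 hX] := tm.
have [M hM] := ac_bounded0 X gs.1.
exists (Num.max M 2) => x x0; have [xX|Xx] := leP x X.
  by rewrite le_max hM// x0 xX.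
rewrite le_max; apply/orP; right.
have -> : m x = (m x - 1) + 1 by rewrite subrK.
rewrite (le_trans (ncD _ _))// nc1; have := hX x (ltW Xx); clear; lra.
Qed.

End Decay.

(** * Dependence on the spectral parameter *)

Section Weight.
Context {R : realType}.
Local Notation edge := (edge R).
Implicit Types (q : R -> R) (k x : R).

(* An integrable weight that controls both the derivative of the decaying
   solution ([cvly]) and that of the growing one ([expR] and [cvl0]), once the
   exponential factors are removed. *)
Definition weight k q x := expR (- k * x) + cvl k (fun t => `|q t|) x.

Lemma weight_rint k q : 0 < k -> rint edge q -> rint edge (weight k q).
Proof.
move=> k0 iq; have [i1 _] := rint_expN k0.
have [i2 _] := cvl_rint k0 (rint_norm iq) (fun t _ => normr_ge0 (q t)).
exact: rintD edge_meas i1 i2.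
Qed.

Lemma weight_ge0 k q x : 0 <= weight k q x.
Proof. by apply: addr_ge0; [exact: expR_ge0|apply: cvl_ge0 => t _; exact: normr_ge0]. Qed.

Lemma cvly_weight k k' q x : 0 < k <= k' -> rint edge q -> 0 <= x ->
  cvly k' (fun t => `|q t|) x <= weight k q x.
Proof.
move=> /andP[k0 kk] iq x0; have q0 t : edge t -> 0 <= `|q t| by move=> _; exact: normr_ge0.
have h1 := cvly_monok x0 (introT andP (conj (ltW k0) kk)) (rint_norm iq) q0.
have h2 := cvly_le k0 (rint_norm iq) q0 x0.
apply: (le_trans h1); apply: (le_trans h2).
by rewrite lerDr expR_ge0.
Qed.

Lemma cvl0_weight k k' q x : 0 < k <= k' -> rint edge q -> 0 <= x ->
  expR (- k' * x) + cvl0 k' (fun t => `|q t|) x <= weight k q x.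
Proof.
move=> /andP[k0 kk] iq x0; have q0 t : edge t -> 0 <= `|q t| by move=> _; exact: normr_ge0.
have h1 := cvl0_monok x0 kk (rint_norm iq) q0.
have h2 := cvl0_le k0 (rint_norm iq) q0 x0.
apply: lerD; last exact: le_trans h1 h2.
by rewrite ler_expR; apply: ler_wpM2r => //; rewrite lerN2.
Qed.

End Weight.

Section ZetaDerivative.
Context {R : realType}.
Local Notation mu := (@lebesgue_measure R).
Local Notation edge := (edge R).
Local Notation nc := (@Normc.normc R).
Local Notation Re := complex.Re.
Local Notation Im := complex.Im.
Local Notation ac := (@ac_derivative R).
Variables (q : R -> R) (iq : rint edge q) (zeta : R[i]) (k : R) (k0 : 0 < k).
Local Notation I := ('i%C : R[i]).
Local Notation c := (I * zeta).
Local Notation H := (weight k q).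

Let iH : rint edge H. Proof. exact: weight_rint. Qed.

(* Wronskian of two solutions whose exponential factors have been removed. *)
Definition psi (n np m mp : R -> R[i]) x := n x * mp x - np x * m x.

Lemma psi_int n np m mp (A B : R) :
  cmeas edge n -> cmeas edge np -> cmeas edge m -> cmeas edge mp ->
  (forall x, 0 <= x -> nc (n x) <= A /\ nc (np x) <= A * H x) ->
  (forall x, 0 <= x -> nc (m x) <= B /\ nc (mp x) <= B * H x) ->
  cintegrable edge (psi n np m mp) /\
  forall x, 0 <= x -> nc (psi n np m mp x) <= 2 * A * B * H x.
Proof.
move=> mn mnp mm mmp hA hB.
have le x : 0 <= x -> nc (psi n np m mp x) <= 2 * A * B * H x.
  move=> x0; have [a1 a2] := hA x x0; have [b1 b2] := hB x x0.
  apply: (le_trans (ncB _ _)).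
  have -> : 2 * A * B * H x = A * (B * H x) + (A * H x) * B by ring.
  by apply: lerD; apply: ncM_le.
split=> //; apply: (cint_le _ _ (rintZ (2 * A * B) edge_meas iH)); first exact: edge_meas.
  by apply: cmeasD; [|apply: cmeasN]; apply: cmeasM.
by move=> x /edgeP; exact: le.
Qed.

Lemma gsol_weight zeta' m mp (M : R) : k <= 2 * Im zeta' -> gsol q (I * zeta') m mp ->
  (forall x, 0 <= x -> nc (m x) <= M) ->
  forall x, 0 <= x -> nc (m x) <= M /\ nc (mp x) <= M * H x.
Proof.
move=> kz gs mM x x0; split; first exact: mM.
have Im0 : 0 < Im zeta'.
  have h : 0 < 2 * Im zeta' by exact: lt_le_trans kz.
  by rewrite pmulr_rgt0 in h.
have c0 : Re (I * zeta') < 0 by rewrite Re_ci oppr_lt0.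
have M0 : 0 <= M by exact: le_trans (nc_ge0 _) (mM x x0).
apply: (le_trans (gsol_decay iq gs c0 mM x0)); apply: ler_wpM2l => //.
by apply: cvly_weight => //; rewrite k0 Re_ci mulrN opprK.
Qed.

Variables (m mp n np : R -> R[i]) (M : R).
Hypotheses (gm : gsol q c m mp) (gn : gsol q (- c) n np).
Hypotheses (mM : forall x, 0 <= x -> nc (m x) <= M /\ nc (mp x) <= M * H x).
Hypotheses (nM : forall x, 0 <= x -> nc (n x) <= M /\ nc (np x) <= M * H x).
Hypothesis wr : forall x, 0 <= x -> psi n np m mp x + 2 * c * (n x * m x) = -1.
Hypothesis m1 : tends m 1.
Hypothesis kz : 2 * k <= Im zeta.

Let z0 : zeta != 0.
Proof.
apply/eqP => h; move: kz; rewrite h /= => h2.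
by have := lt_le_trans (mulr_gt0 (@ltr0n R 2) k0) h2; rewrite ltxx.
Qed.

Let I0 : I != 0. Proof. by rewrite -nc_eq0 nc_i oner_eq0. Qed.

Let II : I * I = -1. Proof. by rewrite -expr2 sqr_i. Qed.

Let M0 : 0 <= M. Proof. by have [h _] := mM (lexx 0); exact: le_trans (nc_ge0 _) h. Qed.

Let mn : cmeas edge n. Proof. exact: (gsol_meas gn).1. Qed.
Let mnp : cmeas edge np. Proof. exact: (gsol_meas gn).2. Qed.
Let mm : cmeas edge m. Proof. exact: (gsol_meas gm).1. Qed.
Let mmp : cmeas edge mp. Proof. exact: (gsol_meas gm).2. Qed.

Lemma ac_psi zeta' m' mp' : gsol q (I * zeta') m' mp' ->
  ac (psi n np m' mp') (fun x => - (2 * I) * (zeta' * (n x * mp' x) + zeta * (np x * m' x))).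
Proof.
move=> [h1 h2]; have [h3 h4] := gn.
by apply: ac_eq (acB (acM h3 h2) (acM h4 h1)) => x _; ring.
Qed.

Lemma psi_tends0 zeta' m' mp' (B : R) : gsol q (I * zeta') m' mp' ->
  (forall x, 0 <= x -> nc (m' x) <= B /\ nc (mp' x) <= B * H x) -> tends (psi n np m' mp') 0.
Proof.
move=> gs hB; have [mm' mmp'] := gsol_meas gs.
have [ip _] := psi_int mn mnp mm' mmp' nM hB.
apply: ac_tends0 (ac_psi gs) _ ip.
pose D := nc (2 * I) * (nc zeta' * (M * B) + nc zeta * (M * B)).
apply: (cint_le _ _ (rintZ D edge_meas iH)); first exact: edge_meas.
  exact: dac_meas (ac_psi gs).
move=> x /edgeP x0; have [a1 a2] := nM x0; have [b1 b2] := hB x x0.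
rewrite mulNr ncN ncM /D -mulrA; apply: ler_wpM2l; first exact: nc_ge0.
rewrite mulrDl; apply: (le_trans (ncD _ _)); rewrite !ncM -!mulrA.
apply: lerD; apply: ler_wpM2l; rewrite ?nc_ge0//.
  by apply: ler_pM => //; exact: nc_ge0.
have -> : M * (B * H x) = (M * H x) * B by ring.
by apply: ler_pM => //; exact: nc_ge0.
Qed.

Lemma n_tends : tends n (- (2 * c)^-1).
Proof.
have t0 : tends (psi n np m mp) 0 by exact: psi_tends0 gm mM.
have c20 : 2 * c != 0 by rewrite !mulf_neq0// pnatr_eq0.
(* [n] itself is recovered as [n * m / m], where [m] tends to 1 *)
have tnm : tends (fun x => n x * m x) (- (2 * c)^-1).
  have h := tendsM (@tends_cst R (2 * c)^-1) (tendsD (@tends_cst R (-1)) (tendsM (@tends_cst R (-1)) t0)).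
  have e : (2 * c)^-1 * (-1 + -1 * 0) = - (2 * c)^-1 by rewrite mulr0 addr0 mulrN1.
  rewrite e in h; apply: tends_ext h => x x0.
  transitivity ((2 * c)^-1 * ((psi n np m mp x + 2 * c * (n x * m x)) - psi n np m mp x)).
    by rewrite (wr x0) mulN1r.
  by rewrite addrAC subrr add0r mulKf.
have hV : tends (fun x => (m x)^-1) 1^-1.
  exact: (@cvgV R[i] _ _ _ m 1 (oner_neq0 _) m1).
have := tendsM tnm hV; rewrite invr1 mulr1 => h.
apply/tendsP => e e0; have /tendsP/(_ e e0)[X X0 hX] := h.
have /tendsP/(_ 1 ltr01)[Y Y0 hY] := m1.
exists (Num.max X Y); first by rewrite le_max X0.
move=> x; rewrite ge_max => /andP[Xx Yx].
have mx0 : m x != 0.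
  by apply/eqP => mx; have := hY x Yx; rewrite mx sub0r ncN nc1 ltxx.
by have := hX x Xx; rewrite mulfK.
Qed.

Section Perturbed.
Variables (zeta' : R[i]) (m' mp' : R -> R[i]).
Hypotheses (gm' : gsol q (I * zeta') m' mp') (m1' : tends m' 1).
Hypothesis kz' : k <= Im zeta'.
Variable B : R.
Hypothesis mB : forall x, 0 <= x -> nc (m' x) <= B.

Let eta := zeta' - zeta.

Let k2 : k <= 2 * Im zeta'.
Proof. by apply: (le_trans kz'); rewrite mulr_natl mulr2n lerDl (le_trans (ltW k0)). Qed.

Let mB' : forall x, 0 <= x -> nc (m' x) <= B /\ nc (mp' x) <= B * H x.
Proof. exact: gsol_weight k2 gm' mB. Qed.

Let B0 : 0 <= B. Proof. exact: le_trans (nc_ge0 _) (mB (lexx 0)). Qed.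

Let mm' : cmeas edge m'. Proof. exact: (gsol_meas gm').1. Qed.
Let mmp' : cmeas edge mp'. Proof. exact: (gsol_meas gm').2. Qed.

Definition beta x := psi n np m' mp' x + I * (zeta + zeta') * (n x * m' x).

Let NH := \int[mu]_(x in edge) H x.

Let ipsi : cintegrable edge (psi n np m' mp').
Proof. by have [] := psi_int mn mnp mm' mmp' nM mB'. Qed.

Lemma ac_beta : ac beta (fun x => - (I * eta) * psi n np m' mp' x).
Proof.
have [h1 h2] := gm'; have [h3 h4] := gn.
apply: ac_eq (acD (ac_psi gm') (acZ (I * (zeta + zeta')) (acM h3 h1))) => x _.
by rewrite /psi /eta; ring.
Qed.

Lemma beta_tail x : 0 <= x -> beta x =
  - (zeta + zeta') / (2 * zeta) + I * eta * cintegral `]x, +oo[ (psi n np m' mp').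
Proof.
move=> x0; have ib := cintZ (- (I * eta)) edge_meas ipsi.
have t1 := ac_tends ac_beta ib.
have t2 : tends beta (0 + I * (zeta + zeta') * (- (2 * c)^-1 * 1)).
  apply: tendsD; first exact: psi_tends0 gm' mB'.
  by apply: tendsM; [exact: tends_cst|apply: tendsM; [exact: n_tends|exact: m1']].
have e := tends_unique t1 t2.
rewrite (ac_tail ac_beta ib x0) e cintegralZ; [|exact: measurable_itv|exact: cint_edgey].
by congr (_ + _); [field; rewrite z0 I0|rewrite mulNr opprK].
Qed.

Let psi_tail_le x : 0 <= x -> nc (cintegral `]x, +oo[ (psi n np m' mp')) <= 2 * M * B * NH.
Proof.
move=> x0; have [_ le] := psi_int mn mnp mm' mmp' nM mB'.
apply: (@le_trans _ _ (\int[mu]_(t in edge) nc (psi n np m' mp' t))).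
  apply: (le_trans (nc_tail x0 ipsi)).
  by apply: rint_itv_sub; [exact: itvy_sub|exact: ipsi].
rewrite /NH -RintegralZl; [|exact: edge_meas|exact: iH].
apply: le_Rintegral; [exact: edge_meas|exact: cint_nc edge_meas ipsi| |].
  exact: rintZ edge_meas iH.
by move=> t /edgeP; exact: le.
Qed.

Definition alpha x := m x * mp' x - mp x * m' x + I * eta * (m x * m' x).

Lemma ac_alpha : ac alpha (fun x => - ((zeta + zeta') * eta * (m x * m' x))
   - I * (zeta + zeta') * alpha x).
Proof.
have [h1 h2] := gm'; have [h3 h4] := gm.
apply: ac_eq (acD (acB (acM h3 h2) (acM h4 h1)) (acZ (I * eta) (acM h3 h1))) => x _.
have e : (zeta + zeta') * eta * (m x * m' x) =
    - ((I * I) * ((zeta + zeta') * eta * (m x * m' x))) by rewrite II mulN1r opprK.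
by rewrite e /alpha /eta; ring.
Qed.

Lemma alpha_le x : 0 <= x -> nc (alpha x) <= nc (zeta + zeta') * nc eta * (M * B) * (2 / k).
Proof.
move=> x0; pose D := nc (zeta + zeta') * nc eta * (M * B).
have D0 : 0 <= D by rewrite !mulr_ge0 ?nc_ge0.
have d0 : Re (I * (zeta + zeta')) < 0.
  rewrite Re_ci oppr_lt0 cImD; apply: addr_gt0; last exact: lt_le_trans kz'.
  by apply: lt_le_trans kz; exact: mulr_gt0.
have kd : k <= - Re (I * (zeta + zeta')).
  rewrite Re_ci opprK cImD; apply: (le_trans kz'); rewrite lerDr.
  by apply: le_trans kz; apply: mulr_ge0 => //; exact: ltW.
have nd0 : 0 < - Re (I * (zeta + zeta')) by rewrite oppr_gt0.
have [ie _] := rint_expN nd0; rewrite opprK in ie.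
have ih : rint edge (fun y => expR (Re (I * (zeta + zeta')) * y) * D).
  by apply: rint_ext (rintZ D edge_meas ie) => y _; exact: mulrC.
have mg : cmeas edge (fun x => - ((zeta + zeta') * eta * (m x * m' x))).
  by apply: cmeasN; apply: cmeasM; [exact: cmeas_cst|exact: cmeasM].
have [NQ NQ0] : exists NQ, forall x, 0 <= x -> H x <= NQ.
  exists (1 + \int[mu]_(t in edge) `|q t|) => t t0; apply: lerD.
    by rewrite -expR0 ler_expR mulNr oppr_le0 mulr_ge0// ltW.
  apply: le_Rintegral; [exact: edge_meas|exact: cvl_int (rint_norm iq)|exact: rint_norm|].
  move=> y _; rewrite ler_piMl// ?normr_ge0//.
  by rewrite (le_trans (ler_norm _))// expR_abs_le1.
have [E hE] : exists E, forall x, 0 <= x -> nc (alpha x) <= E.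
  exists (M * (B * NQ) + (M * NQ) * B + nc (I * eta) * (M * B)) => t t0.
  have [a1 a2] := mM t0; have [b1 b2] := mB' t0; have h := NQ0 t t0.
  have b2' := le_trans b2 (ler_wpM2l B0 h); have a2' := le_trans a2 (ler_wpM2l M0 h).
  apply: (le_trans (ncD _ _)); apply: lerD.
    by apply: (le_trans (ncB _ _)); apply: lerD; apply: ncM_le.
  by apply: ncM_le => //; apply: ncM_le.
have := decay1 d0 ac_alpha mg hE _ ih x0.
have cst : cvly (- Re (I * (zeta + zeta'))) (fun=> D) x <= D * (2 / k).
  apply: (le_trans (cvly_cst nd0 D0 x0)); apply: ler_wpM2l => //.
  by apply: ler_wpM2l => //; rewrite lef_pV2.
move=> h; apply: le_trans cst; apply: h => t t0.
have [a1 _] := mM t0; have [b1 _] := mB' t0.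
by rewrite ncN /D; apply: ncM_le; [rewrite ncM|exact: ncM_le].
Qed.

(* The perturbed solution in the basis of the two unperturbed ones. *)
Lemma m'E x : 0 <= x -> m' x = n x * alpha x - m x * beta x.
Proof.
move=> x0; have w := wr x0.
have -> : n x * alpha x - m x * beta x =
  - (psi n np m mp x + 2 * c * (n x * m x)) * m' x.
  by rewrite /alpha /beta /psi /eta; ring.
by rewrite w opprK mul1r.
Qed.

Definition perturb_cst := M * (nc (2 * zeta))^-1 + M * (2 * M * NH) + M * M * (2 / k) * (nc (2 * zeta) + 1).

Hypothesis eta1 : nc eta <= 1.

Let NH0 : 0 <= NH. Proof. by apply: Rintegral_ge0 => t _; exact: weight_ge0. Qed.

Let zz : nc (zeta + zeta') <= nc (2 * zeta) + 1.
Proof.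
have -> : zeta + zeta' = 2 * zeta + eta by rewrite /eta; ring.
by apply: (le_trans (ncD _ _)); rewrite lerD2l.
Qed.

Lemma m'_diff x : 0 <= x -> nc (m' x - m x) <= perturb_cst * (1 + B) * nc eta.
Proof.
move=> x0; have [a1 _] := mM x0; have [b1 _] := nM x0.
have e : m' x - m x = n x * alpha x + m x * (eta / (2 * zeta) - I * eta * cintegral `]x, +oo[ (psi n np m' mp')).
  have z20 : 2 * zeta != 0 by rewrite mulf_neq0// pnatr_eq0.
  rewrite {1}(m'E x0) (beta_tail x0); rewrite /eta; field; exact: z0.
have al := alpha_le x0; have pl := psi_tail_le x0.
pose a := nc (zeta + zeta') * nc eta * (M * B) * (2 / k).
rewrite e; apply: (le_trans (ncD _ _)).
have h1 : nc (n x * alpha x) <= M * ((nc (2 * zeta) + 1) * nc eta * (M * B) * (2 / k)).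
  apply: ncM_le => //; apply: (le_trans al).
  apply: ler_wpM2r; first by rewrite divr_ge0// ltW.
  apply: ler_wpM2r; first exact: mulr_ge0.
  by apply: ler_wpM2r; first exact: nc_ge0.
have h2 : nc (m x * (eta / (2 * zeta) - I * eta * cintegral `]x, +oo[ (psi n np m' mp'))) <=
    M * (nc eta / nc (2 * zeta) + nc eta * (2 * M * B * NH)).
  apply: ncM_le => //; apply: (le_trans (ncB _ _)); apply: lerD; first by rewrite ncM ncV.
  by apply: ncM_le => //; rewrite ncM nc_i mul1r.
apply: (le_trans (lerD h1 h2)); rewrite /perturb_cst.
have i0 : 0 <= nc eta by exact: nc_ge0.
have j0 : 0 <= (nc (2 * zeta))^-1 by rewrite invr_ge0 nc_ge0.
have l0 : 0 <= 2 / k by rewrite divr_ge0// ltW.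
have n0 : 0 <= nc (2 * zeta) + 1 by rewrite addr_ge0 ?nc_ge0.
move: M0 B0 NH0 i0 j0 l0 n0.
move: (nc eta) (nc (2 * zeta))^-1 (2 / k) (nc (2 * zeta) + 1) (NH) (M) (B) => y v l w N m0 b.
move=> m00 b0 N0 y0 v0 l0 w0.
rewrite -subr_ge0.
have -> : (m0 * v + m0 * (2 * m0 * N) + m0 * m0 * l * w) * (1 + b) * y
  - (m0 * (w * y * (m0 * b) * l) + m0 * (y * v + y * (2 * m0 * b * N))) =
  m0 * v * b * y + m0 * (2 * m0 * N) * y + m0 * m0 * l * w * y by ring.
by rewrite !addr_ge0 ?mulr_ge0.
Qed.

Definition weight2 x := cvly k (fun t => `|q t| + H t) x.

Lemma mp'_diff x : 0 <= x ->
  nc (mp' x - mp x) <= (perturb_cst * (1 + B) + 2 * M) * nc eta * weight2 x.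
Proof.
move=> x0.
have [h1 h2] := gm'; have [h3 h4] := gm.
pose g x := (q x)%:C%C * (m' x - m x) - 2 * I * eta * mp x.
have hd : ac (fun x => mp' x - mp x) (fun x => g x - 2 * (I * zeta') * (mp' x - mp x)).
  by apply: ac_eq (acB h2 h4) => t _; rewrite /g /eta; ring.
have mg : cmeas edge g.
  apply: cmeasD.
    apply: cmeasM; first by apply: cmeas_real; exact: rint_meas.
    by apply: cmeasD => //; exact: cmeasN.
  by apply: cmeasN; apply: cmeasM; [exact: cmeas_cst|].
pose D := (perturb_cst * (1 + B) + 2 * M) * nc eta.
have e0 : 0 <= nc eta by exact: nc_ge0.
have dc0 : 0 <= perturb_cst * (1 + B).
  apply: mulr_ge0; last by rewrite addr_ge0.
  have j0 : 0 <= (nc (2 * zeta))^-1 by rewrite invr_ge0 nc_ge0.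
  have l0 : 0 <= 2 / k by rewrite divr_ge0// ltW.
  have n0 : 0 <= nc (2 * zeta) + 1 by rewrite addr_ge0 ?nc_ge0.
  apply: addr_ge0; first apply: addr_ge0.
  - exact: mulr_ge0 M0 j0.
  - exact: mulr_ge0 M0 (mulr_ge0 (mulr_ge0 (ler0n R 2) M0) NH0).
  - exact: mulr_ge0 (mulr_ge0 (mulr_ge0 M0 M0) l0) n0.
have D0 : 0 <= D by rewrite mulr_ge0// addr_ge0// mulr_ge0.
have gD t : 0 <= t -> nc (g t) <= D * (`|q t| + H t).
  move=> t0; apply: (le_trans (ncB _ _)); rewrite [leRHS]mulrDr; apply: lerD.
    rewrite ncM nc_real mulrC; apply: ler_wpM2r; first exact: normr_ge0.
    apply: (le_trans (m'_diff t0)); apply: ler_wpM2r => //.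
    by rewrite lerDl mulr_ge0.
  have [_ a2] := mM t0.
  have -> : D * H t = (2 * nc eta) * (M * H t) + perturb_cst * (1 + B) * nc eta * H t by rewrite /D; ring.
  rewrite -[leLHS]addr0; apply: lerD; last first.
    by rewrite mulr_ge0 ?weight_ge0// mulr_ge0.
  apply: ncM_le => //; rewrite !ncM nc_i mulr1.
  by apply: ler_wpM2r => //; rewrite -[2 : R[i]]/(2%:R) -(rmorph_nat (real_complex R)) nc_real ger0_norm.
have d0 : Re (2 * (I * zeta')) < 0.
  by rewrite Re2 Re_ci mulrN oppr_lt0 mulr_gt0// (lt_le_trans k0 kz').
have iqH : rint edge (fun t => `|q t| + H t) by apply: rintD; [exact: edge_meas|exact: rint_norm|exact: iH].
have kd : 0 < k <= - Re (2 * (I * zeta')) by rewrite k0 Re2 Re_ci mulrN opprK.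
have i2 : rint edge (fun y => expR (Re (2 * (I * zeta')) * y) * (`|q y| + H y)).
  by rewrite -[Re _]opprK; apply: exp_rint => //; rewrite ltW// oppr_gt0.
have i3 : rint edge (fun y => expR (Re (2 * (I * zeta')) * y) * (D * (`|q y| + H y))).
  by apply: rint_ext (rintZ D edge_meas i2) => y _; ring.
have [NQ NQ0] : exists NQ, forall x, 0 <= x -> nc (mp' x - mp x) <= NQ.
  have [E1 hE1] := gsol_bounded iq gm' mB.
  have [E2 hE2] := gsol_bounded iq gm (fun x x0 => (mM x0).1).
  by exists (E1 + E2) => t t0; apply: (le_trans (ncB _ _)); apply: lerD; [exact: hE1|exact: hE2].
have := decay1 d0 hd mg NQ0 gD i3 x0; move=> h; apply: (le_trans h).
have -> : cvly (- Re (2 * (I * zeta'))) (fun y => D * (`|q y| + H y)) x =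
    D * cvly (- Re (2 * (I * zeta'))) (fun y => `|q y| + H y) x.
  rewrite -RintegralZl; [|exact: measurable_itv|].
    by apply: eq_Rintegral => y _; ring.
  by apply: cvly_rint => //; rewrite opprK.
apply: ler_wpM2l => //; apply: cvly_monok => //.
  by case/andP: kd => k00 ->; rewrite ltW.
by move=> y _; apply: addr_ge0; [exact: normr_ge0|exact: weight_ge0].
Qed.

End Perturbed.
End ZetaDerivative.

Section EdgePair.
Context {R : realType}.
Local Notation mu := (@lebesgue_measure R).
Local Notation edge := (edge R).
Local Notation nc := (@Normc.normc R).
Local Notation Re := complex.Re.
Local Notation Im := complex.Im.
Local Notation ac := (@ac_derivative R).
Local Notation I := ('i%C : R[i]).
Implicit Types (q : R -> R) (zeta : R[i]) (u du th dth ch dch : R -> R[i]).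

(* [th] is the Jost solution and [ch] a growing one; [M] bounds both once their
   exponential factors are removed. *)
Record edge_pair q zeta th dth ch dch (M : R) : Prop := EdgePair {
  ep_th : schrodinger_solution q (zeta ^+ 2) th dth ;
  ep_ch : schrodinger_solution q (zeta ^+ 2) ch dch ;
  ep_wr : forall x, 0 <= x -> ch x * dth x - dch x * th x = -1 ;
  ep_m : forall x, 0 <= x -> nc (ex (- (I * zeta)) x * th x) <= M /\
    nc (ex (- (I * zeta)) x * (dth x - I * zeta * th x)) <= M * weight (Im zeta / 2) q x ;
  ep_n : forall x, 0 <= x -> nc (ex (I * zeta) x * ch x) <= M /\
    nc (ex (I * zeta) x * (dch x + I * zeta * ch x)) <= M * weight (Im zeta / 2) q x }.

Lemma wronskian_cst q z u du v dv : schrodinger_solution q z u du ->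
  schrodinger_solution q z v dv ->
  forall x, 0 <= x -> u x * dv x - du x * v x = u 0 * dv 0 - du 0 * v 0.
Proof.
move=> [hu hdu] [hv hdv] x x0.
have h : ac (fun x => u x * dv x - du x * v x) (fun=> 0).
  by apply: ac_eq (acB (acM hu hdv) (acM hdu hv)) => t _; ring.
by have [_ e] := h x x0; rewrite e cintegral0 addr0.
Qed.

Lemma edge_pair_exists q zeta th dth (a b : R[i]) : rint edge q -> 0 < Im zeta ->
  jost_solution q zeta th dth -> a * dth 0 - b * th 0 = -1 ->
  exists ch dch M, [/\ edge_pair q zeta th dth ch dch M, ch 0 = a & dch 0 = b].
Proof.
move=> iq z0 hj ab; pose c := I * zeta; pose k := Im zeta / 2.
have k0 : 0 < k by rewrite divr_gt0.
have k2 : 2 * k = Im zeta by rewrite /k mulrC divfK.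
have c0 : Re (2 * c) < 0 by rewrite Re2 Re_ci mulrN oppr_lt0 mulr_gt0.
have [gs _ [M1 hM1]] := jost_gsol hj.
have [n [np [M2 [hn hnp n0 np0 hM2]]]] := picard_exists iq c0 a (b + c * a).
have ed : ex c 0 = 1 by exact: ex0.
pose ch x := ex (- c) x * n x; pose dch x := ex (- c) x * (np x + (- c) * n x).
have hch : schrodinger_solution q (zeta ^+ 2) ch dch.
  apply: ac_ungauge hn _; first by rewrite sqrrN ci_sqr.
  by apply: ac_eq hnp => x _; ring.
have ch0 : ch 0 = a by rewrite /ch ex0 mul1r n0.
have dch0 : dch 0 = b by rewrite /dch ex0 mul1r n0 np0; ring.
have e x : ex c x * ex (- c) x = 1 by rewrite exN mulfV// ex_neq0.
exists ch, dch, (Num.max M1 M2); split; [|exact: ch0|exact: dch0].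
split; [by case: hj|exact: hch| | |].
- by move=> x x0; rewrite (wronskian_cst hch (proj1 hj) x0) ch0 dch0.
- move=> x x0.
  have kz : k <= 2 * Im zeta by rewrite -k2 mulrA ler_peMl ?(ltW k0)//; lra.
  have [h1 h2] := gsol_weight iq k0 kz gs hM1 x0; split; first by rewrite le_max h1.
  apply: (le_trans h2); apply: ler_wpM2r; first exact: weight_ge0.
  by rewrite le_max lexx.
- move=> x x0; have [h1 h2] := hM2 x x0.
  have -> : ex (I * zeta) x * ch x = n x by rewrite /ch mulrA e mul1r.
  have -> : ex (I * zeta) x * (dch x + I * zeta * ch x) = np x.
    transitivity ((ex c x * ex (- c) x) * np x); last by rewrite e mul1r.
    by rewrite /dch /ch /c; ring.
  split; first by rewrite le_max h1 orbT.
  have kk : 0 < k <= - Re (2 * c).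
    rewrite k0 Re2 Re_ci mulrN opprK -k2 mulrA ler_peMl ?(ltW k0)//; lra.
  have hw := cvl0_weight kk iq x0; rewrite opprK in hw.
  have M20 : 0 <= M2 by exact: le_trans (nc_ge0 _) h1.
  apply: (le_trans h2); apply: (le_trans (ler_wpM2l M20 hw)).
  by apply: ler_wpM2r; [exact: weight_ge0|rewrite le_max lexx orbT].
Qed.

Lemma edge_pair_diag q zeta th dth ch dch M x : edge_pair q zeta th dth ch dch M -> 0 <= x ->
  let c := I * zeta in
  psi (fun x => ex c x * ch x) (fun x => ex c x * (dch x + c * ch x))
    (fun x => ex (- c) x * th x) (fun x => ex (- c) x * (dth x - c * th x)) x =
  -1 - 2 * c * (ch x * th x).
Proof.
move=> h x0 c; have w := ep_wr h x0.
have e : ex c x * ex (- c) x = 1 by rewrite exN mulfV// ex_neq0.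
rewrite -w /psi.
transitivity ((ex c x * ex (- c) x) * (ch x * dth x - dch x * th x - 2 * c * (ch x * th x))).
  by ring.
by rewrite e mul1r.
Qed.

Lemma edge_pair_gsol q zeta th dth ch dch M : edge_pair q zeta th dth ch dch M ->
  let c := I * zeta in
  gsol q c (fun x => ex (- c) x * th x) (fun x => ex (- c) x * (dth x - c * th x)) /\
  gsol q (- c) (fun x => ex c x * ch x) (fun x => ex c x * (dch x + c * ch x)).
Proof.
move=> h c; split; first exact: ac_gauge (ci_sqr zeta) (ep_th h).
have c2 : (- c) ^+ 2 = - zeta ^+ 2 by rewrite sqrrN; exact: ci_sqr.
have [h1 h2] := ac_gauge c2 (ep_ch h); rewrite opprK in h1 h2; split.
  by apply: ac_eq h1 => x _; rewrite mulNr opprK.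
apply: ac_ext h2 => x _; first by rewrite mulNr opprK.
by rewrite !mulNr opprK; ring.
Qed.

Definition dif (f : R[i] -> R[i]) (z l : R[i]) := exists C del : R, 0 < del /\
  forall eta, nc eta < del -> nc (f (z + eta) - f z - eta * l) <= C * nc eta ^+ 2.

Lemma jost_dif q zeta (th dth : R -> R[i] -> R[i]) ch dch M : rint edge q -> 0 < Im zeta ->
  (forall z, 0 < Im z -> jost_solution q z (th ^~ z) (dth ^~ z)) ->
  edge_pair q zeta (th ^~ zeta) (dth ^~ zeta) ch dch M ->
  cintegrable edge (fun x => -1 - 2 * (I * zeta) * (ch x * th x zeta)) /\
  dif (fun z => ch 0 * dth 0 z - dch 0 * th 0 z) zeta
    (- (2 * zeta)^-1 + I * cintegral edge (fun x => -1 - 2 * (I * zeta) * (ch x * th x zeta))).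
Proof.
move=> iq z0 hj hp; pose c := I * zeta; pose k := Im zeta / 2.
have k0 : 0 < k by rewrite divr_gt0.
have k2 : 2 * k = Im zeta by rewrite /k mulrC divfK.
have kz : 2 * k <= Im zeta by rewrite k2.
have zn0 : zeta != 0 by apply/eqP => h; move: z0; rewrite h /= ltxx.
pose n x := ex c x * ch x; pose np x := ex c x * (dch x + c * ch x).
pose m x := ex (- c) x * th x zeta; pose mp x := ex (- c) x * (dth x zeta - c * th x zeta).
have [gm gn] := edge_pair_gsol hp.
have mM := ep_m hp; have nM := ep_n hp.
have [_ m1 _] := jost_gsol (hj zeta z0).
have pE x : 0 <= x -> psi n np m mp x = -1 - 2 * c * (ch x * th x zeta).
  by move=> x0; exact: edge_pair_diag hp x0.
have nmE x : n x * m x = ch x * th x zeta.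
  have e : ex c x * ex (- c) x = 1 by rewrite exN mulfV// ex_neq0.
  transitivity ((ex c x * ex (- c) x) * (ch x * th x zeta)); last by rewrite e mul1r.
  by rewrite /n /m; ring.
have wr x : 0 <= x -> psi n np m mp x + 2 * c * (n x * m x) = -1.
  by move=> x0; rewrite pE// nmE subrK.
have [mn mnp] := gsol_meas gn; have [mm mmp] := gsol_meas gm.
have [ipsi lepsi] := psi_int iq k0 mn mnp mm mmp nM mM.
have i1 : cintegrable edge (fun x => -1 - 2 * c * (ch x * th x zeta)).
  by apply: cint_ext ipsi => x /edgeP; exact: pE.
split => //.
set J := cintegral edge _.
have J0 : J = cintegral `]0, +oo[ (psi n np m mp).
  have e : J = cintegral edge (psi n np m mp).
    by apply: eq_cintegral => x /edgeP x0; rewrite pE.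
  rewrite e (cintegral_edge_split (lexx 0) ipsi).
  by rewrite {1}/cintegral set_itv1 !Rintegral_set1 add0r.
pose NH := \int[mu]_(x in edge) weight k q x.
have NH0 : 0 <= NH by apply: Rintegral_ge0 => t _; exact: weight_ge0.
have M0 : 0 <= M by have [h _] := mM 0 (lexx 0); exact: le_trans (nc_ge0 _) h.
pose A := M * ((nc (2 * zeta) + 1) / nc (2 * zeta)).
pose Kc := M * ((nc (2 * zeta) + 1) * M * (2 / k)) + M * (2 * M * NH).
have z20 : 2 * zeta != 0 by rewrite mulf_neq0// pnatr_eq0.
have z2n : 0 < nc (2 * zeta) by rewrite nc_gt0.
have A0 : 0 <= A by rewrite mulr_ge0// divr_ge0 ?addr_ge0 ?nc_ge0.
have Kc0 : 0 <= Kc.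
  have l0 : 0 <= 2 / k by rewrite divr_ge0// ltW.
  apply: addr_ge0; first exact: mulr_ge0 M0 (mulr_ge0 (mulr_ge0 (addr_ge0 (nc_ge0 _) ler01) M0) l0).
  exact: mulr_ge0 M0 (mulr_ge0 (mulr_ge0 (ler0n R 2) M0) NH0).
pose B := 2 * A.
have unif z m' mp' : gsol q (I * z) m' mp' -> tends m' 1 -> k <= Im z ->
    (exists M', forall x, 0 <= x -> nc (m' x) <= M') ->
    nc (z - zeta) <= 1 -> Kc * nc (z - zeta) <= 2^-1 -> forall x, 0 <= x -> nc (m' x) <= B.
  move=> gs t1 kz' [M' hM'] e1 e2.
  pose E := [set nc (m' x) | x in edge].
  have hE : has_sup E.
    split; first by exists (nc (m' 0)); exists 0 => //; apply/edgeP.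
    by exists M' => _ [x /edgeP x0 <-]; exact: hM'.
  have lS x : 0 <= x -> nc (m' x) <= sup E.
    by move=> x0; apply: ub_le_sup; [exact: hE.2|exists x => //; exact/edgeP].
  have S0 : 0 <= sup E by exact: le_trans (nc_ge0 _) (lS 0 (lexx 0)).
  have step x : 0 <= x -> nc (m' x) <= A + 2^-1 * sup E.
    move=> x0; rewrite (m'E wr z m' mp' x0).
    have [a1 _] := mM x x0; have [b1 _] := nM x x0.
    have al := alpha_le iq k0 gm mM kz gs kz' lS x0.
    have bt := beta_tail iq k0 gm gn mM nM wr m1 kz gs t1 kz' lS x0.
    have k2' : k <= 2 * Im z by apply: (le_trans kz'); rewrite mulr_natl mulr2n lerDl (le_trans (ltW k0)).
    have mB' := gsol_weight iq k0 k2' gs lS.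
    have [mm' mmp'] := gsol_meas gs.
    have [ip lp] := psi_int iq k0 mn mnp mm' mmp' nM mB'.
    have tl : nc (cintegral `]x, +oo[ (psi n np m' mp')) <= 2 * M * sup E * NH.
      apply: (@le_trans _ _ (\int[mu]_(t in edge) nc (psi n np m' mp' t))).
        by apply: (le_trans (nc_tail x0 ip)); apply: rint_itv_sub; [exact: itvy_sub|exact: ip].
      rewrite /NH -RintegralZl; [|exact: edge_meas|exact: weight_rint].
      apply: le_Rintegral; [exact: edge_meas|exact: cint_nc edge_meas ip| |].
        by apply: rintZ; [exact: edge_meas|exact: weight_rint].
      by move=> t /edgeP; exact: lp.
    have zz : nc (zeta + z) <= nc (2 * zeta) + 1.
      have -> : zeta + z = 2 * zeta + (z - zeta) by ring.
      by apply: (le_trans (ncD _ _)); rewrite lerD2l.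
    have bb : nc (beta zeta n np z m' mp' x) <=
        (nc (2 * zeta) + 1) / nc (2 * zeta) + nc (z - zeta) * (2 * M * sup E * NH).
      rewrite bt; apply: (le_trans (ncD _ _)); apply: lerD.
        by rewrite [leLHS]ncM ncN ncV; apply: ler_wpM2r => //; rewrite invr_ge0 ltW.
      by apply: ncM_le => //; rewrite ncM nc_i mul1r.
    have aa : nc (alpha zeta m mp z m' mp' x) <=
        (nc (2 * zeta) + 1) * nc (z - zeta) * (M * sup E) * (2 / k).
      apply: (le_trans al); apply: ler_wpM2r; first by rewrite divr_ge0// ltW.
      apply: ler_wpM2r; first exact: mulr_ge0.
      by apply: ler_wpM2r; [exact: nc_ge0|].
    apply: (le_trans (ncB _ _)).
    apply: (le_trans (lerD (ncM_le b1 aa) (ncM_le a1 bb))).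
    have -> : M * ((nc (2 * zeta) + 1) * nc (z - zeta) * (M * sup E) * (2 / k)) +
       M * ((nc (2 * zeta) + 1) / nc (2 * zeta) + nc (z - zeta) * (2 * M * sup E * NH)) =
       A + (Kc * nc (z - zeta)) * sup E by rewrite /A /Kc; ring.
    by rewrite lerD2l; apply: ler_wpM2r.
  have : sup E <= A + 2^-1 * sup E.
    apply: ge_sup; first exact: hE.1.
    by move=> _ [x /edgeP x0 <-]; exact: step.
  move=> hs x x0; apply: (le_trans (lS x x0)); rewrite /B.
  by move: hs; move: (sup E) (A) => s a; lra.
pose dc := perturb_cst q zeta k M.
pose H2 x := dc * (1 + B) * weight k q x + (dc * (1 + B) + 2 * M) * weight2 q k x.
have iH2 : rint edge H2.
  have iw := weight_rint k0 iq.
  have iw2 : rint edge (weight2 q k).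
    have iqH : rint edge (fun t => `|q t| + weight k q t).
      by apply: rintD; [exact: edge_meas|exact: rint_norm|exact: iw].
    have qH0 t : edge t -> 0 <= `|q t| + weight k q t.
      by move=> _; apply: addr_ge0; [exact: normr_ge0|exact: weight_ge0].
    have [ic _] := cvl_rint k0 iqH qH0.
    apply: rint_le ic _; first exact: edge_meas.
      exact: rac_meas (rac_cvly k0 iqH).
    move=> x /edgeP x0; rewrite ger0_norm; last exact: cvly_ge0.
    exact: cvly_le.
  by apply: rintD; [exact: edge_meas|exact: rintZ edge_meas iw|exact: rintZ edge_meas iw2].
pose del := Num.min 1 (Num.min k (2^-1 / (Kc + 1))).
have del0 : 0 < del by rewrite !lt_min ltr01 k0 divr_gt0 ?invr_gt0// ltr_wpDl.
exists (M * \int[mu]_(x in edge) H2 x), del; split => // eta.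
rewrite !lt_min => /and3P[e1 e2 e3].
pose z := zeta + eta.
have ez : z - zeta = eta by rewrite /z addrAC subrr add0r.
have kz' : k <= Im z.
  rewrite /z cImD -k2; have := ler_normlW (nc_Im (- eta)); rewrite ncN cImN => h.
  by move: h e2; move: (Im eta) (nc eta) => s t; lra.
have zI : 0 < Im z by exact: lt_le_trans kz'.
have [gs t1 hb] := jost_gsol (hj z zI).
pose m' x := ex (- (I * z)) x * th x z.
pose mp' x := ex (- (I * z)) x * (dth x z - I * z * th x z).
have e3' : Kc * nc (z - zeta) <= 2^-1.
  rewrite ez; apply: (@le_trans _ _ ((Kc + 1) * nc eta)).
    by apply: ler_wpM2r; [exact: nc_ge0|rewrite lerDl].
  by rewrite mulrC -ler_pdivlMr ?ltW// ltr_wpDl.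
have e1' : nc (z - zeta) <= 1 by rewrite ez ltW.
have lB := unif z m' mp' gs t1 kz' hb e1' e3'.
have b0 := beta_tail iq k0 gm gn mM nM wr m1 kz gs t1 kz' lB (lexx 0).
have b0E : beta zeta n np z m' mp' 0 = ch 0 * dth 0 z - dch 0 * th 0 z.
  by rewrite /beta /psi /n /np /m' /mp' !ex0 /c; ring.
have k2' : k <= 2 * Im z by apply: (le_trans kz'); rewrite mulr_natl mulr2n lerDl (le_trans (ltW k0)).
have mB' := gsol_weight iq k0 k2' gs lB.
have [mm' mmp'] := gsol_meas gs.
have [ip lp] := psi_int iq k0 mn mnp mm' mmp' nM mB'.
have dpsi : nc (cintegral `]0, +oo[ (psi n np m' mp') - J) <= nc eta * (M * \int[mu]_(x in edge) H2 x).
  have sub : `]0, +oo[%classic `<=` edge by exact: itvy_sub.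
  rewrite J0 -cintegralB; [|exact: measurable_itv|exact: cint_edgey|exact: cint_edgey].
  have idp : cintegrable edge (fun x => psi n np m' mp' x - psi n np m mp x).
    by apply: cintB; [exact: edge_meas| |].
  apply: (le_trans (nc_cintegral (measurable_itv _) (cint_edgey (lexx 0) idp))).
  apply: (le_trans (rint_itv_sub sub idp)).
  rewrite mulrA -RintegralZl; [|exact: edge_meas|exact: iH2].
  apply: le_Rintegral; [exact: edge_meas|exact: cint_nc edge_meas idp|exact: rintZ edge_meas iH2|].
  move=> x /edgeP x0; have [b1 b2] := nM x x0.
  have d1 := m'_diff iq k0 gm gn mM nM wr m1 kz gs t1 kz' lB e1' x0.
  have d2 := mp'_diff iq k0 gm gn mM nM wr m1 kz gs t1 kz' lB e1' x0.
  rewrite ez in d1 d2.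
  have -> : psi n np m' mp' x - psi n np m mp x = n x * (mp' x - mp x) - np x * (m' x - m x).
    by rewrite /psi; ring.
  apply: (le_trans (ncB _ _)); apply: (le_trans (lerD (ncM_le b1 d2) (ncM_le b2 d1))).
  by apply: le_of_eq; rewrite /H2 /dc; ring.
have b1E : ch 0 * dth 0 zeta - dch 0 * th 0 zeta = -1 by exact: (ep_wr hp (lexx 0)).
rewrite b1E -/z -b0E b0 ez.
have -> : - (zeta + z) / (2 * zeta) + I * eta * cintegral `]0, +oo[ (psi n np m' mp') - -1 -
   eta * (- (2 * zeta)^-1 + I * J) = I * eta * (cintegral `]0, +oo[ (psi n np m' mp') - J).
  by rewrite /z; field; exact: zn0.
rewrite !ncM nc_i mul1r expr2.
apply: (le_trans (ler_wpM2l (nc_ge0 _) dpsi)).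
by apply: le_of_eq; ring.
Qed.

End EdgePair.

(** * First-order expansions and the vertex conditions *)

Section Dif.
Context {R : realType}.
Local Notation nc := (@Normc.normc R).
Implicit Types (f g : R[i] -> R[i]) (z l : R[i]).

Lemma dif_ext f g z l : f =1 g -> dif f z l -> dif g z l.
Proof.
move=> fg [C [del [d0 h]]]; exists C, del; split => // eta e; rewrite -!fg; exact: h.
Qed.

Lemma dif_cst a z : dif (fun=> a) z 0.
Proof.
exists 0, 1; split => // eta _.
by have -> : a - a - eta * 0 = 0; [ring|rewrite nc0 mul0r].
Qed.

Lemma dif_id z : dif id z 1.
Proof.
exists 0, 1; split => // eta _.
by have -> : id (z + eta) - id z - eta * 1 = 0; [rewrite /=; ring|rewrite nc0 mul0r].
Qed.

Lemma difD f g z l l' : dif f z l -> dif g z l' -> dif (fun x => f x + g x) z (l + l').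
Proof.
move=> [C [d [d0 h]]] [C' [d' [d0' h']]].
exists (C + C'), (Num.min d d'); split; first by rewrite lt_min d0.
move=> eta; rewrite lt_min => /andP[e e'].
have -> : f (z + eta) + g (z + eta) - (f z + g z) - eta * (l + l') =
  (f (z + eta) - f z - eta * l) + (g (z + eta) - g z - eta * l') by ring.
by rewrite mulrDl; apply: (le_trans (ncD _ _)); apply: lerD; [exact: h|exact: h'].
Qed.

Lemma difM f g z l l' : dif f z l -> dif g z l' ->
  dif (fun x => f x * g x) z (l * g z + f z * l').
Proof.
move=> [C [d [d0 h]]] [C' [d' [d0' h']]].
have C0 : 0 <= C \/ C < 0 by case: (leP 0 C); [left|right].
pose A := `|C|; pose A' := `|C'|.
exists (nc l * nc l' + (nc (f z) + nc l) * A' + A * (nc (g z) + nc l' + A')), (Num.min 1 (Num.min d d')).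
split; first by rewrite !lt_min ltr01 d0.
move=> eta; rewrite !lt_min => /and3P[e1 e e'].
pose r := f (z + eta) - f z - eta * l; pose s := g (z + eta) - g z - eta * l'.
have e0 := nc_ge0 eta.
have e20 : 0 <= nc eta ^+ 2 by exact: sqr_ge0.
have e21 : nc eta ^+ 2 <= 1 by rewrite expr_le1// ltW.
have hr : nc r <= A * nc eta ^+ 2.
  by apply: (le_trans (h _ e)); apply: ler_wpM2r => //; exact: ler_norm.
have hs : nc s <= A' * nc eta ^+ 2.
  by apply: (le_trans (h' _ e')); apply: ler_wpM2r => //; exact: ler_norm.
have -> : f (z + eta) * g (z + eta) - f z * g z - eta * (l * g z + f z * l') =
  eta ^+ 2 * (l * l') + (f z + eta * l) * s + r * (g z + eta * l' + s) by rewrite /r /s; ring.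
have h1 : nc (f z + eta * l) <= nc (f z) + nc l.
  by apply: (le_trans (ncD _ _)); rewrite lerD2l ncM ler_piMl ?nc_ge0// ltW.
have h2 : nc (g z + eta * l' + s) <= nc (g z) + nc l' + A'.
  apply: (le_trans (ncD _ _)); apply: lerD.
    by apply: (le_trans (ncD _ _)); rewrite lerD2l ncM ler_piMl ?nc_ge0// ltW.
  apply: (le_trans hs); rewrite ler_piMr ?normr_ge0//.
apply: (le_trans (ncD _ _)).
apply: (le_trans (lerD (ncD _ _) (ncM_le hr h2))).
apply: (le_trans (lerD (lerD (lexx _) (ncM_le h1 hs)) (lexx _))).
by rewrite [nc (_ * (l * l'))]ncM [nc (eta ^+ 2)]ncX [nc (l * l')]ncM; apply: le_of_eq; ring.
Qed.

Lemma difV z : z != 0 -> dif (fun x => x^-1) z (- z ^- 2).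
Proof.
move=> z0; have nz : 0 < nc z by rewrite nc_gt0.
exists ((nc z ^+ 2)^-1 * (2 / nc z)), (nc z / 2); split; first by rewrite divr_gt0.
move=> eta e.
have hz : nc z / 2 <= nc (z + eta).
  have := ncB (z + eta) eta; rewrite addrK => h; move: h e.
  by move: (nc z) (nc (z + eta)) (nc eta) => a b c; lra.
have z1 : z + eta != 0 by rewrite -nc_gt0 (lt_le_trans _ hz)// divr_gt0.
have -> : (z + eta)^-1 - z^-1 - eta * - z ^- 2 = (z ^+ 2)^-1 * (z + eta)^-1 * eta ^+ 2.
  by field; rewrite z0 z1.
rewrite [leLHS]ncM [nc (eta ^+ 2)]ncX [nc (_ * (z + eta)^-1)]ncM !ncV ncX; apply: ler_wpM2r; first exact: sqr_ge0.
apply: ler_wpM2l; first by rewrite invr_ge0 sqr_ge0.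
by rewrite -[2 / nc z]invrK invfM invrK mulrC lef_pV2// ?posrE ?divr_gt0// nc_gt0.
Qed.

Lemma dif_sum (J : Type) (r : seq J) (P : pred J) (f : J -> R[i] -> R[i]) z (l : J -> R[i]) :
  (forall j, P j -> dif (f j) z (l j)) ->
  dif (fun x => \sum_(j <- r | P j) f j x) z (\sum_(j <- r | P j) l j).
Proof.
move=> h; elim: r => [|j r ih].
  rewrite big_nil; apply: dif_ext (dif_cst 0 z) => x; by rewrite big_nil.
rewrite big_cons; case: ifP => Pj.
  by apply: dif_ext (difD (h j Pj) ih) => x; rewrite big_cons Pj.
by apply: dif_ext ih => x; rewrite big_cons Pj.
Qed.

Lemma dif_prod (J : eqType) (r : seq J) (f : J -> R[i] -> R[i]) z (l : J -> R[i]) :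
  uniq r -> (forall j, dif (f j) z (l j)) ->
  dif (fun x => \prod_(j <- r) f j x) z (\sum_(k <- r) l k * \prod_(j <- r | j != k) f j z).
Proof.
move=> ur h; elim: r ur => [_|i r ih /= /andP[ir ur]].
  rewrite big_nil; apply: dif_ext (dif_cst 1 z) => x; by rewrite big_nil.
have e1 : \prod_(j <- i :: r | j != i) f j z = \prod_(j <- r) f j z.
  rewrite big_cons eqxx /=; rewrite [RHS]big_seq [LHS]big_seq_cond; apply: eq_bigl => j.
  by case: (boolP (j \in r)) => //= jr; apply: contraNneq ir => <-.
have e2 : \sum_(k <- r) l k * \prod_(j <- i :: r | j != k) f j z =
    f i z * \sum_(k <- r) l k * \prod_(j <- r | j != k) f j z.
  rewrite mulr_sumr !big_seq; apply: eq_bigr => k kr.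
  rewrite big_cons ifT; last by apply: contraNneq ir => ->.
  by ring.
rewrite big_cons e1 e2.
by apply: dif_ext (difM (h i) (ih ur)) => x; rewrite big_cons.
Qed.

Lemma dif_derivable (f : R[i]^o -> R[i]^o) (z l : R[i]^o) : dif f z l ->
  derivable f z 1 /\ derive1 f z = l.
Proof.
move=> [C [d [d0 h]]].
have cv : h^-1 *: (f (h + z) - f z) @[h --> (0 : R[i]^o)^'] --> l.
  apply/cvgcP => e e0.
  pose b := Num.min d (e / (`|C| + 1)).
  have b0 : 0 < b by rewrite lt_min d0 divr_gt0// ltr_wpDl.
  have b0' : 0 < b%:C%C :> R[i] by rewrite ltcR.
  rewrite near_withinE; near=> t => t0.
  have tb : nc t < b.
    have : `|t| < b%:C%C.
      by near: t; apply/nbhs_ballP; exists b%:C%C => //= y; rewrite /ball /= sub0r normrN.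
    by rewrite normCE ltcR.
  have nt0 : 0 < nc t by rewrite nc_gt0.
  move: tb; rewrite lt_min => /andP[td te].
  have -> : t^-1 *: (f (t + z) - f z) - l = t^-1 * (f (z + t) - f z - t * l).
    rewrite [t + z]addrC /GRing.scale /= [RHS]mulrBr mulKf//.
  rewrite ncM ncV ltr_pdivrMl//; apply: (le_lt_trans (h t td)).
  rewrite expr2 mulrA [ltRHS]mulrC ltr_pM2r//.
  move: te; rewrite ltr_pdivlMr ?ltr_wpDl// mulrDr mulr1 => te.
  apply: le_lt_trans te; rewrite -[leLHS]addr0 mulrC; apply: lerD; last exact: ltW.
  by apply: ler_wpM2l; [exact: ltW|exact: ler_norm].
split.
  apply/cvg_ex; exists l.
  by under eq_fun do rewrite [_ *: 1]mulr1.
exact: (cvg_lim (@norm_hausdorff _ R[i]^o) cv).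
Unshelve. all: by end_near. Qed.

End Dif.

Section Kirchhoff.
Context {F : fieldType} {n : nat}.
Variables (w dw : 'I_n -> F).

Definition kw := \sum_j dw j * \prod_(k < n | k != j) w k.
Hypothesis kw0 : kw != 0.

(* [kch] and [kdch] are the initial data of a second solution on each edge for
   which the kernel built from it satisfies the vertex conditions; [kcc] is the
   transmission coefficient between edges. *)
Definition kcc j l := - (\prod_(k < n | (k != j) && (k != l)) w k) / kw.
Definition kch j := - (\prod_(k < n | k != j) w k) / kw.
Definition kdch j := - \sum_(l < n | l != j) kcc j l * dw l.

Lemma kccC j l : kcc j l = kcc l j.
Proof. by rewrite /kcc; congr (- _ / _); apply: eq_bigl => k; rewrite andbC. Qed.

Lemma kchE j l : l != j -> kch j = kcc j l * w l.
Proof.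
move=> lj; rewrite /kch /kcc (bigD1 l)//=; ring.
Qed.

Lemma kwr j : kch j * dw j - kdch j * w j = -1.
Proof.
have e : kdch j * w j = (\sum_(l < n | l != j) dw l * \prod_(k < n | k != l) w k) / kw.
  rewrite /kdch mulNr mulr_suml -sumrN mulr_suml; apply: eq_bigr => l lj.
  rewrite /kcc [\prod_(k < n | k != l) w k](bigD1 j)/=; last by rewrite eq_sym.
  have -> : \prod_(k < n | (k != l) && (k != j)) w k = \prod_(k < n | (k != j) && (k != l)) w k.
    by apply: eq_bigl => k; rewrite andbC.
  ring.
rewrite e /kch; set X := \prod_(k < n | k != j) w k; set S := \sum_(l < n | l != j) _.
have kwE : kw = dw j * X + S by rewrite /kw (bigD1 j).
have -> : - X / kw * dw j - S / kw = - ((dw j * X + S) / kw) by ring.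
by rewrite -kwE divff.
Qed.

Lemma kw_dif (dd1 dd2 : 'I_n -> F) :
  \sum_j (dd2 j * (\prod_(k < n | k != j) w k) +
          dw j * \sum_(k < n | k != j) dd1 k * \prod_(l < n | (l != j) && (l != k)) w l) =
  - kw * \sum_j (kch j * dd2 j - kdch j * dd1 j).
Proof.
rewrite !big_split /= mulrDr; congr (_ + _).
  rewrite mulr_sumr; apply: eq_bigr => j _; rewrite /kch; field; exact: kw0.
rewrite sumrN mulrN mulNr opprK mulr_sumr.
transitivity (\sum_(j < n) \sum_(k < n | k != j)
    dw j * (dd1 k * \prod_(l < n | (l != j) && (l != k)) w l)).
  by apply: eq_bigr => j _; rewrite mulr_sumr.
rewrite (exchange_big_dep xpredT)//=; apply: eq_bigr => k _.
have -> : kw * (kdch k * dd1 k) = \sum_(l < n | l != k) - (kw * (kcc k l * dw l * dd1 k)).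
  by rewrite /kdch sumrN mulNr mulrN [X in kw * X]mulr_suml mulr_sumr.
apply: eq_big => [j|j jk].
  by rewrite eq_sym.
rewrite kccC /kcc; field; exact: kw0.
Qed.

End Kirchhoff.

(** * The Green operator *)

Section L2Edge.
Context {R : realType}.
Local Notation edge := (edge R).
Local Notation nc := (@Normc.normc R).
Implicit Types (u v : R -> R[i]).

Definition L2e u := cmeas edge u /\ rint edge (fun x => nc (u x) ^+ 2).

Lemma L2P n (f : gfun R n) : L2 f <-> forall j, L2e (f j).
Proof.
split=> h j; first by have [a b c] := h j.
by have [[a b] c] := h j.
Qed.

Lemma L2e_le u (h : R -> R) : cmeas edge u -> rint edge (fun x => h x ^+ 2) ->
  (forall x, 0 <= x -> nc (u x) <= h x) -> L2e u.
Proof.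
move=> mu_ ih uh; split => //; apply: (rint_le _ _ ih); first exact: edge_meas.
  by apply: measurable_funX; exact: cmeas_nc.
move=> x /edgeP x0; rewrite ger0_norm ?sqr_ge0//.
by rewrite lerXn2r ?nnegrE ?nc_ge0 ?uh// (le_trans (nc_ge0 _) (uh x x0)).
Qed.

Lemma L2e_ext u v : (forall x, 0 <= x -> u x = v x) -> L2e u -> L2e v.
Proof.
move=> uv [mu_ iu]; split.
  by apply: cmeas_ext mu_ => x /edgeP; exact: uv.
by apply: rint_ext iu => x /edgeP x0; rewrite uv.
Qed.

Lemma L2eD u v : L2e u -> L2e v -> L2e (fun x => u x + v x).
Proof.
move=> [mu_ iu] [mv iv]; split; first exact: cmeasD.
apply: (rint_le _ _ (rintD edge_meas (rintZ 2 edge_meas iu) (rintZ 2 edge_meas iv))).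
- exact: edge_meas.
- by apply: measurable_funX; apply: cmeas_nc; exact: cmeasD.
- by move=> x _; rewrite ger0_norm ?sqr_ge0//; exact: sqr_ncD.
Qed.

Lemma L2eZ (a : R[i]) u : L2e u -> L2e (fun x => a * u x).
Proof.
move=> [mu_ iu]; split; first by apply: cmeasM => //; exact: cmeas_cst.
by apply: rint_ext (rintZ (nc a ^+ 2) edge_meas iu) => x _; rewrite ncM exprMn.
Qed.

Lemma L2eN u : L2e u -> L2e (fun x => - u x).
Proof. by move=> h; apply: L2e_ext (L2eZ (-1) h) => x _; rewrite mulN1r. Qed.

Lemma L2eB u v : L2e u -> L2e v -> L2e (fun x => u x - v x).
Proof. by move=> hu hv; apply: L2eD => //; exact: L2eN. Qed.

Lemma L2e_conj u : L2e u -> L2e (fun x => conjc (u x)).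
Proof.
move=> [mu_ iu]; split; first exact: cmeas_conj.
by apply: rint_ext iu => x _; rewrite nc_conjc.
Qed.

Lemma L2e_sum (J : Type) (r : seq J) (P : pred J) (u : J -> R -> R[i]) :
  (forall j, P j -> L2e (u j)) -> L2e (fun x => \sum_(j <- r | P j) u j x).
Proof.
move=> h; elim: r => [|j r ih].
  split; first by apply: cmeas_sum => i /h[].
  by apply: (rint_ext _ (integrable0 _ _)) => x _; rewrite big_nil nc0 expr0n.
case: (boolP (P j)) => Pj.
  by apply: L2e_ext (L2eD (h j Pj) ih) => x _; rewrite big_cons Pj.
by apply: L2e_ext ih => x _; rewrite big_cons (negPf Pj).
Qed.

Lemma L2eM u v : L2e u -> L2e v -> cintegrable edge (fun x => u x * v x).
Proof.
move=> [mu_ iu] [mv iv].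
apply: (cint_le _ _ (rintZ 2^-1 edge_meas (rintD edge_meas iu iv))); first exact: edge_meas.
  exact: cmeasM.
move=> x _; rewrite ncM; have := sqr_ge0 (nc (u x) - nc (v x)).
by rewrite sqrrB; move: (nc (u x)) (nc (v x)) => a b; rewrite -mulr_natl; lra.
Qed.

Lemma L2e_exp k : 0 < k -> rint edge (fun x => expR (- k * x) ^+ 2).
Proof.
move=> k0; have k2 : 0 < k + k by exact: addr_gt0.
have [i _] := rint_expN k2; apply: rint_ext i => x _.
by rewrite expr2 -expRD; congr expR; ring.
Qed.

Lemma L2e_expmul k u : 0 < k -> L2e u -> rint edge (fun y => expR (- k * y) * nc (u y)).
Proof.
move=> k0 [mu_ iu].
apply: (rint_le _ _ (rintZ 2^-1 edge_meas (rintD edge_meas (L2e_exp k0) iu))).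
- exact: edge_meas.
- apply: measurable_funM; last exact: cmeas_nc.
  by apply: measurableT_comp => //; apply: measurable_funM.
- move=> x _; rewrite ger0_norm ?mulr_ge0 ?expR_ge0 ?nc_ge0//.
  have := sqr_ge0 (expR (- k * x) - nc (u x)).
  by rewrite sqrrB; move: (expR (- k * x)) (nc (u x)) => a b; rewrite -mulr_natl; lra.
Qed.

End L2Edge.

Section PairBounds.
Context {R : realType}.
Local Notation mu := (@lebesgue_measure R).
Local Notation edge := (edge R).
Local Notation nc := (@Normc.normc R).
Local Notation Im := complex.Im.
Local Notation I := ('i%C : R[i]).
Implicit Types (q : R -> R) (zeta : R[i]).

Lemma weight_le k q x : 0 < k -> rint edge q -> 0 <= x ->
  weight k q x <= 1 + \int[mu]_(t in edge) `|q t|.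
Proof.
move=> k0 iq t0; apply: lerD.
  by rewrite -expR0 ler_expR mulNr oppr_le0 mulr_ge0// ltW.
apply: le_Rintegral; [exact: edge_meas|exact: cvl_int (rint_norm iq)|exact: rint_norm|].
move=> y _; rewrite ler_piMl// ?normr_ge0//.
by rewrite (le_trans (ler_norm _))// expR_abs_le1.
Qed.

Lemma nc_exg zeta x : nc (ex (- (I * zeta)) x) = expR (Im zeta * x) /\
  nc (ex (I * zeta) x) = expR (- Im zeta * x).
Proof. by rewrite !nc_ex cReN Re_ci opprK. Qed.

Lemma edge_pair_bounds q zeta th dth ch dch M : rint edge q -> 0 < Im zeta ->
  edge_pair q zeta th dth ch dch M -> exists2 A, 0 <= A & forall x, 0 <= x ->
    [/\ nc (th x) <= A * expR (- Im zeta * x), nc (dth x) <= A * expR (- Im zeta * x),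
        nc (ch x) <= A * expR (Im zeta * x) & nc (dch x) <= A * expR (Im zeta * x)].
Proof.
move=> iq z0 hp; set kap := Im zeta.
have k0 : 0 < kap / 2 by rewrite divr_gt0.
pose W := 1 + \int[mu]_(t in edge) `|q t|.
have W0 : 0 <= W by apply: addr_ge0 => //; apply: Rintegral_ge0 => t _; exact: normr_ge0.
have M0 : 0 <= M by have [h _] := ep_m hp (lexx 0); exact: le_trans (nc_ge0 _) h.
pose A := M * W + nc (I * zeta) * M + M.
have c0 := nc_ge0 (I * zeta).
have A0 : 0 <= A by rewrite !addr_ge0 ?mulr_ge0.
have MA : M <= A by rewrite lerDr addr_ge0 ?mulr_ge0.
exists A => // x x0.
have [e1 e2] := nc_exg zeta x.
have wW : M * weight (Im zeta / 2) q x <= M * W by apply: ler_wpM2l => //; exact: weight_le.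
have g1 : expR (kap * x) * expR (- kap * x) = 1 by rewrite -expRD mulNr addrN expR0.
have drop a (C : R) : expR (kap * x) * a <= C -> a <= C * expR (- kap * x).
  move=> h; have := ler_wpM2r (expR_ge0 (- kap * x)) h.
  by rewrite mulrAC g1 mul1r.
have drop2 a (C : R) : expR (- kap * x) * a <= C -> a <= C * expR (kap * x).
  move=> h; have := ler_wpM2r (expR_ge0 (kap * x)) h.
  by rewrite mulrAC [expR (- _ * _) * _]mulrC g1 mul1r.
have [m1 m2] := ep_m hp x0; have [n1 n2] := ep_n hp x0.
rewrite !ncM e1 in m1 m2; rewrite !ncM e2 in n1 n2.
split.
- by apply: drop; exact: le_trans m1 MA.
- apply: drop.
  have h : nc (dth x) <= nc (dth x - I * zeta * th x) + nc (I * zeta) * nc (th x).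
    by rewrite -ncM -{1}(subrK (I * zeta * th x) (dth x)); exact: ncD.
  apply: (le_trans (ler_wpM2l (expR_ge0 _) h)); rewrite mulrDr.
  apply: (@le_trans _ _ (M * W + nc (I * zeta) * M)); last by rewrite lerDl.
  apply: lerD; first exact: le_trans m2 wW.
  by rewrite mulrCA; apply: ler_wpM2l.
- by apply: drop2; exact: le_trans n1 MA.
- apply: drop2.
  have h : nc (dch x) <= nc (dch x + I * zeta * ch x) + nc (I * zeta) * nc (ch x).
    by rewrite -ncM -{1}(addrK (I * zeta * ch x) (dch x)); exact: ncB.
  apply: (le_trans (ler_wpM2l (expR_ge0 _) h)); rewrite mulrDr.
  apply: (@le_trans _ _ (M * W + nc (I * zeta) * M)); last by rewrite lerDl.
  apply: lerD; first exact: le_trans n2 wW.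
  by rewrite mulrCA; apply: ler_wpM2l.
Qed.

End PairBounds.

Section CvlL2.
Context {R : realType}.
Local Notation mu := (@lebesgue_measure R).
Local Notation edge := (edge R).
Implicit Types (p : R -> R) (k x y : R).

Lemma exp_abs_le k x y : 0 < k -> 0 <= x -> expR (- k * `|x - y|) <= expR (k * x) * expR (- k * y).
Proof.
move=> k0 x0; rewrite -expRD ler_expR -subr_ge0.
have -> : k * x + - k * y - - k * `|x - y| = k * (`|x - y| - (y - x)) by ring.
by rewrite mulr_ge0 ?(ltW k0)// subr_ge0 distrC ler_norm.
Qed.

Lemma cvl_int_exp k p x : 0 < k -> 0 <= x -> measurable_fun edge p ->
  (forall y, edge y -> 0 <= p y) -> rint edge (fun y => expR (- k * y) * p y) ->
  rint edge (fun y => expR (- k * `|x - y|) * p y).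
Proof.
move=> k0 x0 mp p0 ip; apply: (rint_le _ _ (rintZ (expR (k * x)) edge_meas ip)).
- exact: edge_meas.
- by apply: measurable_funM => //; exact: expR_abs_meas.
- move=> y ye; rewrite ger0_norm ?mulr_ge0 ?expR_ge0 ?p0// mulrA.
  by apply: ler_wpM2r; [exact: p0|exact: exp_abs_le].
Qed.

Lemma cvl_cauchy_schwarz k p x : 0 < k -> 0 <= x -> measurable_fun edge p ->
  rint edge (fun y => p y ^+ 2) -> cvl k p x ^+ 2 <= 2 / k * cvl k (fun y => p y ^+ 2) x.
Proof.
move=> k0 x0 mp ip2; have [ie le] := expR_abs_rint k0 x0.
pose e y := expR (- k * `|x - y|).
have e0 y : 0 <= e y by exact: expR_ge0.
have i2 : rint edge (fun y => e y * p y ^+ 2) by exact: cvl_int.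
have i1 : rint edge (fun y => e y * p y).
  apply: (rint_le _ _ (rintZ 2^-1 edge_meas (rintD edge_meas ie i2))); first exact: edge_meas.
    by apply: measurable_funM => //; exact: expR_abs_meas.
  move=> y _; rewrite normrM (ger0_norm (e0 y)) -/(e y).
  have -> : 2^-1 * (e y + e y * p y ^+ 2) = e y * (2^-1 * (1 + p y ^+ 2)) by ring.
  apply: ler_wpM2l => //; have := sqr_ge0 (`|p y| - 1).
  by rewrite -[p y ^+ 2]real_normK ?num_real//; move: (`|p y|) => a; nra.
have q t : 0 <= \int[mu]_(y in edge) (e y * (p y - t) ^+ 2).
  by apply: Rintegral_ge0 => y _; rewrite mulr_ge0// sqr_ge0.
have qE t : \int[mu]_(y in edge) (e y * (p y - t) ^+ 2) =
    cvl k (fun y => p y ^+ 2) x - (2 * t) * cvl k p x + t ^+ 2 * \int[mu]_(y in edge) e y.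
  have -> : (2 * t) * cvl k p x = \int[mu]_(y in edge) ((2 * t) * (e y * p y)).
    by rewrite RintegralZl; [|exact: edge_meas|exact: i1].
  have -> : t ^+ 2 * \int[mu]_(y in edge) e y = \int[mu]_(y in edge) (t ^+ 2 * e y).
    by rewrite RintegralZl; [|exact: edge_meas|exact: ie].
  have i1' := rintZ (2 * t) edge_meas i1.
  have ie' := rintZ (t ^+ 2) edge_meas ie.
  rewrite -RintegralB; [|exact: edge_meas|exact: i2|exact: i1'].
  rewrite -RintegralD; [|exact: edge_meas|exact: rintB edge_meas i2 i1'|exact: ie'].
  by apply: eq_Rintegral => y _; rewrite /e; ring.
pose Y := cvl k p x; pose X := cvl k (fun y => p y ^+ 2) x.
have k2 : 0 < 2 / k by rewrite divr_gt0.
have := q (Y / (2 / k)); rewrite qE -/X -/Y.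
have : (Y / (2 / k)) ^+ 2 * \int[mu]_(y in edge) e y <= (Y / (2 / k)) ^+ 2 * (2 / k).
  by apply: ler_wpM2l => //; exact: sqr_ge0.
move: (\int[mu]_(y in edge) e y) (2 / k) k2 (X) (Y) => E s s0 a b h1 h2.
have s1 : s != 0 by rewrite gt_eqF.
have h3 : 0 <= a - 2 * (b / s) * b + (b / s) ^+ 2 * s.
  by apply: (le_trans h2); rewrite lerD2l.
have e3 : a - 2 * (b / s) * b + (b / s) ^+ 2 * s = a - b ^+ 2 / s by field.
by move: h3; rewrite e3 subr_ge0 ler_pdivrMr// mulrC.
Qed.

Lemma sqr_sum_le n (a : 'I_n -> R) : (\sum_j a j) ^+ 2 <= n%:R * \sum_j a j ^+ 2.
Proof.
rewrite expr2 big_distrlr /=.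
apply: (@le_trans _ _ (\sum_(j < n) \sum_(l < n) (2^-1 * a j ^+ 2 + 2^-1 * a l ^+ 2))).
  apply: ler_sum => j _; apply: ler_sum => l _.
  by have := sqr_ge0 (a j - a l); move: (a j) (a l) => x y; nra.
set S := \sum_j a j ^+ 2.
have e j : \sum_(l < n) (2^-1 * a j ^+ 2 + 2^-1 * a l ^+ 2) = n%:R * (2^-1 * a j ^+ 2) + 2^-1 * S.
  by rewrite big_split /= sumr_const card_ord -mulr_sumr mulr_natl.
rewrite (eq_bigr _ (fun j _ => e j)) big_split /= -!mulr_sumr sumr_const card_ord -mulr_natl -/S.
by apply: le_of_eq; field.
Qed.

End CvlL2.

Section Green.
Context {R : realType} {n : nat}.
Local Notation edge := (edge R).
Local Notation nc := (@Normc.normc R).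
Local Notation Im := complex.Im.
Local Notation ac := (@ac_derivative R).
Local Notation gfun := (gfun R n).

Record green_data (V : 'I_n -> R -> R) (zeta : R[i]) (th dth ch dch : gfun)
  (cc : 'I_n -> 'I_n -> R[i]) (A : R) : Prop := GreenData {
  gd_V : forall j, rint edge (V j) ;
  gd_im : 0 < Im zeta ;
  gd_A : 0 <= A ;
  gd_th : forall j, schrodinger_solution (V j) (zeta ^+ 2) (th j) (dth j) ;
  gd_ch : forall j, schrodinger_solution (V j) (zeta ^+ 2) (ch j) (dch j) ;
  gd_wr : forall j x, 0 <= x -> ch j x * dth j x - dch j x * th j x = -1 ;
  gd_le : forall j x, 0 <= x ->
    [/\ nc (th j x) <= A * expR (- Im zeta * x), nc (dth j x) <= A * expR (- Im zeta * x),
        nc (ch j x) <= A * expR (Im zeta * x) & nc (dch j x) <= A * expR (Im zeta * x)] ;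
  gd_ccC : forall j l, cc j l = cc l j ;
  gd_ccA : forall j l, nc (cc j l) <= A ;
  gd_ch0 : forall j l, l != j -> ch j 0 = cc j l * th l 0 ;
  gd_dch0 : forall j, dch j 0 = - \sum_(l < n | l != j) cc j l * dth l 0 }.

Variables (V : 'I_n -> R -> R) (zeta : R[i]) (th dth ch dch : gfun)
  (cc : 'I_n -> 'I_n -> R[i]) (A : R).
Hypothesis gd : green_data V zeta th dth ch dch cc A.

Local Notation kap := (Im zeta).
Let kap0 : 0 < kap := gd_im gd.
Let A0 : 0 <= A := gd_A gd.

Definition kern (a b : gfun) j x l y : R[i] :=
  if l == j then (if y <= x then a j x * ch j y else b j x * th j y)
  else cc j l * a j x * th l y.

Definition gop (k : 'I_n -> R -> 'I_n -> R -> R[i]) (f : gfun) : gfun :=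
  fun j x => \sum_l cintegral edge (fun y => k j x l y * f l y).

Definition green := gop (kern th ch).
Definition dgreen := gop (kern dth dch).

Definition gcst := A * A + A * A * A.

Lemma gcst_ge0 : 0 <= gcst. Proof. by rewrite addr_ge0 ?mulr_ge0. Qed.

Lemma th_meas j : cmeas edge (th j). Proof. exact: ac_meas (proj1 (gd_th gd j)). Qed.
Lemma dth_meas j : cmeas edge (dth j). Proof. exact: ac_meas (proj2 (gd_th gd j)). Qed.
Lemma ch_meas j : cmeas edge (ch j). Proof. exact: ac_meas (proj1 (gd_ch gd j)). Qed.
Lemma cmeas_if x (f g : R -> R[i]) : cmeas edge f -> cmeas edge g ->
  cmeas edge (fun y => if y <= x then f y else g y).
Proof.
move=> mf mg; pose i := \1_[set` (`]-oo, x]%R : interval R)] : R -> R.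
have mi : measurable_fun edge i by apply: measurable_indic; exact: measurable_itv.
apply: (@cmeas_ext _ _ (fun y => (i y)%:C%C * f y + (1 - i y)%:C%C * g y)).
  move=> y _; rewrite /i indicE mem_setE in_itv /=.
  by case: ifP => _; rewrite ?subrr ?subr0 ?mul1r ?mul0r ?addr0 ?add0r.
apply: cmeasD; apply: cmeasM => //; apply: cmeas_real => //.
by apply: measurable_funB.
Qed.

Lemma kern_meas (a b : gfun) j x l : cmeas edge (kern a b j x l).
Proof.
rewrite /kern; case: (l == j); last by apply: cmeasM; [exact: cmeas_cst|exact: th_meas].
apply: cmeas_if; apply: cmeasM; first [exact: cmeas_cst|exact: ch_meas|exact: th_meas].
Qed.

Definition growth (a b : gfun) := forall j x, 0 <= x ->
  nc (a j x) <= A * expR (- kap * x) /\ nc (b j x) <= A * expR (kap * x).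

Lemma growth0 : growth th ch.
Proof. by move=> j x x0; have [] := gd_le gd j x0. Qed.

Lemma growth1 : growth dth dch.
Proof. by move=> j x x0; have [] := gd_le gd j x0. Qed.

Lemma kern_le a b j x l y : growth a b -> 0 <= x -> 0 <= y ->
  nc (kern a b j x l y) <= gcst * expR (- kap * `|x - y|).
Proof.
move=> gab x0 y0; have [ax bx] := gab j x x0.
have [ty _ cy _] := gd_le gd j y0; have [ly _ _ _] := gd_le gd l y0.
have up (C : R) : C <= gcst -> C * expR (- kap * `|x - y|) <= gcst * expR (- kap * `|x - y|).
  by move=> h; apply: ler_wpM2r => //; exact: expR_ge0.
have A2 : A * A <= gcst by rewrite lerDl !mulr_ge0.
have A3 : A * A * A <= gcst by rewrite lerDr !mulr_ge0.
rewrite /kern; case: ifP => _.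
  case: ifPn => [yx|].
    apply: le_trans (up _ A2); apply: (le_trans (ncM_le ax cy)).
    rewrite ger0_norm ?subr_ge0//; apply: le_of_eq.
    by rewrite mulrACA -expRD; congr (_ * expR _); ring.
  rewrite -ltNge => /ltW xy.
  apply: le_trans (up _ A2); apply: (le_trans (ncM_le bx ty)).
  rewrite distrC ger0_norm ?subr_ge0//; apply: le_of_eq.
  by rewrite mulrACA -expRD; congr (_ * expR _); ring.
apply: le_trans (up _ A3).
apply: (le_trans (ncM_le (ncM_le (gd_ccA gd j l) ax) ly)).
have -> : A * (A * expR (- kap * x)) * (A * expR (- kap * y)) =
  A * A * A * (expR (- kap * x) * expR (- kap * y)) by ring.
apply: ler_wpM2l; first by rewrite !mulr_ge0.
rewrite -expRD ler_expR -subr_ge0.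
have -> : - kap * `|x - y| - (- kap * x + - kap * y) = kap * (x + y - `|x - y|) by ring.
apply: mulr_ge0; [exact: ltW|rewrite subr_ge0].
by apply: (le_trans (ler_normB _ _)); rewrite !ger0_norm.
Qed.

Definition src (f : gfun) := forall l,
  cmeas edge (f l) /\ rint edge (fun y => expR (- kap * y) * nc (f l y)).

Lemma src_cvl f l x : src f -> 0 <= x -> rint edge (fun y => expR (- kap * `|x - y|) * nc (f l y)).
Proof.
move=> sf x0; have [mf fi] := sf l; apply: cvl_int_exp => //; first exact: cmeas_nc.
by move=> y _; exact: nc_ge0.
Qed.

Lemma kern_int a b f j x l : growth a b -> src f -> 0 <= x ->
  cintegrable edge (fun y => kern a b j x l y * f l y).
Proof.
move=> gab sf x0; have [mf _] := sf l.
apply: (cint_le _ _ (rintZ gcst edge_meas (src_cvl l sf x0))); first exact: edge_meas.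
  by apply: cmeasM => //; exact: kern_meas.
move=> y /edgeP y0; rewrite ncM mulrA; apply: ler_wpM2r; first exact: nc_ge0.
exact: kern_le.
Qed.

Lemma gop_le a b f j x : growth a b -> src f -> 0 <= x ->
  nc (gop (kern a b) f j x) <= gcst * \sum_l cvl kap (fun y => nc (f l y)) x.
Proof.
move=> gab sf x0; apply: (le_trans (nc_sum _ _ _)); rewrite mulr_sumr.
apply: ler_sum => l _; have [mf _] := sf l.
rewrite /cvl -RintegralZl; [|exact: edge_meas|exact: src_cvl].
apply: nc_cintegral_le; [exact: edge_meas|exact: cint_meas (kern_int _ _ gab sf x0)| |].
  by apply: rintZ; [exact: edge_meas|exact: src_cvl].
move=> y /edgeP y0; rewrite ncM mulrA; apply: ler_wpM2r; first exact: nc_ge0.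
exact: kern_le.
Qed.

Lemma th_int f l : src f -> cintegrable edge (fun y => th l y * f l y).
Proof.
move=> sf; have [mf fi] := sf l.
apply: (cint_le _ _ (rintZ A edge_meas fi)); first exact: edge_meas.
  by apply: cmeasM => //; exact: th_meas.
move=> y /edgeP y0; rewrite ncM mulrA; apply: ler_wpM2r; first exact: nc_ge0.
by have [] := gd_le gd l y0.
Qed.

Lemma src_int f l x : src f -> cintegrable `[0, x] (f l).
Proof.
move=> sf; have [mf fi] := sf l.
apply: (cint_le _ _ (rintZ (expR (kap * x)) (measurable_itv _) (rint_edge0 x fi))).
- exact: measurable_itv.
- by apply: (cmeasS _ (@itv0_sub _ x)) => //; exact: measurable_itv.
- move=> y; rewrite /= in_itv /= => /andP[y0 yx]; rewrite mulrA -[leLHS]mul1r.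
  apply: ler_wpM2r; first exact: nc_ge0.
  rewrite -expRD -expR0 ler_expR mulNr -mulrBr; apply: mulr_ge0; first exact: ltW.
  by rewrite subr_ge0.
Qed.

Lemma ch_int f l x : src f -> cintegrable `[0, x] (fun y => ch l y * f l y).
Proof.
move=> sf; have [mf _] := sf l.
have i := cint_nc (measurable_itv _) (src_int l x sf).
apply: (cint_le _ _ (rintZ (A * expR (kap * x)) (measurable_itv _) i)).
- exact: measurable_itv.
- apply: (cmeasS _ (@itv0_sub _ x)); first exact: measurable_itv.
  by apply: cmeasM => //; exact: ch_meas.
- move=> y; rewrite /= in_itv /= => /andP[y0 yx]; rewrite ncM.
  apply: ler_wpM2r; first exact: nc_ge0.
  have [_ _ h _] := gd_le gd l y0; apply: (le_trans h); apply: ler_wpM2l => //.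
  by rewrite ler_expR; apply: ler_wpM2l => //; exact: ltW.
Qed.

Definition thint f l := cintegral edge (fun y => th l y * f l y).
Definition kapc f j := \sum_(l < n | l != j) cc j l * thint f l.

Lemma gopE a b f j x : growth a b -> src f -> 0 <= x -> gop (kern a b) f j x =
  a j x * (cintegral `[0, x] (fun y => ch j y * f j y) + kapc f j) +
  b j x * (thint f j - cintegral `[0, x] (fun y => th j y * f j y)).
Proof.
move=> gab sf x0; rewrite /gop (bigD1 j)//=.
have -> : \sum_(l < n | l != j) cintegral edge (fun y => kern a b j x l y * f l y) = a j x * kapc f j.
  rewrite /kapc mulr_sumr; apply: eq_bigr => l lj.
  rewrite /thint -!cintegralZ; [|exact: edge_meas|exact: cintZ edge_meas (th_int l sf)|exact: edge_meas|exact: th_int].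
  by apply: eq_cintegral => y _; rewrite /kern (negPf lj); ring.
rewrite mulrDr [RHS]addrAC; congr (_ + _).
rewrite (cintegral_edge_split x0 (kern_int j j gab sf x0)); congr (_ + _).
  rewrite -cintegralZ; [|exact: measurable_itv|exact: ch_int].
  apply: eq_cintegral => y; rewrite /= in_itv /= => /andP[y0 yx].
  by rewrite /kern eqxx yx mulrA.
rewrite /thint (cintegral_edge_split x0 (th_int j sf)) addrAC subrr add0r.
rewrite -cintegralZ; [|exact: measurable_itv|exact: cint_edgey x0 (th_int j sf)].
apply: eq_cintegral => y; rewrite /= in_itv /= andbT => xy.
by rewrite /kern eqxx leNgt xy /= mulrA.
Qed.

Lemma ac_green f j : src f -> ac (green f j) (dgreen f j) /\
  ac (dgreen f j) (fun x => ((V j x)%:C%C - zeta ^+ 2) * green f j x - f j x).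
Proof.
move=> sf.
have h1 := ac_prim (fun x _ => ch_int j x sf).
have h2 := ac_prim (fun x _ => cint_edge0 x (th_int j sf)).
have [ht hdt] := gd_th gd j; have [hc hdc] := gd_ch gd j.
have g1 := acD h1 (ac_cst (kapc f j)).
have g2 := acB (ac_cst (thint f j)) h2.
split.
  apply: ac_ext (acD (acM ht g1) (acM hc g2)) => x /edgeP x0.
    by rewrite /green gopE//; exact: growth0.
  by rewrite /dgreen gopE//; [ring|exact: growth1].
apply: ac_ext (acD (acM hdt g1) (acM hdc g2)) => x /edgeP x0.
  by rewrite /dgreen gopE//; exact: growth1.
rewrite /green gopE//; last exact: growth0.
rewrite -[X in _ = _ - X]mul1r -[X in _ = _ - X * _]opprK -(gd_wr gd j x0).
ring.
Qed.

Lemma green_at0 f j : src f -> green f j 0 = \sum_l ch l 0 * thint f l /\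
  dgreen f j 0 = dth j 0 * kapc f j + dch j 0 * thint f j.
Proof.
move=> sf.
have z g : cintegral (`[0, 0] : set R) g = 0 by rewrite /cintegral set_itv1 !Rintegral_set1.
rewrite /green /dgreen !gopE//; [|exact: growth1|exact: growth0].
rewrite !z !add0r !subr0; split => //.
rewrite [RHS](bigD1 j)//= addrC; congr (_ + _).
rewrite /kapc mulr_sumr; apply: eq_bigr => l lj.
by rewrite (@gd_ch0 _ _ _ _ _ _ _ _ gd l j) 1?eq_sym// (gd_ccC gd j l); ring.
Qed.

Lemma green_vertex f : src f -> (forall i j, green f i 0 = green f j 0) /\
  \sum_j dgreen f j 0 = 0.
Proof.
move=> sf; split.
  by move=> i j; rewrite (green_at0 i sf).1 (green_at0 j sf).1.
under eq_bigr do rewrite (green_at0 _ sf).2.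
rewrite big_split /=.
transitivity (\sum_(j < n) (- dch j 0 * thint f j) + \sum_(j < n) dch j 0 * thint f j).
  congr (_ + _); rewrite /kapc.
  under eq_bigr do rewrite mulr_sumr.
  rewrite (exchange_big_dep xpredT)//=; apply: eq_bigr => l _.
  rewrite (gd_dch0 gd) opprK mulr_suml; apply: eq_big => [j|j jl]; first by rewrite eq_sym.
  by rewrite (gd_ccC gd l j); ring.
by rewrite -big_split /= big1// => j _; ring.
Qed.

End Green.

Section Domain.
Context {R : realType} {n : nat}.
Local Notation edge := (edge R).
Local Notation ac := (@ac_derivative R).
Local Notation gfun := (gfun R n).
Implicit Types (V : 'I_n -> R -> R) (f g u du v dv : gfun) (z : R[i]).

(* [(H - z) u = f], for a right-hand side that need not be in [L2]. *)
Record dom V z f u du : Prop := Dom {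
  dom_ac : forall j, ac (u j) (du j) ;
  dom_dac : forall j, ac (du j) (fun x => ((V j x)%:C%C - z) * u j x - f j x) ;
  dom_cont : forall i j, u i 0 = u j 0 ;
  dom_kirch : \sum_j du j 0 = 0 ;
  dom_L2 : forall j, L2e (u j) /\ L2e (du j) }.

Lemma vertex_sum (u dv : gfun) (c : R[i]) : (forall j, u j 0 = c) -> \sum_j dv j 0 = 0 ->
  \sum_j u j 0 * dv j 0 = 0.
Proof. by move=> uc dv0; under eq_bigr do rewrite uc; rewrite -mulr_sumr dv0 mulr0. Qed.

Lemma cont_value u : (forall i j, u i 0 = u j 0) -> exists c, forall j, u j 0 = c.
Proof.
move=> h; case: (pickP (fun _ : 'I_n => true)) => [j0 _|n0].
  by exists (u j0 0).
by exists 0 => j; have := n0 j.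
Qed.

Lemma dom_wronskian V z f g u du v dv j : dom V z f u du -> dom V z g v dv ->
  cintegrable edge (fun x => u j x * g j x) -> cintegrable edge (fun x => f j x * v j x) ->
  cintegral edge (fun x => f j x * v j x) - cintegral edge (fun x => u j x * g j x) =
  - (u j 0 * dv j 0 - du j 0 * v j 0).
Proof.
move=> hu hv iug ifv.
have [u2 du2] := dom_L2 hu j; have [v2 dv2] := dom_L2 hv j.
have h : ac (fun x => u j x * dv j x - du j x * v j x) (fun x => f j x * v j x - u j x * g j x).
  by apply: ac_eq (acB (acM (dom_ac hu j) (dom_dac hv j)) (acM (dom_dac hu j) (dom_ac hv j))) => x _; ring.
rewrite -cintegralB; [|exact: edge_meas|exact: ifv|exact: iug].
apply: (ac_total0 h); first exact: cintB edge_meas ifv iug.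
by apply: cintB; [exact: edge_meas|exact: L2eM|exact: L2eM].
Qed.

Lemma dom_sym V z f g u du v dv : dom V z f u du -> dom V z g v dv ->
  (forall j, cintegrable edge (fun x => u j x * g j x)) ->
  (forall j, cintegrable edge (fun x => f j x * v j x)) ->
  \sum_j cintegral edge (fun x => f j x * v j x) = \sum_j cintegral edge (fun x => u j x * g j x).
Proof.
move=> hu hv iug ifv; apply/eqP; rewrite -subr_eq0 -sumrB.
under eq_bigr => j _ do rewrite (dom_wronskian hu hv (iug j) (ifv j)).
rewrite sumrN sumrB oppr_eq0.
have [cu hcu] := cont_value (dom_cont hu); have [cv hcv] := cont_value (dom_cont hv).
rewrite (vertex_sum hcu (dom_kirch hv)).
under eq_bigr do rewrite mulrC.
by rewrite (vertex_sum hcv (dom_kirch hu)) subrr.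
Qed.

End Domain.

Section GreenResolvent.
Context {R : realType} {n : nat}.
Local Notation mu := (@lebesgue_measure R).
Local Notation edge := (edge R).
Local Notation nc := (@Normc.normc R).
Local Notation Im := complex.Im.
Local Notation ac := (@ac_derivative R).
Local Notation gfun := (gfun R n).
Variables (V : 'I_n -> R -> R) (zeta : R[i]) (th dth ch dch : gfun)
  (cc : 'I_n -> 'I_n -> R[i]) (A : R).
Hypothesis gd : green_data V zeta th dth ch dch cc A.
Local Notation kap := (Im zeta).
Let kap0 : 0 < kap := gd_im gd.
Let A0 : 0 <= A := gd_A gd.
Local Notation green := (green th ch cc).
Local Notation dgreen := (dgreen th dth ch dch cc).
Local Notation src := (@src R n zeta).
Local Notation gcst := (gcst A).

Definition good (f : gfun) := src f /\ forall l, exists2 h, rint edge h &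
  forall x, 0 <= x -> cvl kap (fun y => nc (f l y)) x ^+ 2 <= h x.

Lemma L2_cvl (u : R -> R[i]) : L2e u -> [/\ rint edge (cvl kap (fun y => nc (u y) ^+ 2)),
  \int[mu]_(x in edge) cvl kap (fun y => nc (u y) ^+ 2) x <= 2 / kap * \int[mu]_(x in edge) nc (u x) ^+ 2 &
  forall x, 0 <= x -> cvl kap (fun y => nc (u y)) x ^+ 2 <= 2 / kap * cvl kap (fun y => nc (u y) ^+ 2) x].
Proof.
move=> [mu_ iu]; have [i1 i2] := cvl_rint kap0 iu (fun y _ => sqr_ge0 (nc (u y))).
by split => // x x0; apply: cvl_cauchy_schwarz => //; exact: cmeas_nc.
Qed.

Lemma L2_good f : L2 f -> good f.
Proof.
move=> /L2P hf; split=> l; first by split; [exact: (hf l).1|exact: L2e_expmul].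
have [i1 _ i3] := L2_cvl (hf l).
by exists (fun x => 2 / kap * cvl kap (fun y => nc (f l y) ^+ 2) x); [exact: rintZ edge_meas i1|].
Qed.

Lemma L1_good f : (forall j, cintegrable edge (f j)) -> good f.
Proof.
move=> hf; split=> l.
  split; first exact: cint_meas.
  by apply: exp_rint; [exact: ltW|exact: cint_nc edge_meas (hf l)].
have ip := cint_nc edge_meas (hf l).
have [i1 _] := cvl_rint kap0 ip (fun y _ => nc_ge0 (f l y)).
pose N := \int[mu]_(t in edge) nc (f l t).
exists (fun x => N * cvl kap (fun y => nc (f l y)) x); first exact: rintZ edge_meas i1.
move=> x x0; rewrite expr2; apply: ler_wpM2r; first by apply: cvl_ge0 => y _; exact: nc_ge0.
apply: le_Rintegral; [exact: edge_meas|exact: cvl_int|exact: ip|].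
move=> y _; rewrite ler_piMl ?nc_ge0//.
by rewrite (le_trans (ler_norm _))// expR_abs_le1.
Qed.

Lemma gop_sqr_le (a b f : gfun) j x : growth zeta A a b -> src f -> 0 <= x ->
  nc (gop (kern th ch cc a b) f j x) ^+ 2 <=
  gcst ^+ 2 * (n%:R * \sum_l cvl kap (fun y => nc (f l y)) x ^+ 2).
Proof.
move=> gab sf x0; have h := gop_le gd j gab sf x0.
have s0 : 0 <= \sum_l cvl kap (fun y => nc (f l y)) x.
  by apply: sumr_ge0 => l _; apply: cvl_ge0 => y _; exact: nc_ge0.
have g0 := gcst_ge0 gd.
apply: (@le_trans _ _ ((gcst * \sum_l cvl kap (fun y => nc (f l y)) x) ^+ 2)).
  by apply: lerXn2r; rewrite ?nnegrE ?nc_ge0 ?mulr_ge0.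
by rewrite exprMn; apply: ler_wpM2l; [exact: sqr_ge0|exact: sqr_sum_le].
Qed.

Lemma gop_L2 (a b f : gfun) j : growth zeta A a b -> good f ->
  cmeas edge (gop (kern th ch cc a b) f j) -> L2e (gop (kern th ch cc a b) f j).
Proof.
move=> gab [sf hf] mg; split => //.
have /choice[h hh] : forall l, exists h, rint edge h /\
    forall x, 0 <= x -> cvl kap (fun y => nc (f l y)) x ^+ 2 <= h x.
  by move=> l; have [h i1 i2] := hf l; exists h.
have ih : rint edge (fun x => gcst ^+ 2 * (n%:R * \sum_l h l x)).
  apply: rintZ; first exact: edge_meas.
  apply: rintZ; first exact: edge_meas.
  by apply: rint_sum; [exact: edge_meas|move=> l _; exact: (hh l).1].
apply: (rint_le _ _ ih); first exact: edge_meas.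
  by apply: measurable_funX; exact: cmeas_nc.
move=> x /edgeP x0; rewrite ger0_norm ?sqr_ge0//.
apply: (le_trans (gop_sqr_le j gab sf x0)); apply: ler_wpM2l; first exact: sqr_ge0.
by apply: ler_wpM2l => //; apply: ler_sum => l _; exact: (hh l).2.
Qed.

Lemma green_dom f : good f -> dom V (zeta ^+ 2) f (green f) (dgreen f).
Proof.
move=> gf; have [sf _] := gf; have [v1 v2] := green_vertex gd sf.
split; last 1 first.
- move=> j; have [h1 h2] := ac_green gd j sf; split.
    by apply: gop_L2 gf _; [exact: (growth0 gd)|exact: ac_meas h1].
  by apply: gop_L2 gf _; [exact: (growth1 gd)|exact: ac_meas h2].
- by move=> j; exact: (ac_green gd j sf).1.
- by move=> j; exact: (ac_green gd j sf).2.
- exact: v1.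
- exact: v2.
Qed.

Lemma th_L2 j : L2e (th j) /\ L2e (dth j).
Proof.
have h : rint edge (fun x => (A * expR (- kap * x)) ^+ 2).
  by apply: rint_ext (rintZ (A ^+ 2) edge_meas (L2e_exp kap0)) => x _; rewrite exprMn.
split.
  by apply: L2e_le h _; [exact: (th_meas gd)|move=> x x0; have [] := gd_le gd j x0].
by apply: L2e_le h _; [exact: (dth_meas gd)|move=> x x0; have [] := gd_le gd j x0].
Qed.

Lemma th_tail f u du l x : dom V (zeta ^+ 2) f u du -> src f -> 0 <= x ->
  th l x * du l x - dth l x * u l x =
  thint th f l - cintegral `[0, x] (fun y => th l y * f l y).
Proof.
move=> hu sf x0; have [ht hdt] := gd_th gd l.
have [t2 dt2] := th_L2 l; have [u2 du2] := dom_L2 hu l.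
have it := th_int gd l sf.
have h : ac (fun y => th l y * du l y - dth l y * u l y) (fun y => - (th l y * f l y)).
  by apply: ac_eq (acB (acM ht (dom_dac hu l)) (acM hdt (dom_ac hu l))) => y _; ring.
have iw : cintegrable edge (fun y => th l y * du l y - dth l y * u l y).
  by apply: cintB; [exact: edge_meas|exact: L2eM|exact: L2eM].
rewrite (ac_tail0 h (cintN edge_meas it) iw x0).
rewrite cintegralN; [|exact: measurable_itv|exact: cint_edgey].
by rewrite opprK /thint (cintegral_edge_split x0 it) addrAC subrr add0r.
Qed.

Lemma dom_repr f u du j x : dom V (zeta ^+ 2) f u du -> src f -> 0 <= x -> u j x = green f j x.
Proof.
move=> hu sf x0.
have z g : cintegral (`[0, 0] : set R) g = 0 by rewrite /cintegral set_itv1 !Rintegral_set1.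
have t0 l : thint th f l = th l 0 * du l 0 - dth l 0 * u j 0.
  by rewrite (dom_cont hu j l) (th_tail l hu sf (lexx 0)) z subr0.
have kE : kapc th cc f j = - ch j 0 * du j 0 + dch j 0 * u j 0.
  rewrite /kapc; under eq_bigr => l lj do rewrite t0 mulrBr mulrA -(gd_ch0 gd lj) mulrA.
  rewrite sumrB -mulr_suml -mulr_sumr (gd_dch0 gd).
  have := dom_kirch hu; rewrite (bigD1 j)//= => /eqP; rewrite addrC addr_eq0 => /eqP ->.
  by ring.
have [hc hdc] := gd_ch gd j.
have h : ac (fun y => ch j y * du j y - dch j y * u j y) (fun y => - (ch j y * f j y)).
  by apply: ac_eq (acB (acM hc (dom_dac hu j)) (acM hdc (dom_ac hu j))) => y _; ring.
have [_ e] := h x x0.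
have eN : cintegral `[0, x] (fun y => - (ch j y * f j y)) = - cintegral `[0, x] (fun y => ch j y * f j y).
  by apply: cintegralN; [exact: measurable_itv|exact: (ch_int gd j x sf)].
rewrite eN in e.
have e1 : cintegral `[0, x] (fun y => ch j y * f j y) =
   ch j 0 * du j 0 - dch j 0 * u j 0 - (ch j x * du j x - dch j x * u j x).
  by rewrite e opprD opprK addrA subrr add0r.
rewrite /green (gopE gd j (growth0 gd) sf x0) -(th_tail j hu sf x0) e1 kE.
transitivity (- (ch j x * dth j x - dch j x * th j x) * u j x); last by ring.
by rewrite (gd_wr gd j x0) opprK mul1r.
Qed.

Lemma green_lin (a : R[i]) f g j x : src f -> src g -> 0 <= x ->
  green (fun j x => a * f j x + g j x) j x = a * green f j x + green g j x.
Proof.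
move=> sf sg x0; rewrite /green /gop mulr_sumr -big_split /=; apply: eq_bigr => l _.
have i1 := kern_int gd j l (growth0 gd) sf x0; have i2 := kern_int gd j l (growth0 gd) sg x0.
rewrite -cintegralZ; [|exact: edge_meas|exact: i1].
rewrite -cintegralD; [|exact: edge_meas|exact: cintZ edge_meas i1|exact: i2].
by apply: eq_cintegral => y _; ring.
Qed.

Lemma green_L2 f : L2 f -> L2 (green f).
Proof. by move=> hf; apply/L2P => j; have [] := dom_L2 (green_dom (L2_good hf)) j. Qed.

Definition green_cst := n%:R * (gcst ^+ 2 * (n%:R * (2 / kap * (2 / kap)))).

Lemma green_bound f : L2 f -> normsq (green f) <= green_cst * normsq f.
Proof.
move=> hf; have [sf _] := L2_good hf; have hf' : forall j, L2e (f j) by apply/L2P.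
have hg : forall j, L2e (green f j) by apply/L2P; exact: green_L2.
pose S := \sum_l \int[mu]_(x in edge) nc (f l x) ^+ 2.
have le j : \int[mu]_(x in edge) nc (green f j x) ^+ 2 <= gcst ^+ 2 * (n%:R * (2 / kap * (2 / kap))) * S.
  pose h x := gcst ^+ 2 * (n%:R * \sum_l (2 / kap * cvl kap (fun y => nc (f l y) ^+ 2) x)).
  have ic l : rint edge (fun x => 2 / kap * cvl kap (fun y => nc (f l y) ^+ 2) x).
    by have [i1 _ _] := L2_cvl (hf' l); exact: rintZ edge_meas i1.
  have is_ : rint edge (fun x => \sum_l (2 / kap * cvl kap (fun y => nc (f l y) ^+ 2) x)).
    by apply: rint_sum; [exact: edge_meas|move=> l _; exact: ic].
  have ih : rint edge h by apply: rintZ; [exact: edge_meas|exact: rintZ edge_meas is_].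
  apply: (@le_trans _ _ (\int[mu]_(x in edge) h x)).
    apply: le_Rintegral; [exact: edge_meas|exact: (hg j).2|exact: ih|].
    move=> x /edgeP x0; apply: (le_trans (gop_sqr_le j (growth0 gd) sf x0)).
    apply: ler_wpM2l; first exact: sqr_ge0.
    apply: ler_wpM2l => //; apply: ler_sum => l _.
    by have [_ _ i3] := L2_cvl (hf' l); exact: i3.
  rewrite /h RintegralZl; [|exact: edge_meas|exact: rintZ edge_meas is_].
  rewrite RintegralZl; [|exact: edge_meas|exact: is_].
  rewrite -[leRHS]mulrA; apply: ler_wpM2l; first exact: sqr_ge0.
  rewrite -[leRHS]mulrA; apply: ler_wpM2l; first exact: ler0n.
  rewrite Rintegral_bigsum; [|exact: edge_meas|by move=> l _; exact: ic].
  rewrite /S mulr_sumr; apply: ler_sum => l _.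
  have [i1 i2 _] := L2_cvl (hf' l).
  rewrite RintegralZl; [|exact: edge_meas|exact: i1].
  rewrite -[leRHS]mulrA; apply: ler_wpM2l; last exact: i2.
  by rewrite divr_ge0// ltW.
rewrite /normsq -/S; apply: (le_trans (ler_sum _ (fun j _ => le j))).
rewrite sumr_const card_ord /green_cst -/S.
by apply: le_of_eq; rewrite -[LHS]mulr_natl; exact: mulrA.
Qed.

Lemma green_bounded : bounded_operator green.
Proof.
split; first exact: green_L2.
  move=> a f g hf hg j.
  apply: aeW => x /edgeP x0; rewrite green_lin//.
    by have [] := L2_good hf.
  by have [] := L2_good hg.
by exists green_cst; exact: green_bound.
Qed.

End GreenResolvent.

(** * The resolvent *)

Section Hamiltonian.
Context {R : realType} {n : nat}.
Local Notation mu := (@lebesgue_measure R).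
Local Notation edge := (edge R).
Local Notation nc := (@Normc.normc R).
Local Notation ac := (@ac_derivative R).
Local Notation gfun := (gfun R n).
Implicit Types (V : 'I_n -> R -> R) (f g u du v dv phi dphi : gfun) (z : R[i]).

Lemma H1e_bounded (p dp : R -> R[i]) : ac p dp -> L2e p -> L2e dp ->
  exists B, forall x, 0 <= x -> nc (p x) <= B.
Proof.
move=> hp p2 dp2.
have h := acM hp (ac_conj hp).
have i : cintegrable edge (fun x => dp x * conjc (p x) + p x * conjc (dp x)).
  by apply: cintD; [exact: edge_meas|apply: L2eM => //; exact: L2e_conj|apply: L2eM => //; exact: L2e_conj].
set B := nc (p 0 * conjc (p 0)) + \int[mu]_(t in edge) nc (dp t * conjc (p t) + p t * conjc (dp t)).
exists (1 + B) => x x0; have := ac_bounded h i x0; rewrite -/B ncM nc_conjc.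
move: (nc (p x)) (nc_ge0 (p x)) (B) => a a0 b h2.
by have := sqr_ge0 (a - 2^-1); nra.
Qed.

Lemma potential_int V (u v : R -> R[i]) j B C : rint edge (V j) -> cmeas edge u -> cmeas edge v ->
  (forall x, 0 <= x -> nc (u x) <= B) -> (forall x, 0 <= x -> nc (v x) <= C) ->
  cintegrable edge (fun x => (V j x)%:C%C * (u x * v x)).
Proof.
move=> iV mu_ mv uB vC.
apply: (cint_le _ _ (rintZ (B * C) edge_meas (rint_norm iV))); first exact: edge_meas.
  by apply: cmeasM; [apply: cmeas_real; exact: rint_meas|exact: cmeasM].
move=> x /edgeP x0; rewrite ncM nc_real mulrC; apply: ler_wpM2r; first exact: normr_ge0.
by apply: ncM_le; [exact: uB|exact: vC].
Qed.

Lemma dom_hamiltonian V z f u du : (forall j, rint edge (V j)) -> dom V z f u du -> L2 f ->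
  hamiltonian V u (fun j x => f j x + z * u j x).
Proof.
move=> iV hu /L2P hf; have u2 j := (dom_L2 hu j).1; have du2 j := (dom_L2 hu j).2.
have fzu j : L2e (fun x => f j x + z * u j x) by apply: L2eD => //; exact: L2eZ.
split; first by apply/L2P.
exists du; split.
  split; [exact/L2P|exact/L2P|exact: (dom_ac hu)|exact: (dom_cont hu)].
move=> phi dphi [/L2P p2 /L2P dp2 hp pc].
have [c hc] : exists c, forall j, phi j 0 = c by exact: cont_value pc.
rewrite /Defs.form /inner; apply/eqP; rewrite -subr_eq0 -sumrB.
have e j : cintegral edge (fun x => du j x * conjc (dphi j x)) +
    cintegral edge (fun x => (V j x)%:C%C * (u j x * conjc (phi j x))) -
    cintegral edge (fun x => (f j x + z * u j x) * conjc (phi j x)) = - (conjc (phi j 0) * du j 0).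
  have cp2 := L2e_conj (p2 j); have cdp2 := L2e_conj (dp2 j).
  have [B hB] := H1e_bounded (dom_ac hu j) (u2 j) (du2 j).
  have [C hC] := H1e_bounded (ac_conj (hp j)) cp2 cdp2.
  have i1 := L2eM (du2 j) cdp2; have i3 := L2eM (fzu j) cp2.
  have i2 := potential_int (iV j) (u2 j).1 cp2.1 hB hC.
  rewrite -cintegralD; [|exact: edge_meas|exact: i1|exact: i2].
  rewrite -cintegralB; [|exact: edge_meas|exact: cintD edge_meas i1 i2|exact: i3].
  have h : ac (fun x => du j x * conjc (phi j x)) (fun x =>
     du j x * conjc (dphi j x) + (V j x)%:C%C * (u j x * conjc (phi j x))
     - (f j x + z * u j x) * conjc (phi j x)).
    by apply: ac_eq (acM (dom_dac hu j) (ac_conj (hp j))) => x _; ring.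
  rewrite [in RHS]mulrC; apply: (ac_total0 h); last exact: L2eM.
  exact: cintB edge_meas (cintD edge_meas i1 i2) i3.
under eq_bigr do rewrite e.
by rewrite sumrN (vertex_sum (u := fun j x => conjc (phi j x)) (c := conjc c)) ?oppr0// => [j|]; [rewrite hc|exact: (dom_kirch hu)].
Qed.

Lemma gae_eq0 u : L2 u -> inner u u = 0 -> gae_eq u (fun=> fun=> 0).
Proof.
move=> /L2P u2; rewrite /inner.
have e j : cintegral edge (fun x => u j x * conjc (u j x)) = (\int[mu]_(x in edge) nc (u j x) ^+ 2)%:C%C.
  by rewrite -cintegral_real; apply: eq_cintegral => x _; rewrite mulcJ.
under eq_bigr do rewrite e.
rewrite -rmorph_sum /= => /complexI/eqP.
rewrite psumr_eq0; last by move=> j _; apply: Rintegral_ge0 => x _; exact: sqr_ge0.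
move=> /allP h j; have /eqP {}h := h j (mem_index_enum j).
have i := (u2 j).2.
have z : (\int[mu]_(x in edge) `|(nc (u j x) ^+ 2)%:E| = 0)%E.
  transitivity (\int[mu]_(x in edge) (nc (u j x) ^+ 2)%:E)%E.
    by apply: eq_integral => x _; rewrite /= ger0_norm// sqr_ge0.
  have f : (\int[mu]_(x in edge) (nc (u j x) ^+ 2)%:E)%E \is a fin_num.
    by apply: (integrable_fin_num (mu := mu)); [exact: edge_meas|exact: i].
  rewrite -[LHS](fineK f).
  by congr (_%:E); exact: h.
have m : measurable_fun edge (fun x => (nc (u j x) ^+ 2)%:E) by apply/measurable_EFinP; exact: rint_meas i.
have := (ae_eq_integral_abs mu edge_meas m).1 z.
apply: filterS => x hx xe; have := hx xe => /= -[] /eqP.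
by rewrite sqrf_eq0 nc_eq0 => /eqP.
Qed.

Lemma gae_sub0 f g : gae_eq (fun j x => f j x - g j x) (fun=> fun=> 0) -> gae_eq g f.
Proof.
move=> h j; apply: (@filterS _ _ (ae_filter_ringOfSetsType mu) _ _ _ (h j)) => x hx xe.
by have /eqP := hx xe; rewrite subr_eq0 => /eqP ->.
Qed.

Lemma gae_sym f g : gae_eq f g -> gae_eq g f.
Proof.
move=> h j; apply: (@filterS _ _ (ae_filter_ringOfSetsType mu) _ _ _ (h j)) => x hx xe.
by rewrite hx.
Qed.

Lemma gae_trans f g u : gae_eq f g -> gae_eq g u -> gae_eq f u.
Proof.
move=> h1 h2 j.
apply: (@filterS2 _ _ (ae_filter_ringOfSetsType mu) _ _ _ _ (h1 j) (h2 j)) => x e1 e2 xe.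
by rewrite e1// e2.
Qed.

Lemma gae_refl f g : (forall j x, 0 <= x -> f j x = g j x) -> gae_eq f g.
Proof. by move=> h j; apply: aeW => x /edgeP x0; exact: h. Qed.

End Hamiltonian.

Section IsResolvent.
Context {R : realType} {n : nat}.
Local Notation edge := (edge R).
Local Notation ac := (@ac_derivative R).
Local Notation gfun := (gfun R n).
Variables (V : 'I_n -> R -> R) (zeta : R[i]) (th dth ch dch : gfun)
  (cc : 'I_n -> 'I_n -> R[i]) (A : R).
Hypothesis gd : green_data V zeta th dth ch dch cc A.
Local Notation green := (green th ch cc).
Local Notation dgreen := (dgreen th dth ch dch cc).
Let iV := gd_V gd.

Lemma green_hamiltonian f : L2 f -> hamiltonian V (green f) (fun j x => f j x + zeta ^+ 2 * green f j x).
Proof. by move=> hf; apply: dom_hamiltonian iV (green_dom gd (L2_good gd hf)) hf. Qed.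

(* Weak solutions are represented by the kernel: test the weak equation with
   the conjugate of a strong solution. *)
Lemma green_weak psi f : hamiltonian V psi f -> gae_eq (green (fun j x => f j x - zeta ^+ 2 * psi j x)) psi.
Proof.
move=> [/L2P f2 [dpsi [hpsi wpsi]]]; have [/L2P p2 /L2P dp2 hp pc] := hpsi.
set z := zeta ^+ 2; pose F : gfun := fun j x => f j x - z * psi j x.
have F2 : L2 F by apply/L2P => j; apply: L2eB => //; exact: L2eZ.
have hu := green_dom gd (L2_good gd F2).
have u2 j := (dom_L2 hu j).1.
pose g : gfun := fun j x => psi j x - green F j x.
have g2 j : L2e (g j) by apply: L2eB.
have cg2 : L2 (fun j x => conjc (g j x)) by apply/L2P => j; exact: L2e_conj.
have cg2' : forall j, L2e (fun x => conjc (g j x)) by apply/L2P.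
pose v := green (fun j x => conjc (g j x)); pose dv := dgreen (fun j x => conjc (g j x)).
have hv : dom V z (fun j x => conjc (g j x)) v dv := green_dom gd (L2_good gd cg2).
have v2 j := (dom_L2 hv j).1; have dv2 j := (dom_L2 hv j).2.
have H1cv : H1 (fun j x => conjc (v j x)) (fun j x => conjc (dv j x)).
  split; [apply/L2P => j; exact: L2e_conj|apply/L2P => j; exact: L2e_conj| |].
    by move=> j; exact: ac_conj (dom_ac hv j).
  by move=> i j /=; rewrite (dom_cont hv i j).
have e1 := wpsi _ _ H1cv.
have e2 : Defs.form V psi dpsi (fun j x => conjc (v j x)) (fun j x => conjc (dv j x)) =
    \sum_j cintegral edge (fun x => (conjc (g j x) + z * v j x) * psi j x).
  rewrite /Defs.form; apply/eqP; rewrite -subr_eq0 -sumrB.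
  have e j : cintegral edge (fun x => dpsi j x * conjc (conjc (dv j x))) +
      cintegral edge (fun x => (V j x)%:C%C * (psi j x * conjc (conjc (v j x)))) -
      cintegral edge (fun x => (conjc (g j x) + z * v j x) * psi j x) = - (psi j 0 * dv j 0).
    have [B hB] := H1e_bounded (dom_ac hv j) (v2 j) (dv2 j).
    have [C hC] := H1e_bounded (hp j) (p2 j) (dp2 j).
    have i1 := L2eM (dp2 j) (dv2 j).
    have i2 := potential_int (iV j) (p2 j).1 (v2 j).1 hC hB.
    have i3 := L2eM (L2eD (cg2' j) (L2eZ z (v2 j))) (p2 j).
    have -> : cintegral edge (fun x => dpsi j x * conjc (conjc (dv j x))) =
      cintegral edge (fun x => dpsi j x * dv j x) by apply: eq_cintegral => x _; rewrite conjcK.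
    have -> : cintegral edge (fun x => (V j x)%:C%C * (psi j x * conjc (conjc (v j x)))) =
      cintegral edge (fun x => (V j x)%:C%C * (psi j x * v j x)) by apply: eq_cintegral => x _; rewrite conjcK.
    rewrite -cintegralD; [|exact: edge_meas|exact: i1|exact: i2].
    rewrite -cintegralB; [|exact: edge_meas|exact: cintD edge_meas i1 i2|exact: i3].
    have h : ac (fun x => psi j x * dv j x) (fun x =>
       dpsi j x * dv j x + (V j x)%:C%C * (psi j x * v j x) - (conjc (g j x) + z * v j x) * psi j x).
      by apply: ac_eq (acM (hp j) (dom_dac hv j)) => x _; ring.
    apply: (ac_total0 h); last exact: L2eM.
    exact: cintB edge_meas (cintD edge_meas i1 i2) i3.
  under eq_bigr do rewrite e.
  have [c hc] : exists c, forall j, psi j 0 = c by exact: cont_value pc.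
  by rewrite sumrN (vertex_sum hc (dom_kirch hv)) oppr0.
have e3 : \sum_j cintegral edge (fun x => F j x * v j x) =
    \sum_j cintegral edge (fun x => conjc (g j x) * psi j x).
  apply/eqP; rewrite -subr_eq0 -sumrB.
  move: e1; rewrite e2 /inner => /eqP; rewrite -subr_eq0 -sumrB => /eqP e1.
  rewrite -oppr_eq0 -sumrN -[X in _ == X]e1; apply/eqP; apply: eq_bigr => j _.
  have F2' : L2e (F j) by move/L2P: F2.
  have i1 := L2eM F2' (v2 j); have i2 := L2eM (cg2' j) (p2 j).
  have i3 := L2eM (L2eD (cg2' j) (L2eZ z (v2 j))) (p2 j); have i4 := L2eM (f2 j) (v2 j).
  rewrite opprB -cintegralB; [|exact: edge_meas|exact: i2|exact: i1].
  have -> : cintegral edge (fun x => f j x * conjc (conjc (v j x))) =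
    cintegral edge (fun x => f j x * v j x) by apply: eq_cintegral => x _; rewrite conjcK.
  rewrite -cintegralB; [|exact: edge_meas|exact: i3|exact: i4].
  by apply: eq_cintegral => x _; rewrite /F; ring.
have e4 : \sum_j cintegral edge (fun x => F j x * v j x) =
    \sum_j cintegral edge (fun x => green F j x * conjc (g j x)).
  apply: (dom_sym hu hv); first by move=> j; exact: L2eM.
  by move=> j; apply: L2eM => //; move/L2P: F2.
have e5 : inner g g = 0.
  rewrite /inner; transitivity (\sum_j cintegral edge (fun x => conjc (g j x) * psi j x) -
      \sum_j cintegral edge (fun x => green F j x * conjc (g j x))).
    rewrite -sumrB; apply: eq_bigr => j _.
    rewrite -cintegralB; [|exact: edge_meas|exact: L2eM|exact: L2eM].
    by apply: eq_cintegral => x _; rewrite {1}/g; ring.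
  by rewrite -e3 e4 subrr.
have gL2 : L2 g by apply/L2P.
exact: gae_sub0 (gae_eq0 gL2 e5).
Qed.

Lemma green_is_resolvent : is_resolvent V (zeta ^+ 2) green.
Proof.
split; [exact: green_bounded gd|exact: green_hamiltonian|exact: green_weak].
Qed.

Lemma resolventP : is_resolvent V (zeta ^+ 2) (resolvent V (zeta ^+ 2)).
Proof.
apply: (@xgetPex {classic (gfun -> gfun)} idfun [set T | is_resolvent V (zeta ^+ 2) T]).
by exists green; exact: green_is_resolvent.
Qed.

Lemma resolventE f : L2 f -> gae_eq (resolvent V (zeta ^+ 2) f) (green f).
Proof.
move=> hf; have [_ h2 _] := resolventP; have := green_weak (h2 f hf).
set g := (X in green X); have -> : g = f.
  by apply/funext => j; apply/funext => x; rewrite /g addrK.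
exact: gae_sym.
Qed.

End IsResolvent.

(** * The eigenvalue condition *)

Section JostNontrivial.
Context {R : realType}.
Local Notation mu := (@lebesgue_measure R).
Local Notation edge := (edge R).
Local Notation nc := (@Normc.normc R).
Local Notation Re := complex.Re.
Local Notation Im := complex.Im.
Local Notation I := ('i%C : R[i]).
Implicit Types (q : R -> R) (zeta : R[i]) (th dth : R -> R[i]).

Lemma solution_exists q zeta (a b : R[i]) : rint edge q -> 0 < Im zeta ->
  exists u du, [/\ schrodinger_solution q (zeta ^+ 2) u du, u 0 = a & du 0 = b].
Proof.
move=> iq z0; pose c := I * zeta.
have c0 : Re (2 * c) < 0 by rewrite Re2 Re_ci mulrN oppr_lt0 mulr_gt0.
have [m [mp [M [hm hmp m0 mp0 _]]]] := picard_exists iq c0 a (b + c * a).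
exists (fun x => ex (- c) x * m x), (fun x => ex (- c) x * (mp x + (- c) * m x)).
split; [|by rewrite ex0 mul1r m0|by rewrite ex0 mul1r m0 mp0; ring].
apply: ac_ungauge hm _; first by rewrite sqrrN ci_sqr.
by apply: ac_eq hmp => x _; ring.
Qed.

Lemma jost_neq0 q zeta th dth : jost_solution q zeta th dth ->
  exists2 X, 0 <= X & forall x, X <= x -> th x != 0.
Proof.
move=> hj; have [_ /tendsP/(_ 1 ltr01)[X X0 hX] _] := jost_gsol hj.
exists X => // x /hX; apply: contraTneq => ->.
by rewrite mulr0 sub0r ncN nc1 ltxx.
Qed.

Lemma jost_nontrivial q zeta th dth : rint edge q -> 0 < Im zeta ->
  jost_solution q zeta th dth -> th 0 = 0 -> dth 0 != 0.
Proof.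
move=> iq z0 hj t0; apply/eqP => dt0; have [hs _] := hj.
have [u [du [hu u0 du0]]] := solution_exists 1 0 iq z0.
have [v [dv [hv v0 dv0]]] := solution_exists 0 1 iq z0.
have [X X0 /(_ X (lexx X))/eqP[]] := jost_neq0 hj.
have e1 := wronskian_cst hu hv X0; have e2 := wronskian_cst hu hs X0.
have e3 := wronskian_cst hv hs X0.
rewrite u0 du0 v0 dv0 mul1r mul0r subr0 in e1.
rewrite t0 dt0 !mulr0 subr0 in e2; rewrite t0 dt0 !mulr0 subr0 in e3.
transitivity ((u X * dv X - du X * v X) * th X); first by rewrite e1 mul1r.
transitivity (v X * (u X * dth X - du X * th X) - u X * (v X * dth X - dv X * th X)); first by ring.
by rewrite e2 e3 !mulr0 subr0.
Qed.

Lemma jost_growth q zeta th dth : rint edge q -> 0 < Im zeta -> jost_solution q zeta th dth ->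
  exists2 A, 0 <= A & forall x, 0 <= x ->
    nc (th x) <= A * expR (- Im zeta * x) /\ nc (dth x) <= A * expR (- Im zeta * x).
Proof.
move=> iq z0 hj.
have [a [b ab]] : exists a b, a * dth 0 - b * th 0 = -1.
  have [t0|t0] := eqVneq (th 0) 0.
    exists (- (dth 0)^-1), 0; rewrite mul0r subr0 mulNr mulVf//; exact: jost_nontrivial hj t0.
  by exists 0, (th 0)^-1; rewrite mul0r sub0r mulVf.
have [ch [dch [M [hp _ _]]]] := edge_pair_exists iq z0 hj ab.
have [A A0 hA] := edge_pair_bounds iq z0 hp.
by exists A => // x x0; have [] := hA x x0.
Qed.

Lemma jost_L2 q zeta th dth : rint edge q -> 0 < Im zeta -> jost_solution q zeta th dth ->
  L2e th /\ L2e dth.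
Proof.
move=> iq z0 hj; have [A A0 hA] := jost_growth iq z0 hj; have [[h1 h2] _] := hj.
have h : rint edge (fun x => (A * expR (- Im zeta * x)) ^+ 2).
  by apply: rint_ext (rintZ (A ^+ 2) edge_meas (L2e_exp z0)) => x _; rewrite exprMn.
split.
  by apply: L2e_le h _; [exact: ac_meas h1|move=> x x0; have [] := hA x x0].
by apply: L2e_le h _; [exact: ac_meas h2|move=> x x0; have [] := hA x x0].
Qed.

Lemma not_ae_zero (u : R -> R[i]) (X : R) : 0 <= X -> (forall x, X <= x -> u x != 0) ->
  ~ {ae mu, forall x, edge x -> u x = 0}.
Proof.
move=> X0 hX [N [mN N0 hN]].
have : (mu (`[X, (X + 1)%R]%classic : set R) <= mu N)%E.
  apply: le_measure; [apply/mem_set; exact: measurable_itv|apply/mem_set; exact: mN|].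
  move=> x; rewrite /= in_itv /= => /andP[Xx _]; apply: hN => /= h.
  by have := hX x Xx; rewrite h ?eqxx//; apply/edgeP; exact: le_trans Xx.
rewrite N0 lebesgue_measure_itv /= lte_fin ltrDl ltr01 -EFinB addrAC subrr add0r.
by rewrite lee_fin ler10.
Qed.

End JostNontrivial.

Section KirchhoffNonzero.
Context {R : realType} {n : nat}.
Local Notation nc := (@Normc.normc R).
Local Notation edge := (edge R).
Local Notation Im := complex.Im.

Lemma kirchhoff_kernel (F : fieldType) (w dw : 'I_n -> F) : (2 <= n)%N -> kw w dw = 0 ->
  (forall j, w j = 0 -> dw j != 0) ->
  exists c : 'I_n -> F, [/\ forall i j, c i * w i = c j * w j, \sum_j c j * dw j = 0 &
    exists j, c j != 0].
Proof.
move=> n2 k0 hw; pose c j := \prod_(k < n | k != j) w k.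
have [j cj|c0] := pickP (fun j => c j != 0).
  exists c; split; [move=> i k| |by exists j].
    transitivity (\prod_l w l).
      by rewrite [RHS](bigD1 i)//= mulrC.
    by rewrite [LHS](bigD1 k)//= mulrC.
  by rewrite -[RHS]k0; apply: eq_bigr => i _; rewrite mulrC.
have z a : exists2 b, b != a & w b = 0.
  have /negbFE := c0 a; rewrite /c prodf_seq_eq0 => /hasP[b _ /andP[ba /eqP wb]].
  by exists b.
have [a _ wa] := z (Ordinal (leq_trans (isT : 0 < 2)%N n2)).
have [b ba wb] := z a.
exists (fun j => if j == a then dw b else if j == b then - dw a else 0); split.
- have h k : (if k == a then dw b else if k == b then - dw a else 0) * w k = 0.
    case: eqP => [->|_]; first by rewrite wa mulr0.
    by case: eqP => [->|_]; rewrite ?wb ?mulr0 ?mul0r.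
  by move=> i j; rewrite !h.
- rewrite (bigD1 a)//= eqxx (bigD1 b)//= (negPf ba) eqxx big1.
    by rewrite addr0 mulNr mulrC subrr.
  by move=> i /andP[/negPf -> /negPf ->]; rewrite mul0r.
- by exists a; rewrite eqxx; exact: hw.
Qed.

Variables (V : 'I_n -> R -> R) (th dth : gfun R n) (zeta : R[i]).
Hypothesis iV : forall j, rint edge (V j).
Hypothesis z0 : 0 < Im zeta.
Hypothesis hj : forall j, jost_solution (V j) zeta (th j) (dth j).

(* Otherwise a combination of the Jost solutions is an eigenfunction. *)
Lemma kw_neq0 : (2 <= n)%N -> resolvent_set V (zeta ^+ 2) ->
  kw (fun j => th j 0) (fun j => dth j 0) != 0.
Proof.
move=> n2 [T [[_ Tlin _] _ hT]]; apply/eqP => k0.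
have [c [c1 c2 [j cj]]] := kirchhoff_kernel n2 k0 (fun j => jost_nontrivial (iV j) z0 (hj j)).
pose u : gfun R n := fun j x => c j * th j x.
have hu : dom V (zeta ^+ 2) (fun=> fun=> 0) u (fun j x => c j * dth j x).
  split; [| |exact: c1|exact: c2|].
  - by move=> i; apply: acZ; have [[]] := hj i.
  - move=> i; have [[_ h] _] := hj i.
    by apply: ac_eq (acZ (c i) h) => x _; rewrite /u; ring.
  - by move=> i; have [t1 t2] := jost_L2 (iV i) z0 (hj i); split; exact: L2eZ.
have L0 : L2 (fun (_ : 'I_n) (_ : R) => 0 : R[i]).
  by apply/L2P => i; apply: L2e_ext (L2eZ 0 (dom_L2 hu i).1) => x _; rewrite mul0r.
have e1 := hT _ _ (dom_hamiltonian iV hu L0).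
have e2 := Tlin (-1) _ _ L0 L0.
have fE : (fun (j : 'I_n) (x : R) => 0 + zeta ^+ 2 * u j x - zeta ^+ 2 * u j x) = fun=> fun=> 0.
  by apply/funext => i; apply/funext => x; rewrite add0r subrr.
have gE : (fun (j : 'I_n) (x : R) => -1 * 0 + 0) = fun=> fun=> 0 :> R[i].
  by apply/funext => i; apply/funext => x; rewrite mulr0 addr0.
rewrite fE in e1; rewrite gE in e2.
have e3 : gae_eq (T (fun=> fun=> 0)) (fun=> fun=> 0).
  by apply: gae_trans e2 _; apply: gae_refl => i x _; rewrite mulN1r addNr.
have e4 := gae_trans (gae_sym e1) e3.
have [X X0 hX] := jost_neq0 (hj j).
apply: (@not_ae_zero _ (u j) X) (e4 j) => //.
by move=> x Xx; rewrite /u mulf_neq0//; exact: hX.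
Qed.

Lemma green_data_exists : kw (fun j => th j 0) (fun j => dth j 0) != 0 ->
  let w := fun j => th j 0 in let dw := fun j => dth j 0 in
  exists ch dch A, [/\ green_data V zeta th dth ch dch (kcc w dw) A,
    forall j, ch j 0 = kch w dw j, forall j, dch j 0 = kdch w dw j &
    forall j, exists M, edge_pair (V j) zeta (th j) (dth j) (ch j) (dch j) M].
Proof.
move=> k0 w dw.
have /choice[ch /choice[dch /choice[M hM]]] : forall j, exists ch dch M,
    [/\ edge_pair (V j) zeta (th j) (dth j) ch dch M, ch 0 = kch w dw j & dch 0 = kdch w dw j].
  by move=> j; apply: edge_pair_exists (iV j) z0 (hj j) _; exact: kwr k0 j.
have /choice[B hB] : forall j, exists B, 0 <= B /\ forall x, 0 <= x ->
    [/\ nc (th j x) <= B * expR (- Im zeta * x), nc (dth j x) <= B * expR (- Im zeta * x),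
        nc (ch j x) <= B * expR (Im zeta * x) & nc (dch j x) <= B * expR (Im zeta * x)].
  move=> j; have [hp _ _] := hM j; have [B B0 h] := edge_pair_bounds (iV j) z0 hp.
  by exists B.
pose cc := kcc w dw; pose A := \sum_j B j + \sum_j \sum_l nc (cc j l).
have s0 (J : finType) (g : J -> R) : (forall i, 0 <= g i) -> 0 <= \sum_i g i.
  by move=> h; apply: sumr_ge0.
have sle (J : finType) (g : J -> R) i : (forall i, 0 <= g i) -> g i <= \sum_i g i.
  by move=> h; rewrite (bigD1 i)//= lerDl; apply: sumr_ge0.
have B0 : 0 <= \sum_j B j by apply: s0 => j; exact: (hB j).1.
have C0 : 0 <= \sum_j \sum_l nc (cc j l).
  by apply: (s0) => j; apply: s0 => l; exact: nc_ge0.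
have BA j : B j <= A.
  by apply: ler_wpDr => //; apply: sle => i; exact: (hB i).1.
have ccA j l : nc (cc j l) <= A.
  apply: ler_wpDl => //; apply: (le_trans (sle _ (fun l => nc (cc j l)) l (fun=> nc_ge0 _))).
  by apply: (sle _ (fun j => \sum_l nc (cc j l)) j) => i; apply: s0 => l'; exact: nc_ge0.
have up (j : 'I_n) (x e : R) : x <= B j * expR e -> x <= A * expR e.
  by move=> h; apply: (le_trans h); apply: ler_wpM2r; [exact: expR_ge0|exact: BA].
exists ch, dch, A; split.
- split => //.
  + exact: addr_ge0.
  + by move=> j; have [[]] := hM j.
  + by move=> j; have [[]] := hM j.
  + by move=> j x x0; have [[_ _ h _ _] _ _] := hM j; exact: h.
  + by move=> j x x0; have [h1 h2 h3 h4] := (hB j).2 x x0; split; apply: (up j).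
  + by move=> j l; exact: kccC.
  + by move=> j l lj; have [_ -> _] := hM j; exact: kchE.
  + by move=> j; have [_ _ ->] := hM j.
- by move=> j; have [_ -> _] := hM j.
- by move=> j; have [_ _ ->] := hM j.
- by move=> j; exists (M j); have [] := hM j.
Qed.

End KirchhoffNonzero.

(** * Hilbert space tools *)

Section SequenceLimits.
Context {R : realType}.
Local Notation mu := (@lebesgue_measure R).
Local Notation nc := (@Normc.normc R).
Local Notation Re := complex.Re.
Local Notation Im := complex.Im.
Implicit Types (D : set R) (u v : nat -> R[i]).

Definition slim u (l : R[i]) := (u k : R[i]^o) @[k --> \oo] --> (l : R[i]^o).

Lemma slimP u l : slim u l <->
  forall e, 0 < e -> exists N, forall k, (N <= k)%N -> nc (u k - l) < e.
Proof.
split=> [/cvgcP h e e0|h].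
  by have [N _ hN] := h e e0; exists N => k; exact: hN.
by apply/cvgcP => e e0; have [N hN] := h e e0; exists N.
Qed.

Lemma slim_unique u l l' : slim u l -> slim u l' -> l = l'.
Proof. by move=> h h'; exact: (cvg_unique (@norm_hausdorff _ R[i]^o) h h'). Qed.

Lemma slim_ext u v l : u =1 v -> slim u l -> slim v l.
Proof. by move=> uv; rewrite /slim (eq_fun uv). Qed.

Lemma slimM u v l l' : slim u l -> slim v l' -> slim (fun k => u k * v k) (l * l').
Proof. by move=> h h'; exact: (@cvgM R[i] _ _ _ _ _ _ _ h h'). Qed.

Lemma slim_cst l : slim (fun=> l) l.
Proof. exact: cvg_cst. Qed.

Lemma slim_sum (J : Type) (r : seq J) (P : pred J) (F : J -> nat -> R[i]) (L : J -> R[i]) :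
  (forall j, P j -> slim (F j) (L j)) ->
  slim (fun k => \sum_(j <- r | P j) F j k) (\sum_(j <- r | P j) L j).
Proof.
move=> h; elim: r => [|j r ih].
  have -> : (fun k => \sum_(j <- [::] | P j) F j k) = fun=> 0.
    by apply/funext => k; rewrite big_nil.
  by rewrite big_nil; exact: slim_cst.
rewrite big_cons.
have -> : (fun k => \sum_(i <- j :: r | P i) F i k) =
    fun k => if P j then F j k + \sum_(i <- r | P i) F i k else \sum_(i <- r | P i) F i k.
  by apply/funext => k; rewrite big_cons.
by case: ifP => Pj; [exact: (cvgD (h j Pj) ih)|exact: ih].
Qed.

Lemma slim_ReIm u l : slim u l <->
  (Re (u k) @[k --> \oo] --> Re l) /\ (Im (u k) @[k --> \oo] --> Im l).
Proof.
split=> [/slimP h|[/cvgrPdist_lt h1 /cvgrPdist_lt h2]].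
  split; apply/cvgrPdist_lt => e e0; have [N hN] := h e e0; exists N => // k Nk /=.
    by apply: le_lt_trans (hN k Nk); rewrite distrC -cReN -cReD; exact: nc_Re.
  by apply: le_lt_trans (hN k Nk); rewrite distrC -cImN -cImD; exact: nc_Im.
apply/slimP => e e0; have e2 : 0 < e / 2 by exact: divr_gt0.
have [N1 _ H1] := h1 _ e2; have [N2 _ H2] := h2 _ e2.
exists (maxn N1 N2) => k; rewrite geq_max => /andP[k1 k2].
apply: (le_lt_trans (nc_ReIm _)); rewrite cReD cImD cReN cImN [e]splitr.
by apply: ltrD; rewrite distrC; [exact: H1|exact: H2].
Qed.

Lemma rdct D (f_ : nat -> R -> R) (f h : R -> R) : measurable D ->
  (forall k, measurable_fun D (f_ k)) -> rint D h ->
  (forall k x, D x -> `|f_ k x| <= h x) ->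
  (forall x, D x -> f_ k x @[k --> \oo] --> f x) ->
  rint D f /\ (\int[mu]_(x in D) f_ k x) @[k --> \oo] --> \int[mu]_(x in D) f x.
Proof.
move=> mD mf ih fh fl.
have mf' : measurable_fun D f by exact: measurable_fun_cvg fl.
have fl' : \forall x \ae mu, D x -> (f_ k x)%:E @[k --> \oo] --> (f x)%:E.
  by apply: aeW => x Dx; apply: cvg_EFin; [exact: nearW|exact: fl].
have fh' : \forall x \ae mu, forall k, D x -> (`|(f_ k x)%:E| <= (h x)%:E)%E.
  by apply: aeW => x k Dx; rewrite lee_fin; exact: fh.
have mf1 k : measurable_fun D (EFin \o f_ k) by apply/measurable_EFinP.
have mf2 : measurable_fun D (EFin \o f) by apply/measurable_EFinP.
have [i _ c] := @dominated_convergence _ _ _ mu D mD (fun k => EFin \o f_ k) (EFin \o f)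
  (EFin \o h) mf1 mf2 fl' ih fh'.
split; first exact: i.
apply: (@fine_cvg _ _ _ _ (fun k => \int[mu]_(x in D) (f_ k x)%:E)%E).
rewrite fineK; first exact: c.
by apply: (integrable_fin_num (mu := mu)).
Qed.

Lemma cdct D (f_ : nat -> R -> R[i]) (f : R -> R[i]) (h : R -> R) : measurable D ->
  (forall k, cmeas D (f_ k)) -> rint D h -> (forall k x, D x -> nc (f_ k x) <= h x) ->
  (forall x, D x -> slim (f_ ^~ x) (f x)) ->
  cintegrable D f /\ slim (fun k => cintegral D (f_ k)) (cintegral D f).
Proof.
move=> mD mf ih fh fl.
have [] := @rdct D (fun k x => Re (f_ k x)) (fun x => Re (f x)) h mD _ ih _ _.
- by move=> k; exact: (mf k).1.
- by move=> k x Dx; apply: (le_trans (nc_Re _)); exact: fh.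
- by move=> x Dx; have [] := (slim_ReIm _ _).1 (fl x Dx).
move=> i1 c1.
have [] := @rdct D (fun k x => Im (f_ k x)) (fun x => Im (f x)) h mD _ ih _ _.
- by move=> k; exact: (mf k).2.
- by move=> k x Dx; apply: (le_trans (nc_Im _)); exact: fh.
- by move=> x Dx; have [] := (slim_ReIm _ _).1 (fl x Dx).
move=> i2 c2; split; first by split.
by apply/slim_ReIm; split.
Qed.

Lemma ae_cintegral D (f g : R -> R[i]) : measurable D -> cmeas D f -> cmeas D g ->
  {ae mu, forall x, D x -> f x = g x} -> cintegral D f = cintegral D g.
Proof.
move=> mD [f1 f2] [g1 g2] h.
have hR : \forall x \ae mu, D x -> (Re (f x))%:E = (Re (g x))%:E.
  by apply: (@filterS _ _ (ae_filter_ringOfSetsType mu) _ _ _ h) => x hx Dx; rewrite hx.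
have hI : \forall x \ae mu, D x -> (Im (f x))%:E = (Im (g x))%:E.
  by apply: (@filterS _ _ (ae_filter_ringOfSetsType mu) _ _ _ h) => x hx Dx; rewrite hx.
apply: eqc; rewrite /cintegral /= /Rintegral; congr fine; apply: ae_eq_integral => //.
all: by apply/measurable_EFinP.
Qed.

End SequenceLimits.

Section RieszFischer.
Context {R : realType}.
Local Notation mu := (@lebesgue_measure R).
Local Notation edge := (edge R).
Local Notation nc := (@Normc.normc R).
Local Notation Re := complex.Re.
Local Notation Im := complex.Im.
Implicit Types (g b : R -> R[i]).

Lemma geo_sum_le K : \sum_(0 <= k < K) (2^-1 : R) ^+ k <= 2.
Proof.
have -> : \sum_(0 <= k < K) (2^-1 : R) ^+ k = 2 - 2 * 2^-1 ^+ K.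
  elim: K => [|K ih]; first by rewrite big_geq// expr0 mulr1 subrr.
  by rewrite big_nat_recr//= ih exprS; field.
by rewrite gerBl mulr_ge0// exprn_ge0// invr_ge0.
Qed.

(* Absolute summability almost everywhere comes from integrating
   [sum_k 2^k |d_k|^2]. *)
Lemma riesz_fischer (d : nat -> R -> R[i]) : (forall k, L2e (d k)) ->
  (forall k, \int[mu]_(x in edge) nc (d k x) ^+ 2 <= (4^-1) ^+ k) ->
  exists2 b, L2e b & forall g, L2e g ->
    slim (fun K => \sum_(0 <= k < K) cintegral edge (fun x => d k x * g x))
         (cintegral edge (fun x => b x * g x)).
Proof.
move=> d2 dk; pose s k x := 2 ^+ k * nc (d k x) ^+ 2.
have s0 k x : 0 <= s k x by rewrite mulr_ge0 ?sqr_ge0// exprn_ge0.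
have is_ k : rint edge (s k) by apply: rintZ; [exact: edge_meas|exact: (d2 k).2].
have sk k : \int[mu]_(x in edge) s k x <= 2^-1 ^+ k.
  rewrite RintegralZl; [|exact: edge_meas|exact: (d2 k).2].
  have -> : (2^-1 : R) ^+ k = 2 ^+ k * (4^-1) ^+ k.
    by rewrite -exprMn; congr (_ ^+ k); field.
  by apply: ler_wpM2l; [exact: exprn_ge0|exact: dk].
pose S x := (\sum_(0 <= k <oo) (s k x)%:E)%E.
have S0 x : (0 <= S x)%E by apply: nneseries_ge0 => k _ _; rewrite lee_fin.
have ms k : measurable_fun edge (EFin \o s k) by apply/measurable_EFinP; exact: rint_meas (is_ k).
have mS : measurable_fun edge S.
  by apply: ge0_emeasurable_sum => [k x _ _|k _]; [rewrite lee_fin|exact: ms].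
have iS : mu.-integrable edge S.
  apply/integrableP; split => //.
  have -> : (\int[mu]_(x in edge) `|S x| = \int[mu]_(x in edge) S x)%E.
    by apply: eq_integral => x _; rewrite gee0_abs.
  rewrite /S (integral_nneseries mu edge_meas ms); last by move=> k x _; rewrite lee_fin.
  apply: (@le_lt_trans _ _ 2%:E); last exact: ltry.
  apply: lime_le; first by apply: is_cvg_nneseries => k _ _; apply: integral_ge0 => x _; rewrite lee_fin.
  apply: nearW => K; apply: (@le_trans _ _ (\sum_(0 <= k < K) ((2^-1 : R) ^+ k)%:E)%E).
    apply: lee_sum => k _.
    rewrite -[leLHS]fineK; first by rewrite lee_fin; exact: sk.
    by apply: (integrable_fin_num (mu := mu)); [exact: edge_meas|exact: is_].
  by rewrite sumEFin lee_fin; exact: geo_sum_le.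
have [N [mN N0 hN]] := @integrable_ae _ _ _ mu edge edge_meas S iS.
have Sf x : edge x -> ~ N x -> (fine (S x))%:E = S x.
  move=> xe Nx; apply: fineK; apply: contrapT => h; apply: Nx; apply: hN => /= /(_ xe).
  exact: h.
pose h x := fine (S x).
have ih : rint edge h.
  apply: (@le_integrable _ _ _ mu edge edge_meas _ S) => //.
    by apply/measurable_EFinP; apply: measurableT_comp => //; exact: fine_measurable.
  by move=> x _; rewrite /h /=; case: (S x) => [r||] //=; rewrite ?normr0 ?leey.
have h0 x : 0 <= h x by exact: fine_ge0.
have hS K x : edge x -> ~ N x -> \sum_(0 <= k < K) s k x <= h x.
  move=> xe Nx; rewrite -lee_fin Sf// -sumEFin.
  by apply: (@nneseries_lim_ge _ (fun k => (s k x)%:E) xpredT) => k _ _; rewrite lee_fin.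
pose d' k x := ((\1_(~` N) x : R)%:C%C : R[i]) * d k x.
have dN k x : N x -> d' k x = 0 by move=> Nx; rewrite /d' indicE memNset ?mul0r//=; apply.
have dNN k x : ~ N x -> d' k x = d k x by move=> Nx; rewrite /d' indicE mem_set ?mul1r.
have bd K x t : edge x -> 0 <= t -> (\sum_(0 <= k < K) nc (d' k x)) * t <= 2^-1 * (h x + 2 * t ^+ 2).
  move=> xe t0; have [Nx|Nx] := pselect (N x).
    rewrite big1 => [|k _]; last by rewrite dN// nc0.
    by rewrite mul0r mulr_ge0 ?addr_ge0 ?mulr_ge0 ?sqr_ge0.
  apply: (@le_trans _ _ (2^-1 * (\sum_(0 <= k < K) s k x + (\sum_(0 <= k < K) 2^-1 ^+ k) * t ^+ 2))).
    rewrite [leLHS]mulr_suml [(\sum_(0 <= k < K) 2^-1 ^+ k) * _]mulr_suml -big_split mulr_sumr; apply: ler_sum => k _.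
    rewrite dNN// /s /=; have := sqr_ge0 (2 ^+ k * nc (d k x) - t).
    have : (2 : R) ^+ k * 2^-1 ^+ k = 1 by rewrite -exprMn divff// expr1n.
    have : 0 < (2^-1 : R) ^+ k by rewrite exprn_gt0// invr_gt0.
    move: (2 ^+ k) (2^-1 ^+ k) (nc (d k x)) => a a' e a0 aa q.
    have : 0 <= a' * (a * e - t) ^+ 2 by rewrite mulr_ge0// ltW.
    have -> : a' * (a * e - t) ^+ 2 = (a * a') * a * e ^+ 2 - 2 * (a * a') * e * t + a' * t ^+ 2 by ring.
    by rewrite aa; move=> q2; nra.
  apply: ler_wpM2l => //; apply: lerD; first exact: hS.
  by apply: ler_wpM2r; [exact: sqr_ge0|exact: geo_sum_le].
pose B K x := \sum_(0 <= k < K) d' k x.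
have Bt K x t : edge x -> 0 <= t -> nc (B K x) * t <= 2^-1 * (h x + 2 * t ^+ 2).
  by move=> xe t0; apply: le_trans (bd K x t xe t0); apply: ler_wpM2r => //; exact: nc_sum.
have md k : cmeas edge (d' k).
  apply: cmeasM; last exact: (d2 k).1.
  by apply: cmeas_real; apply: measurable_indic; exact: measurableC.
have mB K : cmeas edge (B K) by apply: cmeas_sum => k _; exact: md.
have rcv (u : nat -> R) x : edge x -> (forall k, `|u k| <= nc (d' k x)) -> cvgn (series u).
  move=> xe uk; apply: normed_cvg; apply: nondecreasing_is_cvgn.
    by apply: nondecreasing_series => k _ _ /=.
  exists (2^-1 * (h x + 2 * 1 ^+ 2)) => _ [K _ <-].
  apply: le_trans (bd K x 1 xe ler01); rewrite mulr1 /series /=.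
  by apply: ler_sum => k _; exact: uk.
have /choice[b hb] : forall x, exists l, edge x -> slim (B ^~ x) l.
  move=> x; have [xe|xe] := pselect (edge x); last by exists 0.
  have c1 := rcv (fun k => Re (d' k x)) x xe (fun k => nc_Re _).
  have c2 := rcv (fun k => Im (d' k x)) x xe (fun k => nc_Im _).
  exists (Complex (limn (series (fun k => Re (d' k x)))) (limn (series (fun k => Im (d' k x))))) => _.
  apply/slim_ReIm; split => /=.
    have -> : (fun K => Re (B K x)) = series (fun k => Re (d' k x)); last exact: c1.
    apply/funext => K; rewrite /B /series /=.
    by elim/big_rec2: _ => // k y z _ <-; rewrite cReD.
  have -> : (fun K => Im (B K x)) = series (fun k => Im (d' k x)); last exact: c2.
  apply/funext => K; rewrite /B /series /=.
  by elim/big_rec2: _ => // k y z _ <-; rewrite cImD.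
have mb : cmeas edge b.
  split; [apply: (@measurable_fun_cvg _ _ _ _ (fun K x => Re (B K x)))|
          apply: (@measurable_fun_cvg _ _ _ _ (fun K x => Im (B K x)))].
  - by move=> K; exact: (mB K).1.
  - by move=> x xe; have [] := (slim_ReIm _ _).1 (hb x xe).
  - by move=> K; exact: (mB K).2.
  - by move=> x xe; have [] := (slim_ReIm _ _).1 (hb x xe).
have hB K x : edge x -> nc (B K x) <= Num.sqrt (2 * h x).
  move=> xe; rewrite -[leLHS]ger0_norm ?nc_ge0// -sqrtr_sqr ler_sqrt ?mulr_ge0//.
  have n0 : 0 <= nc (B K x) / 2 by rewrite divr_ge0// nc_ge0.
  have := Bt K x _ xe n0; move: (nc (B K x)) (h x) => a c; lra.
exists b.
  apply: (@L2e_le _ b (fun x => Num.sqrt (2 * h x)) mb).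
    by apply: rint_ext (rintZ 2 edge_meas ih) => x _; rewrite sqr_sqrtr// mulr_ge0.
  move=> x /edgeP xe; rewrite leNgt; apply/negP => lt.
  have /slimP/(_ (nc (b x) - Num.sqrt (2 * h x))) := hb x xe.
  rewrite subr_gt0 => /(_ lt)[K /(_ K (leqnn K))].
  have := hB K x xe; have := ncB (b x - B K x) (- B K x).
  rewrite opprK subrK ncN ncBC.
  by move: (nc (b x)) (nc (B K x)) (nc (B K x - b x)) (Num.sqrt (2 * h x)) => a1 a2 a3 a4; lra.
move=> g g2.
have ig : rint edge (fun x => 2^-1 * (h x + 2 * nc (g x) ^+ 2)).
  apply: rintZ; first exact: edge_meas.
  by apply: rintD; [exact: edge_meas|exact: ih|exact: rintZ edge_meas g2.2].
have [] := @cdct _ edge (fun K x => B K x * g x) (fun x => b x * g x) _ edge_meas _ ig _ _.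
- by move=> K; apply: cmeasM; [exact: mB|exact: g2.1].
- by move=> K x xe; rewrite ncM; apply: Bt => //; exact: nc_ge0.
- by move=> x xe; exact: (slimM (hb x xe) (@slim_cst _ (g x))).
move=> _; apply: slim_ext => K.
have d'2 k : L2e (d' k).
  split; first exact: md.
  apply: (rint_le _ _ (d2 k).2); first exact: edge_meas.
    by apply: measurable_funX; exact: cmeas_nc.
  move=> x _; rewrite ger0_norm ?sqr_ge0//; have [Nx|Nx] := pselect (N x).
    by rewrite dN// nc0 expr0n /= sqr_ge0.
  by rewrite dNN.
transitivity (cintegral edge (fun x => \sum_(0 <= k < K) d' k x * g x)).
  by apply: eq_cintegral => x _; rewrite mulr_suml.
rewrite cintegral_sum; [|exact: edge_meas|by move=> k _; exact: L2eM].
apply: eq_bigr => k _; apply: ae_cintegral; first exact: edge_meas.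
- by apply: cmeasM; [exact: md|exact: g2.1].
- by apply: cmeasM; [exact: (d2 k).1|exact: g2.1].
- exists N; split => // x /= hx; apply: contrapT => Nx; apply: hx => _.
  by rewrite dNN.
Qed.

End RieszFischer.

Section Inner.
Context {R : realType} {n : nat}.
Local Notation mu := (@lebesgue_measure R).
Local Notation edge := (edge R).
Local Notation nc := (@Normc.normc R).
Local Notation gfun := (gfun R n).
Implicit Types (f g h : gfun) (e : nat -> gfun) (c : nat -> R[i]).

Lemma inner_int f g j : L2 f -> L2 g -> cintegrable edge (fun x => f j x * conjc (g j x)).
Proof. by move=> /L2P hf /L2P hg; apply: L2eM => //; exact: L2e_conj. Qed.

Lemma innerC f g : L2 f -> L2 g -> inner g f = conjc (inner f g).
Proof.
move=> hf hg; rewrite /inner rmorph_sum /=; apply: eq_bigr => j _.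
transitivity (cintegral edge (fun x => conjc (f j x * conjc (g j x)))); last by rewrite cintegral_conj; [|exact: edge_meas|exact: inner_int].
by apply: eq_cintegral => x _; rewrite rmorphM /= conjcK mulrC.
Qed.

Lemma L2_lin (a : R[i]) f g : L2 f -> L2 g -> L2 (fun j x => a * f j x + g j x).
Proof. by move=> /L2P hf /L2P hg; apply/L2P => j; apply: L2eD => //; exact: L2eZ. Qed.

Lemma L2_sub f g : L2 f -> L2 g -> L2 (fun j x => f j x - g j x).
Proof. by move=> /L2P hf /L2P hg; apply/L2P => j; exact: L2eB. Qed.

Lemma inner_lin (a : R[i]) f g h : L2 f -> L2 g -> L2 h ->
  inner (fun j x => a * f j x + g j x) h = a * inner f h + inner g h.
Proof.
move=> hf hg hh; rewrite /inner mulr_sumr -big_split; apply: eq_bigr => j _ /=.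
have i1 := inner_int j hf hh; have i2 := inner_int j hg hh.
rewrite -cintegralZ; [|exact: edge_meas|exact: i1].
rewrite -cintegralD; [|exact: edge_meas|exact: cintZ edge_meas i1|exact: i2].
by apply: eq_cintegral => x _; ring.
Qed.

Lemma innerB f g h : L2 f -> L2 g -> L2 h ->
  inner (fun j x => f j x - g j x) h = inner f h - inner g h.
Proof.
move=> hf hg hh; rewrite /inner -sumrB; apply: eq_bigr => j _ /=.
have i1 := inner_int j hf hh; have i2 := inner_int j hg hh.
rewrite -cintegralB; [|exact: edge_meas|exact: i1|exact: i2].
by apply: eq_cintegral => x _; ring.
Qed.

Lemma inner_ae f g h : L2 f -> L2 g -> L2 h -> gae_eq f g -> inner f h = inner g h.
Proof.
move=> /L2P hf /L2P hg /L2P hh fg; apply: eq_bigr => j _; apply: ae_cintegral.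
- exact: edge_meas.
- by apply: cmeasM; [exact: (hf j).1|apply: cmeas_conj; exact: (hh j).1].
- by apply: cmeasM; [exact: (hg j).1|apply: cmeas_conj; exact: (hh j).1].
apply: (@filterS _ _ (ae_filter_ringOfSetsType mu) _ _ _ (fg j)) => x hx xe.
by rewrite hx.
Qed.

Lemma inner_self f : inner f f = (normsq f)%:C%C.
Proof.
rewrite /inner /normsq rmorph_sum; apply: eq_bigr => j _.
transitivity (cintegral edge (fun x => (nc (f j x) ^+ 2)%:C%C)).
  by apply: eq_cintegral => x _; rewrite mulcJ.
exact: cintegral_real.
Qed.

Lemma normsq_ge0 f : 0 <= normsq f.
Proof. by apply: sumr_ge0 => j _; apply: Rintegral_ge0 => x _; exact: sqr_ge0. Qed.

Lemma normsq_edge f j : \int[mu]_(x in edge) nc (f j x) ^+ 2 <= normsq f.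
Proof.
rewrite /normsq (bigD1 j)//= lerDl; apply: sumr_ge0 => i _.
by apply: Rintegral_ge0 => x _; exact: sqr_ge0.
Qed.

Lemma cauchy_schwarz f g : L2 f -> L2 g -> nc (inner f g) ^+ 2 <= normsq f * normsq g.
Proof.
move=> hf hg; set c := inner f g.
have q (s : R) : 0 <= normsq f - 2 * s * nc c ^+ 2 + s ^+ 2 * nc c ^+ 2 * normsq g.
  pose a := - (s%:C%C * c); have hl := L2_lin a hg hf.
  have : normsq (fun j x => a * g j x + f j x) = 
      normsq f - 2 * s * nc c ^+ 2 + s ^+ 2 * nc c ^+ 2 * normsq g.
    apply/complexI; rewrite -inner_self (inner_lin a hg hf hl).
    rewrite (innerC hl hg) (inner_lin a hg hf hg) (innerC hl hf) (inner_lin a hg hf hf).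
    rewrite (innerC hf hg) !inner_self -/c /a; move: {hl a} c (normsq f) (normsq g) => [x y] F G.
    have -> : nc (Complex x y) ^+ 2 = x ^+ 2 + y ^+ 2 by rewrite ncE sqr_sqrtr// addr_ge0 ?sqr_ge0.
    by apply: eqc => /=; ring.
  by move=> <-; exact: normsq_ge0.
have := normsq_ge0 g; rewrite le_eqVlt => /predU1P[g0|g0].
  rewrite -g0 mulr0 leNgt; apply/negP => c0.
  have := q ((normsq f + 1) / (2 * nc c ^+ 2)); rewrite -g0 mulr0 addr0.
  have -> : 2 * ((normsq f + 1) / (2 * nc c ^+ 2)) * nc c ^+ 2 = normsq f + 1.
    by field; apply: contraTneq c0 => ->; rewrite expr0n ltxx.
  by rewrite opprD addrA subrr add0r oppr_ge0 ler10.
have := q (normsq g)^-1.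
have -> : normsq f - 2 * (normsq g)^-1 * nc c ^+ 2 + (normsq g)^-1 ^+ 2 * nc c ^+ 2 * normsq g =
  (normsq f * normsq g - nc c ^+ 2) / normsq g by field; rewrite gt_eqF.
by rewrite pmulr_lge0 ?invr_gt0// subr_ge0.
Qed.

Definition comb c e (r : seq nat) : gfun := fun j x => \sum_(k <- r) c k * e k j x.

Lemma L2_comb c e r : (forall k, L2 (e k)) -> L2 (comb c e r).
Proof.
move=> he; apply/L2P => j; apply: L2e_sum => k _; apply: L2eZ.
by have /L2P := he k.
Qed.

Lemma inner_comb c e r g : (forall k, L2 (e k)) -> L2 g ->
  inner (comb c e r) g = \sum_(k <- r) c k * inner (e k) g.
Proof.
move=> he hg; elim: r => [|k r ih].
  rewrite big_nil /inner big1// => j _.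
  rewrite -[RHS](cintegral0 edge); apply: eq_cintegral => x _.
  by rewrite /comb big_nil mul0r.
rewrite big_cons -ih -(inner_lin _ (he k) (L2_comb c r he) hg).
apply: eq_bigr => j _; apply: eq_cintegral => x _.
by rewrite /comb big_cons.
Qed.

Section Orthonormal.
Variable e : nat -> gfun.
Hypothesis eL2 : forall k, L2 (e k).
Hypothesis eO : forall k l, inner (e k) (e l) = (k == l)%:R.

Lemma inner_comb_basis c r m : uniq r -> inner (comb c e r) (e m) = if m \in r then c m else 0.
Proof.
move=> ur; rewrite inner_comb//; case: ifP => mr.
  rewrite (bigD1_seq m)//= eO eqxx mulr1 big1 ?addr0// => k km.
  by rewrite eO (negPf km) mulr0.
rewrite big_seq big1// => k kr; rewrite eO.
case: eqP => [km|_]; last by rewrite mulr0.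
by move: mr; rewrite -km kr.
Qed.

Lemma normsq_comb c r : uniq r -> normsq (comb c e r) = \sum_(k <- r) nc (c k) ^+ 2.
Proof.
move=> ur; apply/complexI; rewrite -inner_self inner_comb//; last exact: L2_comb.
rewrite rmorph_sum /= !big_seq; apply: eq_bigr => k kr.
rewrite (innerC (L2_comb c r eL2) (eL2 k)) inner_comb_basis// kr.
by rewrite mulcJ.
Qed.

Definition cf f k := inner f (e k).
Definition oproj f N := comb (cf f) e (index_iota 0 N).

Lemma proj_sub_L2 f N : L2 f -> L2 (fun j x => f j x - oproj f N j x).
Proof. by move=> hf; apply: L2_sub => //; exact: L2_comb. Qed.

Lemma inner_proj_sub f g N : L2 f -> L2 g ->
  inner (fun j x => f j x - oproj f N j x) g = inner f g - \sum_(0 <= k < N) cf f k * inner (e k) g.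
Proof.
by move=> hf hg; rewrite (innerB hf (L2_comb _ _ eL2) hg) (inner_comb _ _ eL2 hg).
Qed.

Lemma normsq_proj_sub f N : L2 f ->
  normsq (fun j x => f j x - oproj f N j x) = normsq f - \sum_(0 <= k < N) nc (cf f k) ^+ 2.
Proof.
move=> hf; have hp := proj_sub_L2 N hf; have h2 := L2_comb (cf f) (index_iota 0 N) eL2.
apply/complexI; rewrite -inner_self (inner_proj_sub N hf hp).
have e0 k : (k < N)%N -> inner (e k) (fun j x => f j x - oproj f N j x) = 0.
  move=> kN; rewrite (innerC hp (eL2 k)) (innerB hf h2 (eL2 k)) inner_comb_basis ?iota_uniq//.
  by rewrite mem_index_iota /= kN subrr conjc0.
rewrite big_nat_cond big1 => [|k /andP[/andP[_ kN] _]]; last by rewrite e0// mulr0.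
rewrite subr0 (innerC hp hf) (inner_proj_sub N hf hf) inner_self.
have -> : \sum_(0 <= k < N) cf f k * inner (e k) f = (\sum_(0 <= k < N) nc (cf f k) ^+ 2)%:C%C.
  rewrite rmorph_sum; apply: eq_bigr => k _.
  by rewrite (innerC hf (eL2 k)) mulcJ.
by apply: eqc => /=; ring.
Qed.

Lemma bessel f N : L2 f -> \sum_(0 <= k < N) nc (cf f k) ^+ 2 <= normsq f.
Proof. by move=> hf; rewrite -subr_ge0 -normsq_proj_sub//; exact: normsq_ge0. Qed.

End Orthonormal.
End Inner.

Section Parseval.
Context {R : realType} {n : nat}.
Local Notation edge := (edge R).
Local Notation nc := (@Normc.normc R).
Local Notation gfun := (gfun R n).
Implicit Types (f g h : gfun).

Lemma sum_tail_small (a : nat -> R) (C : R) : (forall k, 0 <= a k) ->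
  (forall N, \sum_(0 <= k < N) a k <= C) -> forall eps, 0 < eps ->
  exists M, forall m N, (M <= m)%N -> \sum_(m <= k < N) a k <= eps.
Proof.
move=> a0 aC eps eps0.
have nd : {homo series a : p q / (p <= q)%N >-> p <= q} by apply: nondecreasing_series => k _ _.
have cv : cvgn (series a).
  by apply: nondecreasing_is_cvgn => //; exists C => _ [N _ <-]; exact: aC.
have /cvgrPdist_lt/(_ eps eps0)[M _ hM] := cv.
exists M => m N Mm; have [mN|Nm] := leqP m N; last by rewrite big_geq ?(ltW eps0)// ltnW.
have := hM m Mm; have := nondecreasing_cvgn_le nd cv N; have := nondecreasing_cvgn_le nd cv m.
rewrite /series /= (big_cat_nat (n := m) (p := N))//=.
move: (limn _) (\sum_(0 <= k < m) a k) (\sum_(m <= k < N) a k) => l s t h1 h2.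
by rewrite ger0_norm; [lra|rewrite subr_ge0].
Qed.

Variable e : nat -> gfun.
Hypothesis eB : orthonormal_basis e.
Let eL2 : forall k, L2 (e k). Proof. by case: eB. Qed.
Let eO : forall k l, inner (e k) (e l) = (k == l)%:R. Proof. by case: eB. Qed.

Lemma sparse_index f : L2 f -> exists N : nat -> nat, [/\ forall k, (k <= N k)%N,
  forall k, (N k <= N k.+1)%N &
  forall k, \sum_(N k <= i < N k.+1) nc (cf e f i) ^+ 2 <= (4^-1) ^+ k].
Proof.
move=> hf.
have /choice[m hm] : forall k, exists M, forall p q, (M <= p)%N ->
    \sum_(p <= i < q) nc (cf e f i) ^+ 2 <= (4^-1) ^+ k.
  move=> k; apply: (@sum_tail_small _ (normsq f)) => //.
  - by move=> i; exact: sqr_ge0.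
  - by move=> N; exact: (bessel eL2 eO N hf).
exists (fun k => \sum_(i < k.+1) (m i).+1)%N; split.
- elim=> [|k ih]; first exact: leq0n.
  by rewrite big_ord_recr /= addnS ltnS (leq_trans ih)// leq_addr.
- by move=> k; rewrite [leqRHS]big_ord_recr /= leq_addr.
- by move=> k; apply: hm; rewrite big_ord_recr /= (leq_trans (leqnSn _))// leq_addl.
Qed.

Lemma deficiency f : L2 f -> forall eps, 0 < eps -> exists M, forall N, (M <= N)%N ->
  normsq f - \sum_(0 <= k < N) nc (cf e f k) ^+ 2 <= eps.
Proof.
move=> hf eps eps0; have [N [kN N1 hN]] := sparse_index hf; set c := cf e f.
pose d k := comb c e (index_iota (N k) (N k.+1)).
have d2 k : L2 (d k) by exact: L2_comb.
have /choice[b hb] : forall j, exists b : R -> R[i], L2e b /\ forall g : R -> R[i], L2e g ->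
    slim (fun K => \sum_(0 <= k < K) cintegral edge (fun x => d k j x * g x))
         (cintegral edge (fun x => b x * g x)).
  move=> j; have [||b b2 hb] := @riesz_fischer R (fun k => d k j); last by exists b.
    by move=> k; have /L2P := d2 k.
  move=> k; apply: (le_trans (normsq_edge (d k) j)).
  by rewrite normsq_comb ?iota_uniq.
have b2 : L2 b by apply/L2P => j; exact: (hb j).1.
have NK K : (N 0%N <= N K)%N by elim: K => // K ih; exact: leq_trans (N1 K).
have wk g : L2 g -> slim (fun K => \sum_(N 0%N <= i < N K) c i * inner (e i) g) (inner b g).
  move=> g2; have := @slim_sum R 'I_n (index_enum 'I_n) xpredT
      (fun j K => \sum_(0 <= k < K) cintegral edge (fun x => d k j x * conjc (g j x)))
      (fun j => cintegral edge (fun x => b j x * conjc (g j x))) _.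
  have /L2P g2' := g2.
  move=> h; have {h} := h (fun j _ => (hb j).2 _ (L2e_conj (g2' j))).
  apply: slim_ext => K; rewrite exchange_big /=.
  elim: K => [|K ih]; first by rewrite !big_geq.
  rewrite big_nat_recr//= ih [RHS](big_cat_nat (n := N K))//=; congr (_ + _).
  by rewrite -(inner_comb c _ eL2 g2).
have fb2 : L2 (fun j x => f j x - oproj e f (N 0%N) j x) by exact: proj_sub_L2.
have z : gae_eq (fun j x => f j x - oproj e f (N 0%N) j x - b j x) (fun=> fun=> 0).
  have [_ _] := eB; apply; first exact: L2_sub.
  move=> m; rewrite (innerB fb2 b2 (eL2 m)) inner_proj_sub//.
  have := wk (e m) (eL2 m) => /slimP h.
  have -> : inner b (e m) = if (N 0%N <= m)%N then c m else 0.
    apply: slim_unique (wk (e m) (eL2 m)) _; apply/slimP => t t0; exists m.+1 => K mK.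
    rewrite -(inner_comb c _ eL2 (eL2 m)) inner_comb_basis ?iota_uniq// mem_index_iota.
    by rewrite (leq_trans mK (kN K)) andbT subrr nc0.
  rewrite -(inner_comb _ _ eL2 (eL2 m)) inner_comb_basis ?iota_uniq// mem_index_iota leq0n /=.
  by rewrite -/(cf e f m) -/c; case: leqP => _; rewrite ?subr0 ?subrr// sub0r addNr.
have ff : inner b f = (normsq f - \sum_(0 <= k < N 0%N) nc (c k) ^+ 2)%:C%C.
  have L0 : L2 (fun (_ : 'I_n) (_ : R) => 0 : R[i]).
    by apply/L2P => j; apply: L2e_ext (L2eZ 0 (hb j).1) => x _; rewrite mul0r.
  have := inner_ae (L2_sub fb2 b2) L0 hf z.
  rewrite (innerB fb2 b2 hf) inner_proj_sub// inner_self.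
  have -> : inner (fun=> fun=> 0) f = 0.
    rewrite /inner big1// => j _; rewrite -[RHS](cintegral0 edge).
    by apply: eq_cintegral => x _; rewrite mul0r.
  move=> /eqP; rewrite subr_eq0 => /eqP <-; rewrite rmorphB; congr (_ - _); rewrite [RHS]rmorph_sum.
  by apply: eq_bigr => k _; rewrite (innerC hf (eL2 k)) mulcJ.
have /slimP/(_ eps eps0)[K /(_ K (leqnn K))] := wk f hf.
rewrite ff.
have -> : \sum_(N 0%N <= i < N K) c i * inner (e i) f = (\sum_(N 0%N <= i < N K) nc (c i) ^+ 2)%:C%C.
  by rewrite rmorph_sum; apply: eq_bigr => k _; rewrite (innerC hf (eL2 k)) mulcJ.
rewrite -rmorphB nc_real => hK; exists (N K) => M NM.
have sm : \sum_(0 <= k < N K) nc (c k) ^+ 2 <= \sum_(0 <= k < M) nc (c k) ^+ 2.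
  rewrite [leRHS](big_cat_nat (n := N K))//= lerDl.
  by apply: sumr_ge0 => k _; exact: sqr_ge0.
move: sm hK; rewrite (big_cat_nat (n := N 0%N) (p := N K))//=.
move: (\sum_(0 <= k < N 0%N) _) (\sum_(N 0%N <= k < N K) _) (\sum_(0 <= k < M) _) (normsq f) => p q r s.
by rewrite ltr_norml => h1 /andP[h2 _]; lra.
Qed.

Lemma parseval f g : L2 f -> L2 g ->
  slim (fun N => \sum_(0 <= k < N) inner f (e k) * inner (e k) g) (inner f g).
Proof.
move=> hf hg; apply/slimP => eps eps0.
have G0 : 0 < normsq g + 1 by rewrite ltr_wpDl ?normsq_ge0.
have d0 : 0 < eps ^+ 2 / (normsq g + 1) / 2 by rewrite !divr_gt0// exprn_gt0.
have [M hM] := deficiency hf d0; exists M => N MN.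
rewrite ncBC -(inner_proj_sub eL2 N hf hg).
have := cauchy_schwarz (proj_sub_L2 eL2 N hf) hg.
rewrite normsq_proj_sub// => h.
rewrite -(@ltr_pXn2r _ 2)//; rewrite ?nnegrE ?nc_ge0 ?(ltW eps0)//.
apply: (le_lt_trans h).
apply: (@le_lt_trans _ _ (eps ^+ 2 / (normsq g + 1) / 2 * (normsq g + 1))).
  apply: (@le_trans _ _ (eps ^+ 2 / (normsq g + 1) / 2 * normsq g)).
    by apply: ler_wpM2r; [exact: normsq_ge0|exact: hM].
  by apply: ler_wpM2l; [exact: ltW|rewrite lerDl].
rewrite mulrAC divfK ?gt_eqF// ltr_pdivrMr// ltr_pMr ?exprn_gt0//.
by rewrite ltr1n.
Qed.

End Parseval.

Section KernelOperator.
Context {R : realType} {n : nat}.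
Local Notation mu := (@lebesgue_measure R).
Local Notation edge := (edge R).
Local Notation nc := (@Normc.normc R).
Local Notation gfun := (gfun R n).

Lemma hs_kernel (A : gfun -> gfun) (k : 'I_n -> R -> gfun) (h : 'I_n -> R -> R) :
  (forall j x, 0 <= x -> L2 (k j x)) -> (forall j x, 0 <= x -> normsq (k j x) <= h j x) ->
  (forall j, rint edge (h j)) ->
  (forall f j x, L2 f -> 0 <= x -> A f j x = inner f (k j x)) ->
  (forall f j, L2 f -> cmeas edge (A f j)) -> hilbert_schmidt A.
Proof.
move=> k2 kh ih AE Am.
have le f j x : L2 f -> 0 <= x -> nc (A f j x) ^+ 2 <= normsq f * h j x.
  move=> hf x0; rewrite AE//; apply: (le_trans (cauchy_schwarz hf (k2 j x x0))).
  by apply: ler_wpM2l; [exact: normsq_ge0|exact: kh].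
have A2 f : L2 f -> forall j, L2e (A f j).
  move=> hf j; split; first exact: Am.
  apply: (rint_le _ _ (rintZ (normsq f) edge_meas (ih j))); first exact: edge_meas.
    by apply: measurable_funX; apply: cmeas_nc; exact: Am.
  by move=> x /edgeP x0; rewrite ger0_norm ?sqr_ge0//; exact: le.
have lin (a : R[i]) f g j x : L2 f -> L2 g -> 0 <= x ->
    A (fun j x => a * f j x + g j x) j x = a * A f j x + A g j x.
  move=> hf hg x0; have hl := L2_lin a hf hg.
  by rewrite !AE//; exact: inner_lin (k2 j x x0).
split.
  split.
  - by move=> f hf; apply/L2P; exact: A2.
  - by move=> a f g hf hg; apply: gae_refl => j x x0; exact: lin.
  exists (\sum_j \int[mu]_(x in edge) h j x) => f hf.
  rewrite mulrC /normsq -/(normsq f) mulr_sumr; apply: ler_sum => j _.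
  rewrite -RintegralZl; [|exact: edge_meas|exact: ih].
  apply: le_Rintegral; [exact: edge_meas|exact: (A2 f hf j).2|exact: rintZ edge_meas (ih j)|].
  by move=> x /edgeP x0; exact: le.
move=> e eB; have [eL2 eO _] := eB.
apply: nondecreasing_is_cvgn.
  by apply: nondecreasing_series => i _ _; exact: normsq_ge0.
exists (\sum_j \int[mu]_(x in edge) h j x) => _ [N _ <-]; rewrite /series /= /normsq exchange_big /=.
apply: ler_sum => j _; rewrite -Rintegral_bigsum; [|exact: edge_meas|by move=> i _; exact: (A2 _ (eL2 i) j).2].
apply: le_Rintegral; [exact: edge_meas| |exact: ih|].
  by apply: rint_sum; [exact: edge_meas|move=> i _; exact: (A2 _ (eL2 i) j).2].
move=> x /edgeP x0; apply: le_trans (kh j x x0).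
apply: le_trans (bessel eL2 eO N (k2 j x x0)); apply: ler_sum => i _.
by rewrite AE// (innerC (k2 j x x0) (eL2 i)) nc_conjc.
Qed.

End KernelOperator.

(** * The trace *)

Section GreenKernel.
Context {R : realType} {n : nat}.
Local Notation mu := (@lebesgue_measure R).
Local Notation edge := (edge R).
Local Notation nc := (@Normc.normc R).
Local Notation Im := complex.Im.
Local Notation gfun := (gfun R n).

Definition gconj (f : gfun) : gfun := fun j x => conjc (f j x).

Lemma L2_conj (f : gfun) : L2 f -> L2 (gconj f).
Proof. by move=> /L2P hf; apply/L2P => j; exact: L2e_conj. Qed.

Lemma normsq_conj (f : gfun) : normsq (gconj f) = normsq f.
Proof. by apply: eq_bigr => j _; apply: eq_Rintegral => x _; rewrite nc_conjc. Qed.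

Lemma inner_gconj (f g : gfun) : inner f (gconj g) = \sum_l cintegral edge (fun y => g l y * f l y).
Proof. by apply: eq_bigr => l _; apply: eq_cintegral => y _; rewrite conjcK mulrC. Qed.

Lemma normsq_sub (f g : gfun) : L2 f -> L2 g ->
  normsq (fun j x => f j x - g j x) <= 2 * normsq f + 2 * normsq g.
Proof.
move=> ha hb; have /L2P hab := L2_sub ha hb; have /L2P ha' := ha; have /L2P hb' := hb.
rewrite /normsq; rewrite [2 * \sum_(j < n) \int[mu]_(x in edge) nc (f j x) ^+ 2]mulr_sumr.
rewrite [2 * \sum_(j < n) _]mulr_sumr -big_split /=; apply: ler_sum => j _.
have i1 := rintZ 2 edge_meas (ha' j).2; have i2 := rintZ 2 edge_meas (hb' j).2.
rewrite -RintegralZl; [|exact: edge_meas|exact: (ha' j).2].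
rewrite -RintegralZl; [|exact: edge_meas|exact: (hb' j).2].
rewrite -RintegralD; [|exact: edge_meas|exact: i1|exact: i2].
apply: le_Rintegral; [exact: edge_meas|exact: (hab j).2|exact: rintD edge_meas i1 i2|].
by move=> x _; apply: (le_trans (sqr_ncD _ _)); rewrite ncN.
Qed.

Variables (V : 'I_n -> R -> R) (zeta : R[i]) (th dth ch dch : gfun)
  (cc : 'I_n -> 'I_n -> R[i]) (A : R).
Hypothesis gd : green_data V zeta th dth ch dch cc A.
Local Notation green := (green th ch cc).
Local Notation kap := (Im zeta).
Let kap0 : 0 < kap := gd_im gd.
Let kap20 : 0 < 2 * kap. Proof. exact: mulr_gt0. Qed.
Local Notation ker := (kern th ch cc th ch).

Lemma greenE f j x : green f j x = inner f (gconj (ker j x)).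
Proof. by rewrite inner_gconj. Qed.

Lemma kern_sqr j x l y : 0 <= x -> 0 <= y ->
  nc (ker j x l y) ^+ 2 <= gcst A ^+ 2 * expR (- (2 * kap) * `|x - y|).
Proof.
move=> x0 y0; have h := kern_le gd j l (growth0 gd) x0 y0.
have -> : gcst A ^+ 2 * expR (- (2 * kap) * `|x - y|) = (gcst A * expR (- kap * `|x - y|)) ^+ 2.
  by rewrite exprMn [expR _ ^+ 2]expr2 -expRD; congr (_ * expR _); ring.
apply: lerXn2r => //; rewrite nnegrE ?nc_ge0//.
by rewrite mulr_ge0 ?expR_ge0//; exact: gcst_ge0 gd.
Qed.

Definition kern_cst := n%:R * (gcst A ^+ 2 * (2 / (2 * kap))).

Lemma kern_L2 j x : 0 <= x -> L2 (ker j x) /\ normsq (ker j x) <= kern_cst.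
Proof.
move=> x0; have [ie le] := expR_abs_rint kap20 x0.
have i := rintZ (gcst A ^+ 2) edge_meas ie.
have h l : L2e (ker j x l).
  have mk := kern_meas gd th ch j x l; split => //; apply: (rint_le _ _ i); first exact: edge_meas.
    by apply: measurable_funX; exact: cmeas_nc.
  by move=> y /edgeP y0; rewrite ger0_norm ?sqr_ge0//; exact: kern_sqr.
split; first by apply/L2P.
have hl l : \int[mu]_(y in edge) nc (ker j x l y) ^+ 2 <= gcst A ^+ 2 * (2 / (2 * kap)).
  apply: (@le_trans _ _ (\int[mu]_(y in edge) (gcst A ^+ 2 * expR (- (2 * kap) * `|x - y|)))).
    apply: le_Rintegral; [exact: edge_meas|exact: (h l).2|exact: i|].
    by move=> y /edgeP y0; exact: kern_sqr.
  by rewrite RintegralZl; [apply: ler_wpM2l; [exact: sqr_ge0|exact: le]|exact: edge_meas|exact: ie].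
apply: (le_trans (ler_sum _ (fun l _ => hl l))).
by rewrite sumr_const card_ord /kern_cst -[leLHS]mulr_natl.
Qed.

Lemma green_src_meas f j : good zeta f -> cmeas edge (green f j).
Proof. by move=> gf; have [h _ _ _ _] := green_dom gd gf; exact: ac_meas (h j). Qed.

Lemma green_bounded_fun f j : good zeta f -> exists B, forall x, 0 <= x -> nc (green f j x) <= B.
Proof.
move=> gf; have hu := green_dom gd gf.
exact: H1e_bounded (dom_ac hu j) (dom_L2 hu j).1 (dom_L2 hu j).2.
Qed.

Lemma mul_green_int (q : 'I_n -> R -> R) f j : rint edge (q j) -> good zeta f ->
  cintegrable edge (fun x => (q j x)%:C%C * green f j x).
Proof.
move=> iq gf; have [B hB] := green_bounded_fun j gf.
have h1 (x : R) : 0 <= x -> nc (1 : R[i]) <= 1 by rewrite nc1.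
have := potential_int iq (green_src_meas j gf) (cmeas_cst edge 1) hB h1.
by apply: cint_ext => x _; rewrite mulr1.
Qed.

Lemma src_lin (a : R[i]) (f g : gfun) : src zeta f -> src zeta g -> src zeta (fun j x => a * f j x + g j x).
Proof.
move=> sf sg l; have [mf fi] := sf l; have [mg gi] := sg l; split.
  by apply: cmeasD => //; apply: cmeasM => //; exact: cmeas_cst.
apply: (rint_le _ _ (rintD edge_meas (rintZ (nc a) edge_meas fi) gi)); first exact: edge_meas.
  apply: measurable_funM; last by apply: cmeas_nc; apply: cmeasD => //; apply: cmeasM => //; exact: cmeas_cst.
  by apply: measurableT_comp => //; exact: measurable_funM.
move=> y _; rewrite ger0_norm ?mulr_ge0 ?expR_ge0 ?nc_ge0//.
have -> : nc a * (expR (- kap * y) * nc (f l y)) + expR (- kap * y) * nc (g l y) =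
  expR (- kap * y) * (nc (a * f l y) + nc (g l y)) by rewrite ncM; ring.
by apply: ler_wpM2l; [exact: expR_ge0|exact: ncD].
Qed.

End GreenKernel.

Section TraceClass.
Context {R : realType} {n : nat}.
Local Notation mu := (@lebesgue_measure R).
Local Notation edge := (edge R).
Local Notation nc := (@Normc.normc R).
Local Notation Im := complex.Im.
Local Notation gfun := (gfun R n).

(* [|V|^(1/2)] and [sgn(V) |V|^(1/2)], in a visibly measurable form: [Num.sqrt]
   vanishes on negative numbers. *)
Definition qp (V : 'I_n -> R -> R) j x := Num.sqrt (V j x) + Num.sqrt (- V j x).
Definition qm (V : 'I_n -> R -> R) j x := Num.sqrt (V j x) - Num.sqrt (- V j x).

Lemma qpm V j x : [/\ qp V j x * qm V j x = V j x, qp V j x ^+ 2 = `|V j x| &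
  qm V j x ^+ 2 = `|V j x| ].
Proof.
rewrite /qp /qm; have [v0|v0] := leP 0 (V j x).
  rewrite ger0_norm// (@ler0_sqrtr _ (- V j x)) ?oppr_le0//.
  by rewrite addr0 subr0 -expr2 sqr_sqrtr.
have v1 := ltW v0; rewrite ltr0_norm// (@ler0_sqrtr _ (V j x))// add0r sub0r mulrN -expr2 sqrrN.
by rewrite sqr_sqrtr ?oppr_ge0// opprK.
Qed.

Lemma qp_meas V j : rint edge (V j) -> measurable_fun edge (qp V j) /\ measurable_fun edge (qm V j).
Proof.
move=> iV; have mV := rint_meas iV.
have m1 : measurable_fun edge (fun x => Num.sqrt (V j x)).
  by apply: (measurableT_comp (continuous_measurable_fun (@sqrt_continuous R))).
have m2 : measurable_fun edge (fun x => Num.sqrt (- V j x)).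
  apply: (measurableT_comp (continuous_measurable_fun (@sqrt_continuous R))).
  exact: measurableT_comp.
by split; [apply: measurable_funD|apply: measurable_funB].
Qed.

Variables (V : 'I_n -> R -> R) (zeta : R[i]).
Variables (th dth ch dch : gfun) (cc : 'I_n -> 'I_n -> R[i]) (A : R).
Variables (th0 dth0 ch0 dch0 : gfun) (cc0 : 'I_n -> 'I_n -> R[i]) (A0 : R).
Hypothesis gd : green_data V zeta th dth ch dch cc A.
Hypothesis gd0 : green_data (fun=> cst 0) zeta th0 dth0 ch0 dch0 cc0 A0.
Local Notation G := (green th ch cc).
Local Notation G0 := (green th0 ch0 cc0).
Local Notation kap := (Im zeta).
Let kap0 : 0 < kap := gd_im gd.
Let kap20 : 0 < 2 * kap. Proof. exact: mulr_gt0. Qed.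
Local Notation ker := (kern th ch cc th ch).
Local Notation ker0 := (kern th0 ch0 cc0 th0 ch0).
Let iV := gd_V gd.

Lemma potential_green_int f j : L2 f -> cintegrable edge (fun x => (V j x)%:C%C * G f j x).
Proof. by move=> hf; exact: (mul_green_int gd (iV j) (L2_good gd hf)). Qed.

Lemma second_resolvent f j x : L2 f -> 0 <= x ->
  G0 f j x - G f j x = G0 (fun j x => (V j x)%:C%C * G f j x) j x.
Proof.
move=> hf x0; have gf := L2_good gd hf; have hu := green_dom gd gf.
have [s1 _] := gf.
have [s2 _] : good zeta (fun j x => (V j x)%:C%C * G f j x).
  by apply: (L1_good gd) => l; exact: potential_green_int.
have hu0 : dom (fun=> cst 0) (zeta ^+ 2) (fun j x => (- 1) * ((V j x)%:C%C * G f j x) + f j x)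
    (G f) (dgreen th dth ch dch cc f).
  split; [exact: (dom_ac hu)| |exact: (dom_cont hu)|exact: (dom_kirch hu)|exact: (dom_L2 hu)].
  by move=> l; apply: ac_eq (dom_dac hu l) => t _; rewrite /cst /=; ring.
have e := dom_repr gd0 j hu0 (src_lin (-1) s2 s1) x0.
by rewrite e (green_lin gd0 _ _ s2 s1 x0); ring.
Qed.

Lemma sqrt_mul_L1 f j : L2 f -> cintegrable edge (fun x => (qp V j x)%:C%C * f j x).
Proof.
move=> /L2P hf; apply: L2eM => //; split; first by apply: cmeas_real; exact: (qp_meas (iV j)).1.
apply: rint_ext (rint_norm (iV j)) => x _; have [_ e _] := qpm V j x.
by rewrite nc_real real_normK ?num_real// e.
Qed.

Lemma hs_left : hilbert_schmidt (fun f => G0 (fun l y => (qp V l y)%:C%C * f l y)).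
Proof.
pose k j x : gfun := gconj (fun l y => (qp V l y)%:C%C * ker0 j x l y).
pose h (j : 'I_n) x := \sum_l (gcst A0 ^+ 2 * cvl (2 * kap) (fun y => `|V l y|) x).
have kle j x l y : 0 <= x -> 0 <= y -> nc (k j x l y) ^+ 2 <=
    gcst A0 ^+ 2 * (expR (- (2 * kap) * `|x - y|) * `|V l y|).
  move=> x0 y0; rewrite /k /gconj nc_conjc ncM nc_real exprMn real_normK ?num_real//.
  have [_ -> _] := qpm V l y; rewrite mulrC mulrA; apply: ler_wpM2r => //.
  exact: (kern_sqr gd0).
have ik x l : 0 <= x -> rint edge (fun y => gcst A0 ^+ 2 * (expR (- (2 * kap) * `|x - y|) * `|V l y|)).
  move=> x0; apply: rintZ; first exact: edge_meas.
  by apply: cvl_int => //; apply: rint_norm; exact: iV.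
have k2 j x l : 0 <= x -> L2e (k j x l).
  move=> x0; have mk : cmeas edge (k j x l).
    apply: cmeas_conj; apply: cmeasM; first by apply: cmeas_real; exact: (qp_meas (iV l)).1.
    exact: (kern_meas gd0 th0 ch0 j x l).
  split => //; apply: (rint_le _ _ (ik x l x0)); first exact: edge_meas.
    by apply: measurable_funX; exact: cmeas_nc.
  by move=> y /edgeP y0; rewrite ger0_norm ?sqr_ge0//; exact: kle.
apply: (@hs_kernel _ _ _ k h).
- by move=> j x x0; apply/L2P => l; exact: k2.
- move=> j x x0; apply: ler_sum => l _; rewrite /cvl -RintegralZl; [|exact: edge_meas|].
    apply: le_Rintegral; [exact: edge_meas|exact: (k2 j x l x0).2|exact: ik|].
    by move=> y /edgeP y0; exact: kle.
  by apply: cvl_int => //; apply: rint_norm; exact: iV.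
- move=> j; apply: rint_sum; [exact: edge_meas|move=> l _].
  apply: rintZ; first exact: edge_meas.
  have [] := cvl_rint kap20 (rint_norm (iV l)) (fun y _ => normr_ge0 _).
  by [].
- move=> f j x hf x0; rewrite /k inner_gconj; apply: eq_bigr => l _.
  by apply: eq_cintegral => y _; ring.
- move=> f j hf; apply: (green_src_meas gd0); apply: (L1_good gd0) => l.
  exact: sqrt_mul_L1.
Qed.

Lemma hs_right : hilbert_schmidt (fun f j x => (qm V j x)%:C%C * G f j x).
Proof.
pose k j x : gfun := gconj (fun l y => (qm V j x)%:C%C * ker j x l y).
pose h (j : 'I_n) x := kern_cst (n := n) zeta A * `|V j x|.
have k2 j x l : 0 <= x -> L2e (fun y => (qm V j x)%:C%C * ker j x l y).
  by move=> x0; apply: L2eZ; have [/L2P] := kern_L2 gd j x0.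
apply: (@hs_kernel _ _ _ k h).
- by move=> j x x0; apply: L2_conj; apply/L2P => l; exact: k2.
- move=> j x x0; rewrite /k normsq_conj /normsq.
  have [k2' kle] := kern_L2 gd j x0; have /L2P k2'' := k2'.
  under eq_bigr => l _.
    under eq_Rintegral do rewrite ncM exprMn nc_real.
    rewrite RintegralZl; [|exact: edge_meas|exact: (k2'' l).2].
    over.
  rewrite -mulr_sumr real_normK ?num_real//; have [_ _ ->] := qpm V j x.
  by rewrite /h mulrC; apply: ler_wpM2r.
- by move=> j; apply: rintZ; [exact: edge_meas|apply: rint_norm; exact: iV].
- move=> f j x hf x0; rewrite greenE !inner_gconj mulr_sumr; apply: eq_bigr => l _.
  have [/L2P k2' _] := kern_L2 gd j x0; have /L2P hf' := hf.
  rewrite -cintegralZ; [|exact: edge_meas|exact: L2eM].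
  by apply: eq_cintegral => y _; ring.
- move=> f j hf; apply: cmeasM; first by apply: cmeas_real; exact: (qp_meas (iV j)).2.
  exact: (green_src_meas gd j (L2_good gd hf)).
Qed.

Local Notation T := (fun g j x => resolvent (fun=> cst 0) (zeta ^+ 2) g j x - resolvent V (zeta ^+ 2) g j x).

Lemma resolvent_sub f : L2 f -> gae_eq (T f) (G0 (fun j x => (V j x)%:C%C * G f j x)).
Proof.
move=> hf j; have h0 := resolventE gd0 hf j; have h1 := resolventE gd hf j.
apply: (@filterS2 _ _ (ae_filter_ringOfSetsType mu) _ _ _ _ h0 h1) => x e0 e1 xe.
by rewrite e0// e1// second_resolvent//; apply/edgeP.
Qed.

Lemma resolvent_sub_bounded : bounded_operator T.
Proof.
have [[a2 al [Ma hMa]] _ _] := resolventP gd0; have [[b2 bl [Mb hMb]] _ _] := resolventP gd.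
split.
- by move=> f hf; apply: L2_sub; [exact: a2|exact: b2].
- move=> c f g hf hg j.
  apply: (@filterS2 _ _ (ae_filter_ringOfSetsType mu) _ _ _ _ (al c f g hf hg j) (bl c f g hf hg j)).
  by move=> x e0 e1 xe; rewrite (e0 xe) (e1 xe); ring.
exists (2 * Ma + 2 * Mb) => f hf; have ha := a2 f hf; have hb := b2 f hf.
apply: (@le_trans _ _ (2 * normsq (resolvent (fun=> cst 0) (zeta ^+ 2) f) + 2 * normsq (resolvent V (zeta ^+ 2) f))).
  exact: normsq_sub.
have e (N : R) : (2 * Ma + 2 * Mb) * N = 2 * (Ma * N) + 2 * (Mb * N) by ring.
rewrite e; apply: lerD.
  by apply: ler_wpM2l; [exact: ler0n|exact: (hMa f hf)].
by apply: ler_wpM2l; [exact: ler0n|exact: (hMb f hf)].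
Qed.

Lemma resolvent_sub_trace_class : trace_class T.
Proof.
split; first exact: resolvent_sub_bounded.
exists (fun f => G0 (fun l y => (qp V l y)%:C%C * f l y)), (fun f j x => (qm V j x)%:C%C * G f j x).
split; [exact: hs_left|exact: hs_right|move=> f hf].
apply: gae_trans (resolvent_sub hf) _; apply: gae_refl => j x x0.
apply: eq_bigr => l _; apply: eq_cintegral => y _; rewrite !mulrA -[_ * (qp V l y)%:C%C * _]mulrA -rmorphM /=.
by have [-> _ _] := qpm V l y.
Qed.

End TraceClass.

Section TraceLimit.
Context {R : realType} {n : nat}.
Local Notation edge := (edge R).
Local Notation nc := (@Normc.normc R).
Local Notation gfun := (gfun R n).
Variables (V : 'I_n -> R -> R) (zeta : R[i]).
Variables (th dth ch dch : gfun) (cc : 'I_n -> 'I_n -> R[i]) (A : R).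
Variables (th0 dth0 ch0 dch0 : gfun) (cc0 : 'I_n -> 'I_n -> R[i]) (A0 : R).
Hypothesis gd : green_data V zeta th dth ch dch cc A.
Hypothesis gd0 : green_data (fun=> cst 0) zeta th0 dth0 ch0 dch0 cc0 A0.
Local Notation G := (green th ch cc).
Local Notation G0 := (green th0 ch0 cc0).
Local Notation ker := (kern th ch cc th ch).
Local Notation ker0 := (kern th0 ch0 cc0 th0 ch0).
Local Notation T := (fun g j x => resolvent (fun=> cst 0) (zeta ^+ 2) g j x - resolvent V (zeta ^+ 2) g j x).
Let iV := gd_V gd.

(* The diagonal of the kernel of [G0 G]. *)
Definition kern_diag j s := \sum_l cintegral edge (fun y => ker0 j s l y * ker j s l y).

Lemma inner_resolvent_sub f : L2 f -> inner (T f) f =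
  \sum_j cintegral edge (fun s => (V j s)%:C%C * (G f j s * G0 (gconj f) j s)).
Proof.
move=> hf; pose Vu : gfun := fun j x => (V j x)%:C%C * G f j x.
have iVu j : cintegrable edge (Vu j) by exact: (potential_green_int gd).
have gVu := L1_good gd0 iVu; have hu := green_dom gd0 gVu.
have hc := L2_conj hf; have hv := green_dom gd0 (L2_good gd0 hc).
have u2 : L2 (G0 Vu) by apply/L2P => j; exact: (dom_L2 hu j).1.
have T2 : L2 (T f) by have [h _ _] := resolvent_sub_bounded gd gd0; exact: h.
have /choice[B hB] := fun j => green_bounded_fun gd j (L2_good gd hf).
have /choice[C hC] := fun j => green_bounded_fun gd0 j (L2_good gd0 hc).
have mG j : cmeas edge (G f j) by exact: (green_src_meas gd j (L2_good gd hf)).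
have mG0 j : cmeas edge (G0 (gconj f) j) by exact: (green_src_meas gd0 j (L2_good gd0 hc)).
rewrite (inner_ae T2 u2 hf (resolvent_sub gd gd0 hf)).
have i1 j : cintegrable edge (fun x => Vu j x * G0 (gconj f) j x).
  by apply: cint_ext (potential_int (iV j) (mG j) (mG0 j) (hB j) (hC j)) => x _; rewrite mulrA.
have i2 j : cintegrable edge (fun x => G0 Vu j x * gconj f j x) by exact: inner_int.
transitivity (\sum_j cintegral edge (fun x => Vu j x * G0 (gconj f) j x)).
  by rewrite (dom_sym hu hv i2 i1).
by apply: eq_bigr => j _; apply: eq_cintegral => x _; rewrite mulrA.
Qed.

Lemma trace_limit e : orthonormal_basis e ->
  (forall j, cintegrable edge (fun s => (V j s)%:C%C * kern_diag j s)) /\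
  slim (fun N => \sum_(0 <= k < N) inner (T (e k)) (e k))
       (\sum_j cintegral edge (fun s => (V j s)%:C%C * kern_diag j s)).
Proof.
move=> eB; have [eL2 eO _] := eB.
pose a k j s := G (e k) j s; pose b k j s := G0 (gconj (e k)) j s.
have aE k j s : a k j s = inner (e k) (gconj (ker j s)) by exact: greenE.
have bE k j s : 0 <= s -> b k j s = inner (ker0 j s) (e k).
  move=> s0; rewrite /b greenE inner_gconj; apply: eq_bigr => l _.
  by apply: eq_cintegral => y _.
pose C := kern_cst (n := n) zeta A0 + kern_cst (n := n) zeta A.
have k2 j s : 0 <= s -> L2 (gconj (ker j s)) /\ normsq (gconj (ker j s)) <= kern_cst (n := n) zeta A.
  by move=> s0; have [h1 h2] := kern_L2 gd j s0; rewrite normsq_conj; split => //; exact: L2_conj.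
have bd N j s : 0 <= s -> nc (\sum_(0 <= k < N) b k j s * a k j s) <= C.
  move=> s0; have [h1 h2] := kern_L2 gd0 j s0; have [h3 h4] := k2 j s s0.
  apply: (le_trans (nc_sum _ _ _)).
  have b1 := bessel eL2 eO N h1; have b2 := bessel eL2 eO N h3.
  apply: (@le_trans _ _ (\sum_(0 <= k < N) nc (cf e (ker0 j s) k) ^+ 2 +
      \sum_(0 <= k < N) nc (cf e (gconj (ker j s)) k) ^+ 2)).
    rewrite -big_split; apply: ler_sum => k _ /=.
    rewrite ncM bE// aE (innerC h3 (eL2 k)) nc_conjc -/(cf e _ k) -/(cf e (ker0 j s) k).
    move: (nc_ge0 (cf e (ker0 j s) k)) (nc_ge0 (cf e (gconj (ker j s)) k)).
    move: (nc _) (nc _) => p q p0 q0.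
    have := sqr_ge0 (p - q); have := sqr_ge0 (p + q); nra.
  by apply: lerD; [exact: le_trans b1 h2|exact: le_trans b2 h4].
have ma k j : cmeas edge (a k j) by exact: (green_src_meas gd j (L2_good gd (eL2 k))).
have mb k j : cmeas edge (b k j) by exact: (green_src_meas gd0 j (L2_good gd0 (L2_conj (eL2 k)))).
have main j : cintegrable edge (fun s => (V j s)%:C%C * kern_diag j s) /\
    slim (fun N => cintegral edge (fun s => (V j s)%:C%C * \sum_(0 <= k < N) b k j s * a k j s))
         (cintegral edge (fun s => (V j s)%:C%C * kern_diag j s)).
  apply: (@cdct _ edge _ _ (fun s => C * `|V j s|) edge_meas).
  - move=> N; apply: cmeasM; first by apply: cmeas_real; exact: rint_meas (iV j).
    by apply: cmeas_sum => k _; apply: cmeasM; [exact: mb|exact: ma].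
  - by apply: rintZ; [exact: edge_meas|apply: rint_norm; exact: iV].
  - move=> N s /edgeP s0; rewrite ncM nc_real mulrC; apply: ler_wpM2r; first exact: normr_ge0.
    exact: bd.
  - move=> s /edgeP s0; have [h1 h2] := kern_L2 gd0 j s0; have [h3 h4] := k2 j s s0.
    have h := parseval eB h1 h3.
    have -> : kern_diag j s = inner (ker0 j s) (gconj (ker j s)).
      by rewrite inner_gconj; apply: eq_bigr => l _; apply: eq_cintegral => y _; rewrite mulrC.
    apply: slimM; first exact: slim_cst.
    by apply: slim_ext h => N; apply: eq_bigr => k _; rewrite bE// aE.
have i1 k j : cintegrable edge (fun s => (V j s)%:C%C * (a k j s * b k j s)).
  have [B hB] := green_bounded_fun gd j (L2_good gd (eL2 k)).
  have [D hD] := green_bounded_fun gd0 j (L2_good gd0 (L2_conj (eL2 k))).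
  exact: potential_int (iV j) (ma k j) (mb k j) hB hD.
split; first by move=> j; exact: (main j).1.
have := @slim_sum R 'I_n (index_enum 'I_n) xpredT _ _ (fun j _ => (main j).2).
apply: slim_ext => N; rewrite (eq_bigr _ (fun k _ => inner_resolvent_sub (eL2 k))) exchange_big.
apply: eq_bigr => j _ /=; rewrite -cintegral_sum; [|exact: edge_meas|by move=> k _; exact: i1].
apply: eq_cintegral => s _; rewrite mulr_sumr; apply: eq_bigr => k _.
by rewrite /a /b [G0 _ j s * _]mulrC.
Qed.

End TraceLimit.

Section EdgeTrace.
Context {R : realType}.
Local Notation mu := (@lebesgue_measure R).
Local Notation edge := (edge R).
Local Notation nc := (@Normc.normc R).
Local Notation ac := (@ac_derivative R).
Variables (V : R -> R) (z : R[i]) (k P : R).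
Variables (th dth ch dch th0 dth0 ch0 dch0 : R -> R[i]).
Hypothesis iV : rint edge V.
Hypothesis k0 : 0 < k.
Hypothesis P0 : 0 <= P.
Hypothesis hth : schrodinger_solution V z th dth.
Hypothesis hch : schrodinger_solution V z ch dch.
Hypothesis hth0 : schrodinger_solution (cst 0) z th0 dth0.
Hypothesis hch0 : schrodinger_solution (cst 0) z ch0 dch0.
Hypothesis wr : forall x, 0 <= x -> ch x * dth x - dch x * th x = -1.
Hypothesis wr0 : forall x, 0 <= x -> ch0 x * dth0 x - dch0 x * th0 x = -1.
Hypothesis thP : forall x, 0 <= x -> nc (th0 x * th x) <= P * expR (- k * x).
Hypothesis chP : forall x, 0 <= x -> nc (ch0 x * ch x) <= P * expR (k * x).
Hypothesis wint : cintegrable edge (fun x => th0 x * dth x - dth0 x * th x).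
Variable kc : R[i].

Let al x := ch0 x * dch x - dch0 x * ch x.
Let be x := th0 x * dth x - dth0 x * th x.
Let a x := cintegral `[0, x] (fun y => ch0 y * ch y) + kc.
Let b x := cintegral `]x, +oo[ (fun y => th0 y * th y).

Let mth : cmeas edge (fun x => th0 x * th x).
Proof. by apply: cmeasM; [exact: ac_meas hth0.1|exact: ac_meas hth.1]. Qed.
Let mch : cmeas edge (fun x => ch0 x * ch x).
Proof. by apply: cmeasM; [exact: ac_meas hch0.1|exact: ac_meas hch.1]. Qed.

Let ith : cintegrable edge (fun x => th0 x * th x).
Proof.
apply: (cint_le _ mth (rintZ P edge_meas (rint_expN k0).1)); first exact: edge_meas.
by move=> x /edgeP; exact: thP.
Qed.

Let ich x : cintegrable `[0, x] (fun y => ch0 y * ch y).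
Proof.
have m : measurable (`[0, x]%classic : set R) by exact: measurable_itv.
apply: (cint_le _ _ (rint_cst x (P * expR (k * x)))); [exact: m|exact: (cmeasS edge_meas (@itv0_sub _ x) mch)|].
move=> y; rewrite /= in_itv /= => /andP[y0 yx]; apply: (le_trans (chP y0)).
by apply: ler_wpM2l => //; rewrite ler_expR ler_pM2l.
Qed.

Let prim_le h x : 0 <= x -> rint edge h -> (forall y, edge y -> 0 <= h y) ->
  \int[mu]_(y in `[0, x]) h y <= \int[mu]_(y in edge) h y /\
  \int[mu]_(y in `]x, +oo[) h y <= \int[mu]_(y in edge) h y.
Proof.
move=> x0 ih h0; rewrite (Rintegral_edge_split x0 ih) /prim.
have p1 : 0 <= \int[mu]_(y in `[0, x]) h y.
  by apply: Rintegral_ge0 => y /itv0_sub; exact: h0.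
have p2 : 0 <= \int[mu]_(y in `]x, +oo[) h y.
  by apply: Rintegral_ge0 => y /(itvy_sub x0); exact: h0.
by split; [rewrite lerDl|rewrite lerDr].
Qed.

Let expR_opp x : expR (- k * x) * expR (k * x) = 1.
Proof. by rewrite -expRD mulNr addNr expR0. Qed.

Let weighted_le (p : R -> R) x (g : R -> R[i]) : 0 <= x ->
  rint edge (fun y => expR (- k * `|x - y|) * p y) -> (forall y, edge y -> 0 <= p y) ->
  (cmeas `[0, x] g -> (forall y, 0 <= y -> nc (g y) <= P * expR (k * y) * p y) ->
    nc (cintegral `[0, x] g) <= P * expR (k * x) * cvl k p x) /\
  (cmeas `]x, +oo[ g -> (forall y, 0 <= y -> nc (g y) <= P * expR (- k * y) * p y) ->
    nc (cintegral `]x, +oo[ g) <= P * expR (- k * x) * cvl k p x).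
Proof.
move=> x0 ip p0.
have h0 y : edge y -> 0 <= expR (- k * `|x - y|) * p y.
  by move=> ye; rewrite mulr_ge0 ?expR_ge0 ?p0.
have [l1 l2] := prim_le x0 ip h0; split=> mg hg.
  have i := rint_edge0 x ip; have m : measurable (`[0, x]%classic : set R) by exact: measurable_itv.
  apply: (@le_trans _ _ (\int[mu]_(y in `[0, x]) (P * expR (k * x) * (expR (- k * `|x - y|) * p y)))).
    apply: (nc_cintegral_le m mg (rintZ _ m i)) => y; rewrite /= in_itv /= => /andP[y0 yx].
    apply: (le_trans (hg y y0)); rewrite ger0_norm ?subr_ge0//; apply: le_of_eq.
    rewrite mulrA -[P * expR (k * x) * _]mulrA -expRD; congr (_ * expR _ * _); ring.
  rewrite RintegralZl; [|exact: m|exact: i].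
  by apply: ler_wpM2l; [rewrite mulr_ge0 ?expR_ge0|exact: l1].
have i := rint_edgey x0 ip; have m : measurable (`]x, +oo[%classic : set R) by exact: measurable_itv.
apply: (@le_trans _ _ (\int[mu]_(y in `]x, +oo[) (P * expR (- k * x) * (expR (- k * `|x - y|) * p y)))).
  apply: (nc_cintegral_le m mg (rintZ _ m i)) => y; rewrite /= in_itv /= andbT => xy.
  have y0 := le_trans x0 (ltW xy).
  apply: (le_trans (hg y y0)); rewrite distrC ger0_norm ?subr_ge0 ?(ltW xy)//; apply: le_of_eq.
  rewrite mulrA -[P * expR (- k * x) * _]mulrA -expRD; congr (_ * expR _ * _); ring.
rewrite RintegralZl; [|exact: m|exact: i].
by apply: ler_wpM2l; [rewrite mulr_ge0 ?expR_ge0|exact: l2].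
Qed.

Let Vn x := `|V x|.
Let cst1_int x : 0 <= x -> rint edge (fun y => expR (- k * `|x - y|) * 1) /\ cvl k (fun=> 1) x <= 2 / k.
Proof.
move=> x0; have [i le] := expR_abs_rint k0 x0; split.
  by apply: rint_ext i => y _; rewrite mulr1.
by apply: le_trans le; apply: le_of_eq; apply: eq_Rintegral => y _; rewrite mulr1.
Qed.

Let ac_be : ac be (fun x => (V x)%:C%C * (th0 x * th x)).
Proof.
by apply: ac_eq (acB (acM hth0.1 hth.2) (acM hth0.2 hth.1)) => x _; rewrite /cst /=; ring.
Qed.

Let ac_al : ac al (fun x => (V x)%:C%C * (ch0 x * ch x)).
Proof.
by apply: ac_eq (acB (acM hch0.1 hch.2) (acM hch0.2 hch.1)) => x _; rewrite /cst /=; ring.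
Qed.

Let be_le x : 0 <= x -> nc (be x) <= P * expR (- k * x) * cvl k Vn x.
Proof.
move=> x0.
have mV : cmeas edge (fun x => (V x)%:C%C * (th0 x * th x)).
  by apply: cmeasM => //; apply: cmeas_real; exact: rint_meas iV.
have le y : 0 <= y -> nc ((V y)%:C%C * (th0 y * th y)) <= P * expR (- k * y) * Vn y.
  by move=> y0; rewrite ncM nc_real mulrC; apply: ler_wpM2r => //; exact: thP.
have i : cintegrable edge (fun x => (V x)%:C%C * (th0 x * th x)).
  apply: (cint_le edge_meas mV (rintZ P edge_meas (rint_norm iV))) => y /edgeP y0.
  have e1 : expR (- k * y) <= 1.
    by rewrite -expR0 ler_expR mulNr oppr_le0 mulr_ge0// ltW.
  apply: (le_trans (le y y0)); apply: ler_wpM2r; first exact: normr_ge0.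
  by rewrite -[leRHS]mulr1; apply: ler_wpM2l.
rewrite (ac_tail0 ac_be i wint x0) ncN.
have iVn := rint_norm iV.
have [_ h] := weighted_le (fun x => (V x)%:C%C * (th0 x * th x)) x0 (cvl_int x k0 iVn) (fun y _ => normr_ge0 _).
by apply: h => //; apply: (cmeasS edge_meas (itvy_sub x0) mV).
Qed.

Let al_le x : 0 <= x -> nc (al x) <= nc (al 0) + P * expR (k * x) * cvl k Vn x.
Proof.
move=> x0; have [i ->] := ac_al x0; apply: (le_trans (ncD _ _)); rewrite lerD2l.
have iVn := rint_norm iV.
have [h _] := weighted_le (fun x => (V x)%:C%C * (ch0 x * ch x)) x0 (cvl_int x k0 iVn) (fun y _ => normr_ge0 _).
apply: h; first exact: cint_meas i.
by move=> y y0; rewrite ncM nc_real mulrC; apply: ler_wpM2r => //; exact: chP.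
Qed.

Let a_le x : 0 <= x -> nc (a x) <= P * expR (k * x) * (2 / k) + nc kc.
Proof.
move=> x0; apply: (le_trans (ncD _ _)); rewrite lerD2r.
have [i le] := cst1_int x0.
have [h _] := weighted_le (fun x => ch0 x * ch x) x0 i (fun y _ => ler01).
apply: (@le_trans _ _ (P * expR (k * x) * cvl k (fun=> 1) x)).
  by apply: h; [exact: cint_meas (ich x)|move=> y y0; rewrite mulr1; exact: chP].
by apply: ler_wpM2l => //; rewrite mulr_ge0 ?expR_ge0.
Qed.

Let b_le x : 0 <= x -> nc (b x) <= P * expR (- k * x) * (2 / k).
Proof.
move=> x0; have [i le] := cst1_int x0.
have [_ h] := weighted_le (fun x => th0 x * th x) x0 i (fun y _ => ler01).
apply: (@le_trans _ _ (P * expR (- k * x) * cvl k (fun=> 1) x)).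
  by apply: h; [exact: cint_meas (cint_edgey x0 ith)|move=> y y0; rewrite mulr1; exact: thP].
by apply: ler_wpM2l => //; rewrite mulr_ge0 ?expR_ge0.
Qed.

Let ac_b : ac b (fun x => - (th0 x * th x)).
Proof.
have h := acB (ac_cst (cintegral edge (fun x => th0 x * th x))) (ac_prim (fun x _ => cint_edge0 x ith)).
apply: ac_ext h => x /edgeP x0; last by rewrite sub0r.
by rewrite (cintegral_edge_split x0 ith) addrAC subrr add0r.
Qed.

Let ac_a : ac a (fun x => ch0 x * ch x).
Proof.
have h := acD (ac_prim (fun x _ => ich x)) (ac_cst kc).
by apply: ac_ext h => x _ //; rewrite addr0.
Qed.

Let iw : cintegrable edge (fun x => be x * a x + al x * b x).
Proof.
pose C := P * (P * (2 / k) + nc kc) + P * (P * (2 / k)).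
pose D := nc (al 0) * (P * (2 / k)).
have [ic _] := cvl_rint k0 (rint_norm iV) (fun y _ => normr_ge0 _).
have ih := rintD edge_meas (rintZ C edge_meas ic) (rintZ D edge_meas (rint_expN k0).1).
apply: (cint_le edge_meas _ ih).
  exact: ac_meas (acD (acM ac_be ac_a) (acM ac_al ac_b)).
move=> x /edgeP x0; apply: (le_trans (ncD _ _)).
apply: (le_trans (lerD (ncM_le (be_le x0) (a_le x0)) (ncM_le (al_le x0) (b_le x0)))).
have c0 : 0 <= cvl k Vn x by apply: cvl_ge0 => y _; exact: normr_ge0.
have e1 := expR_opp x; have e0 := expR_ge0 (- k * x).
have e2 : expR (- k * x) <= 1 by rewrite -expR0 ler_expR mulNr oppr_le0 mulr_ge0// ltW.
have n0 := nc_ge0 kc; have n1 := nc_ge0 (al 0).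
rewrite /C /D -/Vn; have q0 : 0 <= 2 / k by rewrite divr_ge0// ltW.
move: c0 e1 e0 e2 n0 n1 q0.
move: (cvl k Vn x) (expR (- k * x)) (expR (k * x)) (nc kc) (nc (al 0)) (2 / k) => c f g m l q.
move=> c0 e1 f0 f1 m0 l0 q0.
have -> : P * f * c * (P * g * q + m) + (l + P * g * c) * (P * f * q) =
  P * (P * q * (f * g) + f * m) * c + P * (P * q) * (f * g) * c + l * (P * q) * f by ring.
rewrite e1 !mulr1 lerD2r mulrDl; apply: lerD => //.
apply: ler_wpM2r => //; apply: ler_wpM2l => //; rewrite lerD2l.
by rewrite ler_piMl.
Qed.

(* [F - D] is the derivative of [be a + al b]: the remaining terms of the product
   rule combine to [D] because both Wronskians are [-1]. *)
Lemma edge_trace :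
  let F s := (V s)%:C%C * (th0 s * th s * a s + ch0 s * ch s * b s) in
  let D s := ch0 s * th0 s - ch s * th s in
  cintegrable edge F -> cintegrable edge D ->
  cintegral edge F = cintegral edge D -
    (be 0 * kc + al 0 * cintegral edge (fun y => th0 y * th y)).
Proof.
move=> F D iF iD.
have h : ac (fun x => be x * a x + al x * b x) (fun x => F x - D x).
  apply: ac_eq (acD (acM ac_be ac_a) (acM ac_al ac_b)) => x /edgeP x0; rewrite /F /D.
  have e : be x * (ch0 x * ch x) - al x * (th0 x * th x) =
     ch0 x * th0 x * (ch x * dth x - dch x * th x) - ch x * th x * (ch0 x * dth0 x - dch0 x * th0 x).
    by rewrite /be /al; ring.
  rewrite wr// wr0// in e.
  transitivity ((V x)%:C%C * (th0 x * th x * a x + ch0 x * ch x * b x) +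
    (be x * (ch0 x * ch x) - al x * (th0 x * th x))); first by ring.
  by rewrite e; ring.
have := ac_total0 h (cintB edge_meas iF iD) iw.
rewrite cintegralB; [|exact: edge_meas|exact: iF|exact: iD].
have -> : b 0 = cintegral edge (fun y => th0 y * th y).
  rewrite (cintegral_edge_split (lexx 0) ith).
  have -> : cintegral `[0, 0] (fun y => th0 y * th y) = 0.
    by rewrite /cintegral set_itv1 !Rintegral_set1.
  by rewrite add0r.
have -> : a 0 = kc by rewrite /a /cintegral set_itv1 !Rintegral_set1 add0r.
by move=> /eqP; rewrite subr_eq addrC => /eqP.
Qed.

End EdgeTrace.

(** * Summation over the edges *)

Section TraceSum.
Context {R : realType} {n : nat}.
Local Notation edge := (edge R).
Local Notation nc := (@Normc.normc R).
Local Notation Im := complex.Im.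
Local Notation gfun := (gfun R n).
Variables (V : 'I_n -> R -> R) (zeta : R[i]).
Variables (th dth ch dch : gfun) (cc : 'I_n -> 'I_n -> R[i]) (A : R).
Variables (th0 dth0 ch0 dch0 : gfun) (cc0 : 'I_n -> 'I_n -> R[i]) (A0 : R).
Hypothesis gd : green_data V zeta th dth ch dch cc A.
Hypothesis gd0 : green_data (fun=> cst 0) zeta th0 dth0 ch0 dch0 cc0 A0.
Local Notation ker := (kern th ch cc th ch).
Local Notation ker0 := (kern th0 ch0 cc0 th0 ch0).
Local Notation diag := (kern_diag th ch cc th0 ch0 cc0).

Let tau l := cintegral edge (fun y => th0 l y * th l y).
Let kc j := \sum_(l < n | l != j) cc0 j l * cc j l * tau l.

Let ith l : cintegrable edge (fun y => th0 l y * th l y).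
Proof. by apply: L2eM; [exact: (th_L2 gd0 l).1|exact: (th_L2 gd l).1]. Qed.

Lemma kern_diagE j s : 0 <= s -> diag j s =
  th0 j s * th j s * (cintegral `[0, s] (fun y => ch0 j y * ch j y) + kc j) +
  ch0 j s * ch j s * cintegral `]s, +oo[ (fun y => th0 j y * th j y).
Proof.
move=> s0; rewrite /kern_diag (bigD1 j)//=.
have -> : \sum_(l < n | l != j) cintegral edge (fun y => ker0 j s l y * ker j s l y) =
    th0 j s * th j s * kc j.
  rewrite /kc mulr_sumr; apply: eq_bigr => l lj.
  transitivity (cintegral edge (fun y => (th0 j s * th j s * (cc0 j l * cc j l)) * (th0 l y * th l y))).
    by apply: eq_cintegral => y _; rewrite /kern (negPf lj); ring.
  by rewrite cintegralZ; [rewrite /tau; ring|exact: edge_meas|exact: ith].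
rewrite mulrDr [RHS]addrAC; congr (_ + _).
have [/L2P k0 _] := kern_L2 gd0 j s0; have [/L2P k1 _] := kern_L2 gd j s0.
have ik := L2eM (k0 j) (k1 j).
rewrite (cintegral_edge_split s0 ik).
have e0 : cintegral `]s, +oo[ (fun y => ker0 j s j y * ker j s j y) =
    ch0 j s * ch j s * cintegral `]s, +oo[ (fun y => th0 j y * th j y).
  rewrite -cintegralZ; [|exact: measurable_itv|exact: cint_edgey s0 (ith j)].
  apply: eq_cintegral => y; rewrite /= in_itv /= andbT => sy.
  by rewrite /kern eqxx leNgt sy /=; ring.
rewrite e0; congr (_ + _).
have ich : cintegrable `[0, s] (fun y => ch0 j y * ch j y).
  have h := acM (proj1 (gd_ch gd0 j)) (proj1 (gd_ch gd j)).
  have [M hM] := ac_bounded0 s h.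
  apply: (cint_le _ _ (rint_cst s M)); first exact: measurable_itv.
    exact: (cmeasS (measurable_itv _) (@itv0_sub _ s) (ac_meas h)).
  by move=> y; rewrite /= in_itv /=; exact: hM.
rewrite -cintegralZ; [|exact: measurable_itv|exact: ich].
apply: eq_cintegral => y; rewrite /= in_itv /= => /andP[_ ys].
by rewrite /kern eqxx ys; ring.
Qed.

Let be j x := th0 j x * dth j x - dth0 j x * th j x.
Let al j x := ch0 j x * dch j x - dch0 j x * ch j x.

Lemma vertex_al j : al j 0 = - \sum_(l < n | l != j) cc0 j l * cc j l * be l 0.
Proof.
rewrite /al (gd_dch0 gd) (gd_dch0 gd0) mulrN mulNr opprK mulr_sumr mulr_suml -sumrN -sumrN -big_split /=.
apply: eq_bigr => l lj; rewrite (gd_ch0 gd lj) (gd_ch0 gd0 lj) /be; ring.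
Qed.

Lemma vertex_cancel : \sum_j (be j 0 * kc j + al j 0 * tau j) = 0.
Proof.
rewrite big_split /= -[RHS](subrr (\sum_(j < n) be j 0 * kc j)); congr (_ + _).
transitivity (- \sum_j (\sum_(l < n | l != j) cc0 j l * cc j l * be l 0) * tau j).
  by rewrite -sumrN; apply: eq_bigr => j _; rewrite vertex_al mulNr.
congr (- _); under eq_bigr do rewrite mulr_suml.
rewrite (exchange_big_dep xpredT)//=; apply: eq_bigr => l _.
rewrite /kc mulr_sumr; apply: eq_big => [j|j lj]; first by rewrite eq_sym.
by rewrite (gd_ccC gd j l) (gd_ccC gd0 j l); ring.
Qed.

Lemma trace_sum :
  (forall j, cintegrable edge (fun s => (V j s)%:C%C * diag j s)) ->
  (forall j, cintegrable edge (fun s => ch0 j s * th0 j s - ch j s * th j s)) ->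
  \sum_j cintegral edge (fun s => (V j s)%:C%C * diag j s) =
  \sum_j cintegral edge (fun s => ch0 j s * th0 j s - ch j s * th j s).
Proof.
move=> iD iS; have z0 := gd_im gd; have A1 := gd_A gd; have A2 := gd_A gd0.
have e j : cintegral edge (fun s => (V j s)%:C%C * diag j s) =
    cintegral edge (fun s => ch0 j s * th0 j s - ch j s * th j s) - (be j 0 * kc j + al j 0 * tau j).
  have k0 : 0 < 2 * Im zeta by rewrite mulr_gt0.
  have P0 : 0 <= A0 * A by exact: mulr_ge0.
  have thP x : 0 <= x -> nc (th0 j x * th j x) <= A0 * A * expR (- (2 * Im zeta) * x).
    move=> x0; have [h1 _ _ _] := gd_le gd j x0; have [h2 _ _ _] := gd_le gd0 j x0.
    apply: (le_trans (ncM_le h2 h1)); apply: le_of_eq.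
    by rewrite mulrACA -expRD; congr (_ * expR _); ring.
  have chP x : 0 <= x -> nc (ch0 j x * ch j x) <= A0 * A * expR (2 * Im zeta * x).
    move=> x0; have [_ _ h1 _] := gd_le gd j x0; have [_ _ h2 _] := gd_le gd0 j x0.
    apply: (le_trans (ncM_le h2 h1)); apply: le_of_eq.
    by rewrite mulrACA -expRD; congr (_ * expR _); ring.
  have wint : cintegrable edge (fun x => th0 j x * dth j x - dth0 j x * th j x).
    have [t1 t2] := th_L2 gd j; have [t3 t4] := th_L2 gd0 j.
    by apply: cintB; [exact: edge_meas|exact: L2eM|exact: L2eM].
  have := @edge_trace _ _ _ _ _ _ _ _ _ _ _ _ _ (gd_V gd j) k0 P0 (gd_th gd j) (gd_ch gd j)
    (gd_th gd0 j) (gd_ch gd0 j) (gd_wr gd j) (gd_wr gd0 j) thP chP wint (kc j).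
  cbv zeta beta; set F := (X in cintegrable _ X -> _).
  have FE x : edge x -> (V j x)%:C%C * diag j x = F x.
    by move=> /edgeP x0; rewrite kern_diagE.
  rewrite (eq_cintegral FE) => h; apply: h; last exact: iS.
  exact: cint_ext FE (iD j).
by under eq_bigr do rewrite e; rewrite sumrB vertex_cancel subr0.
Qed.

End TraceSum.

Section LogDerivative.
Context {R : realType} {n : nat}.
Local Notation edge := (edge R).
Local Notation Im := complex.Im.
Local Notation I := ('i%C : R[i]).
Local Notation gfun := (gfun R n).

Lemma dif_unique (f : R[i] -> R[i]) z l l' : dif f z l -> dif f z l' -> l = l'.
Proof.
by move=> h h'; have [_ <-] := dif_derivable h; have [_ <-] := dif_derivable h'.
Qed.

Lemma difZ (a : R[i]) f z l : dif f z l -> dif (fun x => a * f x) z (a * l).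
Proof.
move=> h; have := difM (dif_cst a z) h.
by have -> : 0 * f z + a * l = a * l by ring.
Qed.

(* Two second solutions with independent initial data determine the
   derivatives of both [th 0] and [dth 0]. *)
Lemma jost_dif_data q zeta (th dth : R -> R[i] -> R[i]) (a b : R[i]) : rint edge q -> 0 < Im zeta ->
  (forall z, 0 < Im z -> jost_solution q z (th ^~ z) (dth ^~ z)) ->
  a * dth 0 zeta - b * th 0 zeta = -1 ->
  exists l1 l2, dif (th 0) zeta l1 /\ dif (dth 0) zeta l2.
Proof.
move=> iq z0 hj ab; set w := th 0 zeta; set dw := dth 0 zeta.
have ex a' b' : a' * dw - b' * w = -1 -> exists l, dif (fun z => a' * dth 0 z - b' * th 0 z) zeta l.
  move=> ab'; have [ch [dch [M [hp c0 d0]]]] := edge_pair_exists iq z0 (hj _ z0) ab'.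
  have [_ h] := jost_dif iq z0 hj hp.
  by eexists; apply: dif_ext h => z; rewrite c0 d0.
have [l hl] := ex a b ab.
have ab2 : (a + w) * dw - (b + dw) * w = -1 by rewrite -ab; rewrite -/w -/dw; ring.
have [l' hl'] := ex _ _ ab2.
have hm := difD hl' (difZ (-1) hl).
have det : b * w - a * dw = 1.
  by rewrite -[RHS]opprK -ab opprB.
exists (- w * l + a * (l' + -1 * l)), (- dw * l + b * (l' + -1 * l)); split.
  apply: dif_ext (difD (difZ (- w) hl) (difZ a hm)) => z.
  transitivity ((b * w - a * dw) * th 0 z); last by rewrite det mul1r.
  by ring.
apply: dif_ext (difD (difZ (- dw) hl) (difZ b hm)) => z.
transitivity ((b * w - a * dw) * dth 0 z); last by rewrite det mul1r.
by ring.
Qed.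

Lemma kw_dif_jost V (theta dtheta : 'I_n -> R -> R[i] -> R[i]) zeta (ch dch : gfun) :
  let th j x := theta j x zeta in let dth j x := dtheta j x zeta in
  let w := fun j => th j 0 in let dw := fun j => dth j 0 in
  (forall j, rint edge (V j)) -> 0 < Im zeta ->
  (forall j z, 0 < Im z -> jost_solution (V j) z (theta j ^~ z) (dtheta j ^~ z)) ->
  kw w dw != 0 ->
  (forall j, ch j 0 = kch w dw j) -> (forall j, dch j 0 = kdch w dw j) ->
  (forall j, exists M, edge_pair (V j) zeta (th j) (dth j) (ch j) (dch j) M) ->
  let Psi j x := -1 - 2 * (I * zeta) * (ch j x * th j x) in
  (forall j, cintegrable edge (Psi j)) /\
  dif (Kw theta dtheta) zeta
    (- kw w dw * \sum_j (- (2 * zeta)^-1 + I * cintegral edge (Psi j))).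
Proof.
move=> th dth w dw iV z0 hj k0 c0 d0 hp Psi.
have hd j : cintegrable edge (Psi j) /\ dif (fun z => kch w dw j * dtheta j 0 z - kdch w dw j * theta j 0 z) zeta
    (- (2 * zeta)^-1 + I * cintegral edge (Psi j)).
  have [M hM] := hp j; have [h1 h2] := jost_dif (iV j) z0 (hj j) hM.
  by split; [exact: h1|apply: dif_ext h2 => z; rewrite c0 d0].
split; first by move=> j; exact: (hd j).1.
have /choice[l1 /choice[l2 hl]] : forall j, exists l1 l2,
    dif (theta j 0) zeta l1 /\ dif (dtheta j 0) zeta l2.
  by move=> j; apply: jost_dif_data (iV j) z0 (hj j) (kwr k0 j).
have lE j : kch w dw j * l2 j - kdch w dw j * l1 j = - (2 * zeta)^-1 + I * cintegral edge (Psi j).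
  apply: dif_unique (hd j).2.
  have := difD (difZ (kch w dw j) (hl j).2) (difZ (- kdch w dw j) (hl j).1).
  by rewrite mulNr; apply: dif_ext => z; rewrite mulNr.
rewrite -(eq_bigr _ (fun j _ => lE j)) -(kw_dif k0); apply: dif_sum => j _.
have := dif_prod (filter_uniq (fun k => k != j) (index_enum_uniq 'I_n)) (fun k => (hl k).1).
rewrite big_filter => hpr.
have := difM (hl j).2 hpr.
have -> : \prod_(k <- [seq k <- index_enum 'I_n | k != j]) theta k 0 zeta = \prod_(k < n | k != j) w k.
  by rewrite big_filter.
under eq_bigr do rewrite big_filter_cond.
by apply: dif_ext => z; rewrite big_filter.
Qed.

End LogDerivative.

Section FreeJost.
Context {R : realType} {n : nat}.
Local Notation edge := (edge R).
Local Notation I := ('i%C : R[i]).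

Definition free_theta (j : 'I_n) (x : R) (z : R[i]) := ex (I * z) x.
Definition free_dtheta (j : 'I_n) (x : R) (z : R[i]) := I * z * ex (I * z) x.

Lemma free_jost j z : jost_solution (cst 0) z (free_theta j ^~ z) (free_dtheta j ^~ z).
Proof.
split; first split.
- exact: ac_ex.
- apply: ac_eq (acZ (I * z) (ac_ex (I * z))) => x _.
  by rewrite /free_theta mulrA -expr2 ci_sqr /cst /=; ring.
apply: (@tends_ext _ (fun=> 1) _ 1); last exact: tends_cst.
by move=> x _; rewrite /free_theta exE [I * x%:C%C * z]mulrAC divff// cexp_neq0.
Qed.

Lemma free_Kw z : Kw free_theta free_dtheta z = n%:R * I * z.
Proof.
rewrite /Kw (eq_bigr (fun=> I * z)); last first.
  by move=> j _; rewrite /free_dtheta /free_theta ex0 mulr1 big1 ?mulr1.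
by rewrite sumr_const card_ord -[LHS]mulr_natl mulrA.
Qed.

End FreeJost.

Theorem theorem1p1 (R : realType) (n : nat) (hn : (2 <= n)%N)
  (V : 'I_n -> R -> R)
  (hV : forall j, (@lebesgue_measure R).-integrable (edge R) (EFin \o V j))
  (theta dtheta : 'I_n -> R -> R[i] -> R[i])
  (htheta : jost_family V theta dtheta)
  (zeta : R[i]) (hIm : 0 < complex.Im zeta)
  (hrho : resolvent_set V (zeta ^+ 2)) :
  let F : R[i]^o -> R[i]^o := fun z => Kw theta dtheta z / z in
  [/\ derivable F zeta 1, F zeta != 0 &
      has_trace
        (fun g j x => resolvent (fun=> cst 0) (zeta ^+ 2) g j x
                      - resolvent V (zeta ^+ 2) g j x)
        ((2 * zeta)^-1 * (derive1 F zeta / F zeta))].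
Proof.
move=> F.
have z0 : zeta != 0 by apply: contraTneq hIm => ->; rewrite /= ltxx.
have nz (z : R[i]) : 0 < complex.Im z -> z != 0.
  by move=> h; apply: contraTneq h => ->; rewrite /= ltxx.
have hj j z : 0 < complex.Im z -> jost_solution (V j) z (theta j ^~ z) (dtheta j ^~ z).
  by move=> iz; apply: htheta; [exact: ltW|exact: nz].
pose th j x := theta j x zeta; pose dth j x := dtheta j x zeta.
pose w (j : 'I_n) := th j 0; pose dw (j : 'I_n) := dth j 0.
have k0 : kw w dw != 0 by exact: (kw_neq0 hV hIm (fun j => hj j zeta hIm) hn hrho).
have [ch [dch [A [gd c0 d0 hp]]]] := green_data_exists hV hIm (fun j => hj j zeta hIm) k0.
pose th0 (j : 'I_n) x := free_theta j x zeta; pose dth0 (j : 'I_n) x := free_dtheta j x zeta.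
pose w0 (j : 'I_n) := th0 j 0; pose dw0 (j : 'I_n) := dth0 j 0.
have hV0 (j : 'I_n) : (@lebesgue_measure R).-integrable (edge R) (EFin \o (cst 0 : R -> R)).
  exact: integrable0.
have n0 : (n%:R : R[i]) != 0 by rewrite pnatr_eq0 -lt0n (leq_trans _ hn).
have i0 : ('i%C : R[i]) != 0 by rewrite -nc_gt0 nc_i.
have k00 : kw w0 dw0 != 0.
  by rewrite -[kw w0 dw0]/(Kw free_theta free_dtheta zeta) free_Kw !mulf_neq0.
have [ch0 [dch0 [A0 [gd0 c00 d00 hp0]]]] :=
  green_data_exists (V := fun=> cst 0) hV0 hIm (fun j => free_jost j zeta) k00.
have [iP dP] := kw_dif_jost hV hIm hj k0 c0 d0 hp.
have [iP0 dP0] := kw_dif_jost (V := fun=> cst 0) hV0 hIm (fun j z _ => free_jost j z) k00 c00 d00 hp0.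
set S := \sum_j _ in dP; set S0 := \sum_j _ in dP0.
have S0E : S0 = - zeta^-1.
  have h : dif (Kw (@free_theta R n) free_dtheta) zeta (n%:R * 'i%C).
    rewrite -[n%:R * _]mulr1; apply: dif_ext (difZ (n%:R * 'i%C) (dif_id zeta)) => z.
    by rewrite free_Kw.
  have := dif_unique dP0 h; rewrite -[kw _ _]/(Kw (@free_theta R n) free_dtheta zeta) free_Kw => e.
  apply: (mulfI (x := n%:R * 'i%C * zeta)); first by rewrite !mulf_neq0.
  apply: oppr_inj; rewrite -mulNr e; field.
  exact: z0.
have P0 : Kw theta dtheta zeta != 0 by exact: k0.
have hF : dif F zeta (- kw w dw * S * zeta^-1 + Kw theta dtheta zeta * - zeta ^- 2).
  exact: difM dP (difV z0).
have [dF dFE] := dif_derivable hF.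
have F0 : F zeta != 0 by rewrite /F mulf_neq0 ?invr_eq0.
pose D j s := ch0 j s * th0 j s - ch j s * th j s.
have c2 : 2 * ('i%C * zeta) != 0 by rewrite !mulf_neq0// pnatr_eq0.
have DE j s : D j s = (- (2 * ('i%C * zeta))^-1) * ((-1 - 2 * ('i%C * zeta) * (ch0 j s * th0 j s)) -
    (-1 - 2 * ('i%C * zeta) * (ch j s * th j s))).
  rewrite /D; move: (ch0 j s) (th0 j s) (ch j s) (th j s) c2 => p q r t c2'; field.
  by rewrite z0 i0.
have iB j := cintB edge_meas (iP0 j) (iP j).
have iD j : cintegrable (edge R) (D j).
  by apply: cint_ext (cintZ _ edge_meas (iB j)) => s _; exact: esym (DE j s).
have tr : \sum_j cintegral (edge R) (D j) = (2 * zeta)^-1 * (S0 - S).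
  rewrite /S0 /S -sumrB mulr_sumr; apply: eq_bigr => j _.
  rewrite (eq_cintegral (fun s _ => DE j s)) cintegralZ; [|exact: edge_meas|exact: iB].
  rewrite cintegralB; [|exact: edge_meas|exact: iP0|exact: iP].
  move: (cintegral _ _) (cintegral _ _) => p q.
  have ii : 'i%C * 'i%C = -1 :> R[i] by rewrite -expr2 sqr_i.
  have -> : (2 * ('i%C * zeta))^-1 = - 'i%C * (2 * zeta)^-1.
    rewrite mulrCA invfM; congr (_ * _); apply: (mulfI i0).
    by rewrite mulfV// mulrN ii opprK.
  by ring.
split; [exact: dF|exact: F0|split; first exact: resolvent_sub_trace_class gd gd0].
move=> e he; have [iVD] := trace_limit gd gd0 he.
rewrite (trace_sum gd gd0 iVD iD) tr S0E dFE.
have -> : (2 * zeta)^-1 * (- zeta^-1 - S) =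
  (2 * zeta)^-1 * ((- kw w dw * S * zeta^-1 + Kw theta dtheta zeta * - zeta ^- 2) / F zeta).
  congr (_ * _); rewrite /F -[kw w dw]/(Kw theta dtheta zeta).
  move: (Kw theta dtheta zeta) P0 (S) => p p0 q; field.
  by rewrite p0 z0.
by [].
Qed.
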